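(* If the flux $f$ is not convex, dissipative solutions do not depend continuously on the initial data in general. Precisely, for the flux $f(u)=u^3$ there exist times $0<t_0<T$, an initial datum $\bar u$ and a family of initial data $\bar u^\varepsilon$, for $\varepsilon>0$ small (all of them absolutely continuous on $\mathbb R_+$, vanishing at $x=0$, with derivative in $L^2(\mathbb R_+)$), together with dissipative solutions $v$ and $u^\varepsilon$ on $[0,T]\times\mathbb R_+$ of $$u_t+f(u)_x=\tfrac12\int_0^xf''(u)u_x^2\,dx,\qquad u(t,0)=0,$$ with initial data $v(0,\cdot)=\bar u$ and $u^\varepsilon(0,\cdot)=\bar u^\varepsilon$, such that, as $\varepsilon\to0$, $$\|\bar u^\varepsilon-\bar u\|_{C^0}\to0,\qquad \|\bar u^\varepsilon_x-\bar u_x\|_{L^2}\to0,$$ but for every $t\in\,]t_0,T]$ there is $x^*(t)\ge 0$ such that, for all $x>x^*(t)$, the limit $\lim_{\varepsilon\to0+}u^\varepsilon(t,x)$ exists and is different from $v(t,x)$.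
   Context: Notation: $\mathbb R_+=[0,\infty[$. Solution: a function $u=u(t,x)$ on $[0,T]\times\mathbb R_+$ is a solution of the initial-boundary value problem with data $u(0,x)=\bar u(x)$, $u(t,0)=0$ if: (a) $u$ is locally H\''older continuous w.r.t. both variables; the initial and boundary conditions hold pointwise; for each $t$ the map $x\mapsto u(t,x)$ is absolutely continuous with $u_x(t,\cdot)\in L^2_{loc}(\mathbb R_+)$; (b) for any $M>0$, restricting $u$ to $x\in[0,M]$, the map $t\mapsto u(t,\cdot)\in L^2([0,M])$ is absolutely continuous and satisfies $$\frac{d}{dt}u(t,\cdot)=-f'(u)u_x+\frac12\int_0^{\,\cdot}f''(u)u_x^2\,dx$$ for a.e. $t\in[0,T]$, as an equality of functions in $L^2([0,M])$. Dissipative solution: a solution $u$ is dissipative if the absolutely continuous measures $\mu_{(t)}$ defined by $d\mu_{(t)}=u_x^2(t,\cdot)\,dx$ satisfy $$\int\phi(t_2,\cdot)\,d\mu_{(t_2)}-\int\phi(t_1,\cdot)\,d\mu_{(t_1)}\le\int_{t_1}^{t_2}\left[\int\big[\phi_t(t,\cdot)+\phi_x(t,\cdot)f'(u(t,\cdot))\big]\,d\mu_{(t)}\right]dt$$ for every $t_2>t_1\ge0$ in the time interval of existence and every nonnegative $C^1$ compactly supported function $\phi=\phi(t,x)$ on $\mathbb R_+\times\mathbb R_+$. *)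

(* Defs.v *)
From HB Require Import structures.
From mathcomp Require Import all_boot all_order all_algebra.
From mathcomp Require Import all_classical all_reals all_analysis.

Set Implicit Arguments.
Unset Strict Implicit.
Unset Printing Implicit Defensive.

Import Order.TTheory GRing.Theory Num.Theory.
Import numFieldNormedType.Exports.

Local Open Scope ring_scope.
Local Open Scope classical_set_scope.

(* Functions on R_+ or [0, T] x R_+ are represented by total functions on R or
   R x R; only their values on the stated domain are ever constrained.  For an
   absolutely continuous g, the a.e. defined derivative g_x is derive1 g, which
   takes a default value at the points where g is not derivable. *)

Definition L2norm (R : realType) (D : set R) (g : R -> R) : \bar R :=
  ('N[@lebesgue_measure R]_(2%:E)[EFin \o (g \_ D)])%E.

(* Membership in Lfun means measurable with a finite norm. *)
Definition in_L2 (R : realType) (D : set R) (g : R -> R) : Prop :=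
  (g \_ D : measurableTypeR R -> R) \in Lfun (@lebesgue_measure R) 2%:E.

Definition C0norm (R : realType) (D : set R) (g : R -> R) : \bar R :=
  ereal_sup [set `|g x|%:E | x in D].

(* Absolute continuity on [a, b] of a curve F in a space V with distance dist.
   The distance takes values in \bar R so that V can be the space of functions
   on R with the L^2 distance over a set. *)
Definition abs_continuous (R : realType) (V : Type) (dist : V -> V -> \bar R)
    (a b : R) (F : R -> V) : Prop :=
  forall e : R, 0 < e -> exists2 d : R, 0 < d &
    forall (n : nat) (s t : 'I_n -> R),
      (forall i, [/\ a <= s i, s i <= t i & t i <= b]) ->
      trivIset [set: 'I_n] (fun i => `]s i, t i[) ->
      \sum_(i < n) (t i - s i) < d ->
      (\sum_(i < n) dist (F (s i)) (F (t i)) < e%:E)%E.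

Definition dist_R (R : realType) (x y : R) : \bar R := `|x - y|%:E.

Definition dist_L2 (R : realType) (D : set R) (g h : R -> R) : \bar R :=
  L2norm D (g \- h).

(* On the unbounded half-line, absolute continuity is understood on every
   compact interval.  When moreover g_x is in L^2(R_+), this is the same as
   requiring a uniform modulus on the whole half-line (Cauchy-Schwarz). *)
Definition abs_continuous_Rplus (R : realType) (g : R -> R) : Prop :=
  forall M : R, 0 < M -> abs_continuous (@dist_R R) 0 M g.

Definition loc_hoelder (R : realType) (T : R) (u : R -> R -> R) : Prop :=
  forall M : R, 0 < M -> exists alpha C : R, [/\ 0 < alpha, alpha <= 1 &
    forall t s x y : R, 0 <= t <= T -> 0 <= s <= T ->
      0 <= x <= M -> 0 <= y <= M ->
      `|u t x - u s y| <= C * (`|t - s| `^ alpha + `|x - y| `^ alpha)].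

(* The function  - f'(w) w_x + 1/2 \int_0^x f''(w) w_x^2 dy. *)
Definition evolution_rhs (R : realType) (f w : R -> R) (x : R) : R :=
  - (derive1 f (w x) * derive1 w x) +
  2^-1 * \int[@lebesgue_measure R]_(y in `[0, x])
           (derive1n 2 f (w y) * derive1 w y ^+ 2).

Definition is_solution (R : realType) (f : R -> R) (T : R) (ubar : R -> R)
    (u : R -> R -> R) : Prop :=
  [/\ loc_hoelder T u,
      forall x : R, 0 <= x -> u 0 x = ubar x,
      forall t : R, 0 <= t <= T -> u t 0 = 0,
      forall t : R, 0 <= t <= T -> abs_continuous_Rplus (u t) /\
        (forall M : R, 0 < M -> in_L2 `[0, M] (derive1 (u t))) &
      forall M : R, 0 < M ->
        abs_continuous (dist_L2 `[0, M]) 0 T u /\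
        {ae @lebesgue_measure R, forall t : R, 0 <= t <= T ->
          in_L2 `[0, M] (evolution_rhs f (u t)) /\
          L2norm `[0, M]
            (fun x => h^-1 * (u (t + h) x - u t x) - evolution_rhs f (u t) x)
            @[h --> 0^'] --> 0%E} ].

Definition d_t (R : realType) (phi : R -> R -> R) (t x : R) : R :=
  derive1 (phi ^~ x) t.

Definition d_x (R : realType) (phi : R -> R -> R) (t x : R) : R :=
  derive1 (phi t) x.

(* A C^1 compactly supported function on the closed quadrant R_+ x R_+ is the
   restriction of a C^1 compactly supported function on R x R; in particular
   it need not vanish on the boundary of the quadrant. *)
Definition test_function (R : realType) (phi : R -> R -> R) : Prop :=
  [/\ forall t x : R, derivable (phi ^~ x) t 1 /\ derivable (phi t) x 1,
      continuous (fun p : R * R => d_t phi p.1 p.2),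
      continuous (fun p : R * R => d_x phi p.1 p.2),
      compact (closure [set p : R * R | phi p.1 p.2 != 0]) &
      forall t x : R, 0 <= t -> 0 <= x -> 0 <= phi t x].

(* The integral of g against the measure w_x^2 dx on R_+. *)
Definition energy_int (R : realType) (w g : R -> R) : R :=
  \int[@lebesgue_measure R]_(x in `[0, +oo[) (g x * derive1 w x ^+ 2).

(* The integrability clause says that the right-hand side of the inequality is
   meaningful, since a real-valued integral takes a default value on
   functions that are not integrable. *)
Definition is_dissipative_solution (R : realType) (f : R -> R) (T : R)
    (ubar : R -> R) (u : R -> R -> R) : Prop :=
  is_solution f T ubar u /\
  forall (phi : R -> R -> R) (t1 t2 : R), test_function phi ->
    0 <= t1 -> t1 < t2 -> t2 <= T ->
    let flux t :=
      energy_int (u t) (fun x => d_t phi t x + d_x phi t x * derive1 f (u t x)) in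
    (@lebesgue_measure R).-integrable `[t1, t2] (EFin \o flux) /\
    energy_int (u t2) (phi t2) - energy_int (u t1) (phi t1) <=
      \int[@lebesgue_measure R]_(t in `[t1, t2]) flux t.

Definition admissible_datum (R : realType) (ubar : R -> R) : Prop :=
  [/\ abs_continuous_Rplus ubar, ubar 0 = 0 & in_L2 `[0, +oo[ (derive1 ubar)].

(* Main.v *)
Require Import Defs.
From mathcomp Require Import all_boot all_order all_algebra.
From mathcomp Require Import all_classical all_reals all_analysis.
From mathcomp Require Import measurable_realfun ring lra.
Set Implicit Arguments.
Unset Strict Implicit.
Unset Printing Implicit Defensive.
Import Order.TTheory GRing.Theory Num.Theory.
Import numFieldNormedType.Exports.
Local Open Scope ring_scope.
Local Open Scope classical_set_scope.

(* Along the characteristics dx/dt = 3 u^2 the energy u_x^2 dx is transported.  In the coordinate z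
   with dz = u_x^2 dx, the position X(s, z) and the value U(s, z) = u(s, X(s, z)) satisfy
   X_z = U_z^2 and X_s = 3 U^2, and the equation becomes linear: U_sz = 3 U.  It is solved by
   x bes_1(3 s x), where bes_m(z) is the sum of z^k / (k! (k + m)!), hence by combinations of the
   translates of this function, cut off for x <= 0.  Explicit coefficients give data for which, at
   the time s = 0 (that is, t = t0), the energy carried by 2 < z < 3 is concentrated at one point,
   where u = 0 and thus f''(u) = 0.  The solution v forgets this energy at s = 0.  A perturbation
   of size eps of the coefficients prevents the concentration, so that the perturbed solutions
   conserve their energy; as eps -> 0 they tend, to the right of the energy, to U(s, 3) instead
   of U(s, 2), and U(s, .) is strictly decreasing on [2, 3] for s <> 0. *)

(** * Bessel-type series *)

(** With the coefficients -1, 2, -(1 + e) at the shifts 0, 1, 2, the slope U_z at s = 0 is -1, 1, -e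
    on the three unit pieces, so that U(0, 2) = 0. On the third piece with e = 0, U_z is minus a
    second difference of [bes 0] with step 3|s|. By convexity it is negative, of order s^2 at least,
    for s <> 0; a positive e adds a negative term that survives at s = 0. The obstacle is that v
    must remain a solution through s = 0, although v_x = 1 / U_z may grow like s^-2 on the third
    piece as s -> 0-. There U vanishes at s = 0, hence U = O(s), and f'(u) = 3 u^2 = O(s^2)
    compensates the slope: f'(v) v_x stays bounded and v is Lipschitz in time. At s = 0 itself the
    third piece occupies a single point, which no absolutely continuous measure u_x^2 dx can charge,
    so v has already lost it at that instant. *)

Section bessel.
Variable R : realType.
Implicit Types (m : nat) (z : R).

Definition bes_coef m : R^nat := fun k => (k`! * (k + m)`!)%:R^-1.

(** For z > 0 this is z^(-m/2) I_m(2 sqrt z), with I_m the modified Bessel function. In this form it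
    is entire in z, so that negative times s are covered too. *)
Definition bes m z := limn (pseries (bes_coef m) z).

Lemma bes_coef_ge0 m k : 0 <= bes_coef m k.
Proof. by rewrite /bes_coef invr_ge0. Qed.

Lemma is_cvg_bes m z : cvgn (pseries (bes_coef m) z).
Proof.
apply: normed_cvg; apply: (@series_le_cvg _ _ (exp_coeff `|z|)).
- by move=> n /=; exact: normr_ge0.
- by move=> n; rewrite /exp_coeff/= divr_ge0// exprn_ge0.
- move=> n /=; rewrite /exp_coeff/= normrM normrX (ger0_norm (bes_coef_ge0 _ _)).
  rewrite mulrC ler_wpM2l ?exprn_ge0// /bes_coef lef_pV2 ?posrE ?ltr0n ?muln_gt0 ?fact_gt0//.
  by rewrite ler_nat leq_pmulr// fact_gt0.
- exact: is_cvg_series_exp_coeff.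
Qed.

Lemma bes_coef_diffs m : pseries_diffs (bes_coef m) = bes_coef m.+1.
Proof.
apply/funext => k; rewrite /pseries_diffs /bes_coef factS addSnnS -mulnA natrM invfM.
by rewrite mulVKf.
Qed.

Lemma is_derive_bes m z : is_derive z 1 (bes m) (bes m.+1 z).
Proof.
have := @pseries_snd_diffs R (bes_coef m) (`|z| + 1) z.
rewrite !bes_coef_diffs; apply; try exact: is_cvg_bes.
by rewrite [ltRHS]ger0_norm ?addr_ge0// ltrDl.
Qed.

Lemma bes0 m : bes m 0 = m`!%:R^-1.
Proof.
apply: lim_near_cst => //.
near=> n; rewrite -[n]prednK; last by near: n.
rewrite /pseries /series /= big_nat_recl// expr0 mulr1 /bes_coef fact0 mul1n add0n.
by rewrite big1 ?addr0// => i _; rewrite expr0n mulr0.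
Unshelve. all: by end_near. Qed.

(** The three-term recurrence of Bessel functions. It makes x^(m+1) bes_{m+1}(c x) a primitive of
    x^m bes_m(c x). *)
Lemma bes_rec m z : z * bes m.+2 z + m.+1%:R * bes m.+1 z = bes m z.
Proof.
(* Multiplication by z shifts the index, so n terms of the first series are paired with n + 1 terms
   of the other two. *)
have h n : z * pseries (bes_coef m.+2) z n + m.+1%:R * pseries (bes_coef m.+1) z n.+1
         = pseries (bes_coef m) z n.+1.
  rewrite /pseries /series /=; elim: n => [|n IH].
    rewrite !big_nat1 big_geq// mulr0 add0r !expr0 !mulr1 /bes_coef fact0 !mul1n !add0n.
    by rewrite factS natrM invfM mulVKf.
  rewrite big_nat_recr//= [in LHS](big_nat_recr n.+1)//= [RHS]big_nat_recr//= -IH.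
  rewrite !mulrDr addrACA; congr (_ + _).
  rewrite /bes_coef exprS.
  have -> : (n`! * (n + m.+2)`!)%:R^-1 = n.+1%:R * (n.+1`! * (n.+1 + m.+1)`!)%:R^-1 :> R.
    by rewrite factS addSnnS -mulnA [in RHS]natrM invfM mulVKf.
  have -> : (n.+1`! * (n.+1 + m)`!)%:R^-1 =
      (n.+1 + m.+1)%:R * (n.+1`! * (n.+1 + m.+1)`!)%:R^-1 :> R.
    by rewrite addnS factS [in RHS]mulnCA [in RHS]natrM invfM mulVKf.
  by rewrite natrD; ring.
have h1 : (fun n => z * pseries (bes_coef m.+2) z n + m.+1%:R * pseries (bes_coef m.+1) z n.+1)
    @ \oo --> z * bes m.+2 z + m.+1%:R * bes m.+1 z.
  apply: cvgD; first by apply: cvgMr; exact: is_cvg_bes.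
  apply: cvgMr; rewrite (_ : (fun n => _) = [sequence pseries (bes_coef m.+1) z (n + 1)%N]_n).
    by rewrite cvg_shiftn; exact: is_cvg_bes.
  by apply/funext => n; rewrite /= addn1.
have h2 : (fun n => z * pseries (bes_coef m.+2) z n + m.+1%:R * pseries (bes_coef m.+1) z n.+1)
    @ \oo --> bes m z.
  rewrite (_ : (fun n => _) = [sequence pseries (bes_coef m) z (n + 1)%N]_n).
    by rewrite cvg_shiftn; exact: is_cvg_bes.
  by apply/funext => n; rewrite /= addn1.
by rewrite -(cvg_lim (@Rhausdorff R) h1) (cvg_lim (@Rhausdorff R) h2).
Qed.

Lemma continuous_bes m : continuous (bes m).
Proof.
move=> z; apply/differentiable_continuous/derivable1_diffP.
by have [] := is_derive_bes m z.
Qed.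

(** Continuity at 0, where the values are 1/0!, 1/1!, 1/2!. The tolerance 1/10 leaves room for the
    sign of U_z on the first two pieces and for the convexity of [bes 0]. *)
Lemma bes_near0 : exists2 r : R, 0 < r & forall z, `|z| <= r ->
  [/\ `|bes 0 z - 1| <= 10^-1, `|bes 1 z - 1| <= 10^-1 & `|bes 2 z - 2^-1| <= 10^-1].
Proof.
have c m := @continuous_bes m 0.
have e0 : (0 : R) < 10^-1 by rewrite invr_gt0.
have /cvgrPdist_le/(_ _ e0)[r0 /= r00 h0] := c 0%N.
have /cvgrPdist_le/(_ _ e0)[r1 /= r10 h1] := c 1%N.
have /cvgrPdist_le/(_ _ e0)[r2 /= r20 h2] := c 2%N.
exists (Num.min r0 (Num.min r1 r2) / 2); first by rewrite divr_gt0// !lt_min r00 r10.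
move=> z; rewrite ler_pdivlMr// => hz.
have hz' : `|0 - z| < Num.min r0 (Num.min r1 r2).
  rewrite sub0r normrN; have : 0 < Num.min r0 (Num.min r1 r2) by rewrite !lt_min r00 r10.
  by have := normr_ge0 z; lra.
move: hz'; rewrite !lt_min => /and3P[z0 z1 z2].
have := h0 z z0; have := h1 z z1; have := h2 z z2.
by rewrite !bes0 /= !invr1 ![`|_ - bes _ _|]distrC.
Qed.

End bessel.

(** * Monotonicity and derivatives off a finite set *)

Section off_finite.
Variable R : realType.
Implicit Types (B : seq R) (f df : R -> R) (a b : R).

(** Induction on [B]: an interval that contains the head is cut there, which is why [P] speaks of
    all intervals and must pass to concatenations. *)
Lemma finite_split B (P : R -> R -> Prop) :
  (forall a c b, a < c -> c < b -> P a c -> P c b -> P a b) ->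
  (forall a b, a < b -> (forall x, a < x < b -> x \notin B) -> P a b) ->
  forall a b, a < b -> P a b.
Proof.
move=> Ptrans; elim: B => [|c B IH] Pbase; first by move=> a b ab; exact: Pbase.
apply: IH => a b ab abB.
have [/andP[ac cb]|acb] := boolP (a < c < b).
  apply: (Ptrans _ c) => //; apply: Pbase => // x /andP[ax xb]; rewrite inE negb_or.
    by rewrite lt_eqF//= abB// ax (lt_trans xb).
  by rewrite gt_eqF//= abB// xb (lt_trans ac).
apply: Pbase => // x axb; rewrite inE negb_or abB// andbT.
by apply: contraNneq acb => <-.
Qed.

Lemma within_subitv f a b a' b' : a <= a' -> b' <= b ->
  {within `[a, b], continuous f} -> {within `[a', b'], continuous f}.
Proof.
move=> aa bb; apply: continuous_subspaceW => x /=.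
by rewrite !in_itv/= => /andP[h1 h2]; rewrite (le_trans aa)// (le_trans h2).
Qed.

Lemma ndecr_off_finite B f df a b : a <= b ->
  {within `[a, b], continuous f} ->
  (forall x, a < x < b -> x \notin B -> is_derive x 1 f (df x)) ->
  (forall x, a < x < b -> x \notin B -> 0 <= df x) ->
  f a <= f b.
Proof.
rewrite le_eqVlt => /predU1P[->//|ab] fc fd dfge0.
suff: forall a' b', a' < b' -> a <= a' -> b' <= b -> f a' <= f b' by apply.
apply: (finite_split (B := B)) => [a' c b' ac cb h1 h2 aa bb|a' b' ab' nB aa bb].
  apply: (le_trans (h1 aa _)); first by rewrite (le_trans (ltW cb)).
  by rewrite h2// (le_trans aa)// ltW.
have oo x : a' < x < b' -> a < x < b.
  by move=> /andP[h1 h2]; rewrite (le_lt_trans aa)//= (lt_le_trans h2).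
have [||c] := @MVT _ f df a' b' ab'.
- by move=> x; rewrite in_itv/= => xab; apply: fd; [exact: oo|exact: nB].
- exact: within_subitv fc.
- rewrite in_itv/= => cab /eqP; rewrite subr_eq => /eqP ->.
  rewrite lerDr mulr_ge0// ?subr_ge0 ?(ltW ab')//.
  by rewrite dfge0//; [exact: oo|exact: nB].
Qed.

Lemma incr_off_finite B f df a b : a < b ->
  {within `[a, b], continuous f} ->
  (forall x, a < x < b -> x \notin B -> is_derive x 1 f (df x)) ->
  (forall x, a < x < b -> x \notin B -> 0 < df x) ->
  f a < f b.
Proof.
move=> ab fc fd dfgt0.
suff: forall a' b', a' < b' -> a <= a' -> b' <= b -> f a' < f b' by apply.
apply: (finite_split (B := B)) => [a' c b' ac cb h1 h2 aa bb|a' b' ab' nB aa bb].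
  apply: (lt_trans (h1 aa _)); first by rewrite (le_trans (ltW cb)).
  by rewrite h2// (le_trans aa)// ltW.
have oo x : a' < x < b' -> a < x < b.
  by move=> /andP[h1 h2]; rewrite (le_lt_trans aa)//= (lt_le_trans h2).
have [||c] := @MVT _ f df a' b' ab'.
- by move=> x; rewrite in_itv/= => xab; apply: fd; [exact: oo|exact: nB].
- exact: within_subitv fc.
- rewrite in_itv/= => cab /eqP; rewrite subr_eq => /eqP ->.
  rewrite ltrDr mulr_gt0// ?subr_gt0//.
  by rewrite dfgt0//; [exact: oo|exact: nB].
Qed.

(** Both g + f and g - f are nondecreasing. *)
Lemma ler_increment_off_finite B f df (g dg : R -> R) a b : a <= b ->
  {within `[a, b], continuous f} -> {within `[a, b], continuous g} ->
  (forall x, a < x < b -> x \notin B -> is_derive x 1 f (df x)) ->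
  (forall x, a < x < b -> x \notin B -> is_derive x 1 g (dg x)) ->
  (forall x, a < x < b -> x \notin B -> `|df x| <= dg x) ->
  `|f b - f a| <= g b - g a.
Proof.
move=> ab fc gc fd gd dfg; rewrite ler_norml; apply/andP; split.
  have : (g \+ f) a <= (g \+ f) b.
    apply: (@ndecr_off_finite B _ (dg \+ df) _ _ ab) => [|x xab xB|x xab xB].
    - by move=> x; apply: cvgD; [exact: gc|exact: fc].
    - by apply: is_deriveD; [exact: gd|exact: fd].
    - by have := dfg _ xab xB; rewrite ler_norml => /andP[]; rewrite /=; lra.
  by rewrite /=; lra.
have : (g \- f) a <= (g \- f) b.
  apply: (@ndecr_off_finite B _ (dg \- df) _ _ ab) => [|x xab xB|x xab xB].
  - by move=> x; apply: cvgB; [exact: gc|exact: fc].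
  - by apply: is_deriveB; [exact: gd|exact: fd].
  - by have := dfg _ xab xB; rewrite ler_norml => /andP[]; rewrite /=; lra.
by rewrite /=; lra.
Qed.

Lemma lipschitz_off_finite B f df C a b : a <= b ->
  {within `[a, b], continuous f} ->
  (forall x, a < x < b -> x \notin B -> is_derive x 1 f (df x)) ->
  (forall x, a < x < b -> x \notin B -> `|df x| <= C) ->
  `|f b - f a| <= C * (b - a).
Proof.
move=> ab fc fd dfC.
rewrite mulrBr.
apply: (@ler_increment_off_finite B f df ( *%R C) (fun=> C) a b ab fc) => //.
  move=> x; apply: continuous_subspaceT => y; exact: mulrl_continuous.
move=> x xab xB.
have -> : *%R C = (fun y => C *: y) by [].
rewrite -[X in is_derive _ _ _ X]mulr1. exact: is_deriveZ.
Qed.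

Lemma cst_off_finite B f a b : a <= b ->
  {within `[a, b], continuous f} ->
  (forall x, a < x < b -> x \notin B -> is_derive x 1 f 0) -> f a = f b.
Proof.
move=> ab fc fd.
have := @lipschitz_off_finite B f (cst 0) 0 a b ab fc fd.
rewrite mul0r normr_le0 subr_eq0 => h; apply/eqP; rewrite eq_sym h// => x _ _.
by rewrite normr0.
Qed.

End off_finite.

Section off_finite_measure.
Variable R : realType.
Notation mu := (@lebesgue_measure R).
Implicit Types (B : seq R) (g : R -> R).

Lemma ae_off_finite B (P : R -> Prop) : (forall x, x \notin B -> P x) ->
  {ae mu, forall x, P x}.
Proof.
move=> h; exists [set` B]; split.
- exact/countable_measurable/finite_set_countable/finite_seq.
- exact/countable_lebesgue_measure0/finite_set_countable/finite_seq.
- by move=> x /= nP; apply: contra_notT nP => /h.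
Qed.

(** The half-line is an open set on which [g] is continuous plus finitely many points, where the
    values, for instance defaults of [derive1], may be arbitrary. *)
Lemma measurable_off_finite B g a :
  (forall x, a < x -> x \notin B -> {for x, continuous g}) ->
  measurable_fun (`[a, +oo[ : set (measurableTypeR R)) (g : _ -> measurableTypeR R).
Proof.
move=> cg.
have mB (C : seq R) : measurable_fun ([set` C] : set (measurableTypeR R)) (g : _ -> measurableTypeR R).
  elim: C => [|c C IH]; first by have -> : [set` ([::] : seq R)] = set0;
    [apply/seteqP; split|exact: measurable_fun_set0].
  have -> : [set` c :: C] = [set c] `|` [set` C].
    by apply/seteqP; split => x /=; rewrite inE => /predU1P.
  apply/measurable_funU => //.
    exact/countable_measurable/finite_set_countable/finite_seq.
  by split=> //; exact: measurable_fun_set1.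
have oD : open (`]a, +oo[ `\` [set` B]).
  rewrite setDE; apply: openI; first exact: interval_open.
  apply: closed_openC; apply: (iffLR accessible_finite_set_closed).
    exact/hausdorff_accessible/Rhausdorff.
  exact: finite_seq.
have mO : measurable_fun ((`]a, +oo[ `\` [set` B]) : set (measurableTypeR R)) (g : _ -> measurableTypeR R).
  apply: (open_continuous_measurable_fun oD) => x; rewrite inE /= in_itv/= andbT => -[ax xB].
  by apply: cg => //; apply/negP.
apply: (@measurable_funS _ _ _ _ ((`]a, +oo[ `\` [set` B]) `|` [set` a :: B])).
- apply: measurableU; first exact: (open_measurable oD).
  exact/countable_measurable/finite_set_countable/finite_seq.
- move=> x /=; rewrite in_itv/= andbT le_eqVlt => /predU1P[<-|ax]; first by right; rewrite mem_head.
  have [xB|xB] := boolP (x \in B); first by right; rewrite inE xB orbT.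
  by left; split; [rewrite in_itv/= ax|].
- apply/measurable_funU; first exact: (open_measurable oD).
    exact/countable_measurable/finite_set_countable/finite_seq.
  by split; [exact: mO|exact: mB].
Qed.

Lemma bounded_off_finite B g (D : set R) C :
  (forall x, D x -> x \notin B -> `|g x| <= C) ->
  exists2 C', 0 <= C' & forall x, D x -> `|g x| <= C'.
Proof.
move=> gC; exists (Num.max 0 C + \sum_(b <- B) `|g b|).
  by rewrite addr_ge0 ?le_max ?lexx// sumr_ge0.
move=> x Dx; have [xB|xB] := boolP (x \in B).
  rewrite (big_rem x)//= addrCA lerDl addr_ge0 ?le_max ?lexx// sumr_ge0//.
by rewrite (le_trans (gC _ Dx xB))// -[C in C <= _]addr0 lerD ?sumr_ge0 ?le_max ?lexx ?orbT.
Qed.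

End off_finite_measure.

(** * The L^2 norm of bounded functions on a bounded interval *)

Section L2.
Variable R : realType.
Notation mu := (@lebesgue_measure R).
Implicit Types (D : set (measurableTypeR R)) (g : R -> R) (C M : R).

(** An integrable majorant that serves both on [0, M] and on the whole half-line, where the
    functions of interest vanish far to the right. *)
Definition boxed D C M g := forall x, D x -> `|g x| <= C * \1_(`[0, M] : set R) x.

Lemma integrable_box D C M : measurable D ->
  mu.-integrable D (EFin \o (fun x => C * \1_(`[0, M] : set R) x)).
Proof.
move=> mD; apply: (@integrableS _ _ _ _ setT) => //.
rewrite (_ : _ \o _ = (fun x => C%:E * (\1_(`[0, M] : set R) x)%:E)%E); last by apply/funext.
apply: integrableZl => //; exact: integrable_indic_itv.
Qed.

Lemma box_ge0 C M x : 0 <= C -> 0 <= C * \1_(`[0, M] : set R) x.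
Proof. by move=> C0; rewrite mulr_ge0// indicE. Qed.

Lemma integrable_boxed D C M g : measurable D -> measurable_fun D g -> boxed D C M g ->
  mu.-integrable D (EFin \o g).
Proof.
move=> mD mg hg; apply: le_integrable (integrable_box C M mD) => //.
  exact/measurable_EFinP.
by move=> x Dx /=; rewrite lee_fin (le_trans (hg _ Dx))// ler_norm.
Qed.

Lemma boxed_sqr D C M g : 0 <= C -> boxed D C M g -> boxed D (C ^+ 2) M (fun x => g x ^+ 2).
Proof.
move=> C0 hg x Dx; rewrite normrX; have := hg x Dx; rewrite !indicE.
case: (_ \in _); first by rewrite !mulr1 => h; rewrite lerXn2r// nnegrE.
rewrite !mulr0 => h; have -> : `|g x| = 0 by apply/eqP; rewrite eq_le h normr_ge0.
  by rewrite expr0n.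
Qed.

Lemma L2norm_int D g : L2norm D g = (sqrte (\int[mu]_(x in D) (g x ^+ 2)%:E))%E.
Proof.
rewrite /L2norm unlock poweR12_sqrt; last first.
  by apply: integral_ge0 => x _; exact: poweR_ge0.
congr sqrte; rewrite [RHS]integral_mkcond; apply: eq_integral => x _.
rewrite /= /patch; case: ifP => _.
  by rewrite /poweR powR_mulrn// real_normK ?num_real.
by rewrite normr0 /poweR powR0 // gt_eqF.
Qed.

Lemma L2norm_sqrt D C M g : measurable D -> measurable_fun D g -> 0 <= C -> boxed D C M g ->
  L2norm D g = (Num.sqrt (\int[mu]_(x in D) (g x ^+ 2)))%:E.
Proof.
move=> mD mg C0 hg; rewrite L2norm_int /Rintegral.
have := integrable_fin_num mD (integrable_boxed mD (measurable_funX 2 mg) (boxed_sqr C0 hg)).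
by move=> /fineK <-.
Qed.

Lemma in_L2_boxed D C M g : measurable D -> measurable_fun D g -> 0 <= C -> boxed D C M g ->
  in_L2 D g.
Proof.
move=> mD mg C0 hg; apply/andP; split; rewrite inE/=.
  exact: (iffLR (measurable_restrictT g mD)).
by rewrite /finite_norm; have := L2norm_sqrt mD mg C0 hg; rewrite /L2norm => ->; rewrite ltry.
Qed.

Lemma L2norm_cvg0 (B : seq R) D C M (g : nat -> R -> R) : measurable D -> 0 <= C ->
  (forall n, measurable_fun D (g n)) -> (forall n, boxed D C M (g n)) ->
  (forall x, D x -> x \notin B -> g n x @[n --> \oo] --> 0) ->
  Num.sqrt (\int[mu]_(x in D) (g n x ^+ 2)) @[n --> \oo] --> 0.
Proof.
move=> mD C0 mg hg g0; rewrite -[X in _ --> X](@sqrtr0 R).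
apply: continuous_cvg; first exact: sqrt_continuous.
have [] := @dominated_convergence _ _ _ mu _ mD (fun n x => (g n x ^+ 2)%:E) (cst 0%E)
   (EFin \o (fun x => C ^+ 2 * \1_(`[0, M] : set R) x)).
- by move=> n; apply/measurable_EFinP/measurable_funX.
- exact: measurable_cst.
- apply: (@ae_off_finite _ B) => x xB Dx; apply: cvg_EFin; first exact: nearW.
  rewrite [X in _ --> X](_ : _ = (0 : R) ^+ 2); last by rewrite expr0n.
  rewrite /comp /=; under eq_fun do rewrite expr2.
  by rewrite expr2; apply: cvgM; exact: g0.
- exact: integrable_box.
- by apply/aeW => x n Dx; rewrite lee_fin; exact: (boxed_sqr C0 (hg n)).
move=> _ _; rewrite integral0 => h.
have := fine_cvg h.
by rewrite /=; apply.
Qed.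

(** Reduced to sequences, where dominated convergence applies. The bound excludes h = 0 because [g]
    will be a difference quotient. *)
Lemma L2norm_dnbhs0 (B : seq R) D C M (g : R -> R -> R) : measurable D -> 0 <= C ->
  (forall h, measurable_fun D (g h)) -> (forall h, h != 0 -> boxed D C M (g h)) ->
  (forall x, D x -> x \notin B -> g h x @[h --> 0^'] --> 0) ->
  L2norm D (g h) @[h --> 0^'] --> 0%E.
Proof.
move=> mD C0 mg hg g0.
suff h0 : Num.sqrt (\int[mu]_(x in D) (g h x ^+ 2)) @[h --> 0^'] --> 0.
  apply: (@cvg_trans _ (EFin (Num.sqrt (\int[mu]_(x in D) (g h x ^+ 2))) @[h --> 0^'])).
    apply: near_eq_cvg; near=> h.
    rewrite (L2norm_sqrt mD (mg h) C0 (hg h _))//; near: h; exact: nbhs_dnbhs_neq.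
  by apply: cvg_EFin => //; exact: nearW.
apply/cvgr_dnbhsP => h [h0 hcvg].
apply: (@L2norm_cvg0 B D C M (fun n => g (h n))) => //.
- by move=> n; apply: hg.
- by move=> x Dx xB; have /cvgr_dnbhsP := g0 x Dx xB; apply; split.
Unshelve. all: by end_near. Qed.

Lemma L2norm_at_right0 (B : seq R) D C M (g : R -> R -> R) : measurable D -> 0 <= C ->
  (forall h, measurable_fun D (g h)) -> (forall h, 0 < h -> boxed D C M (g h)) ->
  (forall x, D x -> x \notin B -> g h x @[h --> 0^'+] --> 0) ->
  L2norm D (g h) @[h --> 0^'+] --> 0%E.
Proof.
move=> mD C0 mg hg g0.
suff h0 : Num.sqrt (\int[mu]_(x in D) (g h x ^+ 2)) @[h --> 0^'+] --> 0.
  apply: (@cvg_trans _ (EFin (Num.sqrt (\int[mu]_(x in D) (g h x ^+ 2))) @[h --> 0^'+])).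
    apply: near_eq_cvg; near=> h.
    by rewrite (L2norm_sqrt mD (mg h) C0 (hg h _)).
  by apply: cvg_EFin => //; exact: nearW.
apply/cvg_at_rightP => h [h0 hcvg].
apply: (@L2norm_cvg0 B D C M (fun n => g (h n))) => //.
- by move=> n; apply: hg.
- by move=> x Dx xB; have /cvg_at_rightP := g0 x Dx xB; apply; split.
Unshelve. all: by end_near. Qed.

Lemma L2norm_le C M g : measurable_fun (`[0, M] : set (measurableTypeR R)) g ->
  0 <= C -> 0 <= M ->
  (forall x, 0 <= x <= M -> `|g x| <= C) -> (L2norm `[0%R, M] g <= (C * Num.sqrt M)%:E)%E.
Proof.
move=> mg C0 M0 hg.
have bg : boxed (`[0, M] : set R) C M g.
  by move=> x xM; rewrite indicE mem_set// mulr1 hg.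
rewrite (L2norm_sqrt _ mg C0 bg)// lee_fin -[in leRHS](ger0_norm C0) -sqrtr_sqr -sqrtrM ?sqr_ge0//.
apply: ler_wsqrtr.
have -> : C ^+ 2 * M = \int[mu]_(x in `[0, M] : set R) (C ^+ 2).
  rewrite Rintegral_cst//= lebesgue_measure_itv/= lte_fin; case: ltP => [_|M0'].
    by rewrite /= subr0.
  by rewrite (_ : M = 0) //; apply/eqP; rewrite eq_le M0 M0'.
apply: le_Rintegral => //.
- exact: integrable_boxed (measurable_funX 2 mg) (boxed_sqr C0 bg).
- apply: (@integrable_boxed _ (C ^+ 2) M) => // x xM.
  by rewrite indicE mem_set// mulr1 ger0_norm ?sqr_ge0.
- by move=> x xM; rewrite -[X in X <= _]ger0_norm ?sqr_ge0// normrX lerXn2r ?nnegrE// hg.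
Qed.

Lemma lipschitz_abs_continuous (V : Type) (dist : V -> V -> \bar R) a b (F : R -> V) C :
  0 <= C ->
  (forall s t, a <= s -> s <= t -> t <= b -> (dist (F s) (F t) <= (C * (t - s))%:E)%E) ->
  abs_continuous dist a b F.
Proof.
move=> C0 hF e e0; exists (e / (C + 1)); first by rewrite divr_gt0// ltr_wpDl.
move=> n s t hst _ hsum.
have h1 : (\sum_(i < n) dist (F (s i)) (F (t i)) <= \sum_(i < n) (C * (t i - s i))%:E)%E.
  by apply: lee_sum => i _; have [] := hst i => *; exact: hF.
apply: (le_lt_trans h1); rewrite sumEFin lte_fin -mulr_sumr.
have hs0 : 0 <= \sum_(i < n) (t i - s i).
  by apply: sumr_ge0 => i _; have [_ h _] := hst i; rewrite subr_ge0.
move: hsum; rewrite ltr_pdivlMr ?ltr_wpDl// => hsum; apply: le_lt_trans hsum.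
by rewrite mulrC ler_wpM2l// lerDl.
Qed.

End L2.

(** * From the energy coordinate to the space variable *)

Section profile.
Variable R : realType.
Notation mu := (@lebesgue_measure R).
Variables (E : R) (B : seq R) (X U V q : R -> R).

(** This is X_z. The slope 1 outside the energy range makes X map R onto R. *)
Definition jac z := if 0 < z < E then q z ^+ 2 else 1.

(** [B] collects the points where derivatives may fail. Outside the energy range U is constant
    although X moves; V is the primitive of U over the energy range, so that for the cubic flux the
    source term of the equation is 3 V. *)
Record profile : Prop := Profile {
  prE : 0 < E;
  prB0 : 0 \in B;
  prBE : E \in B;
  prX : continuous X;
  prU : continuous U;
  prV : continuous V;
  prdX : forall z, z \notin B -> is_derive z 1 X (jac z);
  prdU : forall z, z \notin B -> is_derive z 1 U (q z);
  prdV : forall z, z \notin B -> is_derive z 1 V (if 0 < z < E then U z else 0);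
  prq : forall z, z \notin B -> {for z, continuous q};
  prq0 : forall z, z \notin B -> ~~ (0 < z < E) -> q z = 0;
  prXl : forall z, z <= 0 -> X z = z;
  prXr : forall z, E <= z -> X z = X E + (z - E);
  prU0 : forall z, z <= 0 -> U z = 0;
  prV0 : forall z, z <= 0 -> V z = 0
}.

(** A chosen preimage rather than an inverse: X may be flat where energy is concentrated, and by
    [eul_at] the function U does not see the choice. *)
Definition inv x := xget 0 [set z | X z = x].

Definition eul x := U (inv x).

Hypothesis P : profile.

Lemma notin_near z : z \notin B -> \forall y \near z, y \notin B.
Proof.
move=> zB; have oB : open (~` [set` B]).
  apply: closed_openC; apply: (iffLR accessible_finite_set_closed).
    exact/hausdorff_accessible/Rhausdorff.
  exact: finite_seq.
have : nbhs z (~` [set` B]) by apply: open_nbhs_nbhs; split=> //=; apply/negP.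
by apply: filterS => y /= /negP.
Qed.

Lemma X_surj x : exists z, X z = x.
Proof.
have [x0|x0] := leP x 0; first by exists x; rewrite (prXl P).
have m0 : 0 <= Num.max E (x - X E + E) by rewrite le_max ltW// (prE P).
have mE : E <= Num.max E (x - X E + E) by rewrite le_max lexx.
have mx : x - X E + E <= Num.max E (x - X E + E) by rewrite le_max lexx orbT.
have [|||z _ <-] := @IVT R X 0 (Num.max E (x - X E + E)) x.
- exact: m0.
- exact/continuous_subspaceT/(prX P).
- rewrite (prXl P)// (prXr P mE) ge_min le_max (ltW x0)/=; apply/orP; right; lra.
- by exists z.
Qed.

Lemma invK x : X (inv x) = x.
Proof.
rewrite /inv; case: xgetP => [y _ //|/= nex].
by have [z zx] := X_surj x; have := nex z; rewrite /= zx.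
Qed.

Lemma jac_ge0 z : 0 <= jac z.
Proof. by rewrite /jac; case: ifP => // _; exact: sqr_ge0. Qed.

Lemma X_ndecr a b : a <= b -> X a <= X b.
Proof.
move=> ab; apply: (ndecr_off_finite (B := B) (df := jac) ab) => //.
- exact/continuous_subspaceT/(prX P).
- by move=> x _ xB; apply: (prdX P).
- by move=> x _ _; exact: jac_ge0.
Qed.

Lemma U_cst z : E <= z -> U z = U E.
Proof.
move=> Ez; apply/esym/(cst_off_finite (B := B) Ez).
  exact/continuous_subspaceT/(prU P).
move=> x /andP[Ex _] xB; have := prdU P xB.
by rewrite (prq0 P xB)// [_ && _]andbC ltNge (ltW Ex).
Qed.

(* (dU)^2 <= E dX is Cauchy-Schwarz: X - 2 l U + l^2 z is nondecreasing for every l. *)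
Lemma hoelder_XU a b : a <= b -> (U b - U a) ^+ 2 <= E * (X b - X a).
Proof.
move=> ab.
(* Outside [0, E] U is constant and X is nondecreasing, so both endpoints can be moved into [0, E],
   where [jac] is q ^+ 2. *)
wlog ha : a ab / 0 <= a.
  move=> h; have [|a0] := leP 0 a; first exact: h.
  have [b0|b0] := leP 0 b; last first.
    rewrite (prU0 P (ltW a0)) (prU0 P (ltW b0)) subrr expr0n/= mulr_ge0 ?(ltW (prE P))// subr_ge0.
    exact: X_ndecr.
  have := h _ b0 (lexx 0).
  rewrite (prU0 P (lexx _)) (prU0 P (ltW a0)) => /le_trans; apply.
  by rewrite ler_wpM2l ?(ltW (prE P))// lerB// X_ndecr// ltW.
wlog hb : b ab / b <= E.
  move=> h; have [|Eb] := leP b E; first exact: h.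
  have [aE|aE] := leP a E; last first.
    rewrite (U_cst (ltW aE)) (U_cst (ltW Eb)) subrr expr0n/= mulr_ge0 ?(ltW (prE P))// subr_ge0.
    exact: X_ndecr.
  have := h _ aE (lexx E).
  rewrite (U_cst (ltW Eb)) => /le_trans; apply.
  by rewrite ler_wpM2l ?(ltW (prE P))// lerB// X_ndecr// ltW.
have key l : 2 * l * (U b - U a) <= (X b - X a) + l ^+ 2 * (b - a).
  have : X a + (- (2 * l) * U a + l ^+ 2 * a) <= X b + (- (2 * l) * U b + l ^+ 2 * b).
    apply: (ndecr_off_finite (B := B) (f := X \+ ((- (2 * l)) \*: U \+ (l ^+ 2) \*: id))
      (df := fun z => jac z + (- (2 * l) * q z + l ^+ 2 * 1)) ab).
    - apply: continuous_subspaceT => z; apply: cvgD; first exact: (prX P).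
      by apply: cvgD; [apply: cvgZr; exact: (prU P)|apply: cvgZr; exact: cvg_id].
    - move=> z _ zB; apply: is_deriveD; first exact: (prdX P).
      by apply: is_deriveD; apply: is_deriveZ; exact: (prdU P).
    - move=> z /andP[az zb] zB; rewrite /jac (le_lt_trans ha az) (lt_le_trans zb hb)/=.
      by have := sqr_ge0 (q z - l); lra.
  by lra.
have dX : 0 <= X b - X a by rewrite subr_ge0 X_ndecr.
have E0 := prE P.
(* With b - a <= E, this l minimises l^2 E - 2 l (U b - U a). *)
have := key ((U b - U a) / E); set d := U b - U a => h.
have h2 : 2 * (d / E) * d = 2 * d ^+ 2 / E by field; rewrite gt_eqF.
have h3 : (d / E) ^+ 2 * (b - a) <= d ^+ 2 / E.
  have -> : (d / E) ^+ 2 * (b - a) = d ^+ 2 / E * ((b - a) / E) by field; rewrite gt_eqF.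
  rewrite ler_piMr ?divr_ge0 ?sqr_ge0 ?(ltW E0)// ler_pdivrMr// mul1r; lra.
have : d ^+ 2 / E <= X b - X a by lra.
by rewrite ler_pdivrMr// mulrC.
Qed.

Lemma hoelder_eul x y : (eul x - eul y) ^+ 2 <= E * `|x - y|.
Proof.
wlog xy : x y / inv x <= inv y.
  by move=> h; case/orP: (le_total (inv x) (inv y)) => /h//; rewrite -sqrrN opprB distrC.
rewrite /eul -sqrrN opprB (le_trans (hoelder_XU xy))// !invK ler_wpM2l ?(ltW (prE P))//.
by rewrite distrC ler_norm.
Qed.

(** Two preimages of x have the same X, so [hoelder_XU] forces the same U. *)
Lemma eul_at z x : X z = x -> eul x = U z.
Proof.
move=> Xz; have [zx|zx] := leP z (inv x).
  have := hoelder_XU zx; rewrite invK Xz subrr mulr0 => h.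
  by apply/eqP; rewrite -subr_eq0 -sqrf_eq0 eq_le h sqr_ge0.
have := hoelder_XU (ltW zx); rewrite invK Xz subrr mulr0 => h.
by apply/eqP; rewrite eq_sym -subr_eq0 -sqrf_eq0 eq_le h sqr_ge0.
Qed.

Lemma lipschitz_XU C a b : (forall z, a < z < b -> z \notin B -> `|q z| <= C * jac z) ->
  a <= b -> `|U b - U a| <= C * (X b - X a).
Proof.
move=> qC ab; rewrite mulrBr.
apply: (ler_increment_off_finite (B := B) (g := C \*: X) (df := q)
  (dg := fun z => C * jac z) ab).
- exact/continuous_subspaceT/(prU P).
- by apply/continuous_subspaceT => z; apply: cvgZr; exact: (prX P).
- by move=> z _; exact: (prdU P).
- by move=> z _ zB; apply: is_deriveZ; exact: (prdX P).
- by move=> z zab; exact: qC.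
Qed.

(** Formally u_x = q / jac. Since jac = q^2 on the energy range, the hypothesis there says |q| >= 1
    / C wherever q is nonzero. *)
Lemma lipschitz_eul C : (forall z, z \notin B -> `|q z| <= C * jac z) ->
  forall x y, `|eul x - eul y| <= C * `|x - y|.
Proof.
move=> qC x y; wlog xy : x y / inv x <= inv y.
  by move=> h; case/orP: (le_total (inv x) (inv y)) => /h//; rewrite distrC [X in _ * X]distrC.
rewrite /eul distrC (le_trans (lipschitz_XU (C := C) _ xy))//; first by move=> z _; exact: qC.
rewrite !invK distrC ger0_norm// subr_ge0.
by rewrite -[X in X <= _](invK x) -[X in _ <= X](invK y) X_ndecr.
Qed.

Lemma eul_left x : x <= 0 -> eul x = 0.
Proof. by move=> x0; rewrite (eul_at (prXl P x0)) (prU0 P). Qed.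

Lemma eul_right x : X E <= x -> eul x = U E.
Proof.
move=> Ex; rewrite -(U_cst (z := x - X E + E)); last by rewrite lerDr subr_ge0.
by apply: eul_at; rewrite (prXr P) ?lerDr ?subr_ge0//; lra.
Qed.

Hypothesis nondeg : forall z, 0 < z < E -> z \notin B -> q z != 0.

Lemma jac_gt0 z : z \notin B -> 0 < jac z.
Proof.
move=> zB; rewrite lt_neqAle jac_ge0 andbT eq_sym /jac; case: ifPn => [zE|_].
  by rewrite sqrf_eq0 nondeg.
exact: oner_neq0.
Qed.

Lemma X_incr a b : a < b -> X a < X b.
Proof.
move=> ab; apply: (incr_off_finite (B := B) (df := jac) ab) => //.
- exact/continuous_subspaceT/(prX P).
- by move=> x _ xB; apply: (prdX P).
- by move=> x _ xB; exact: jac_gt0.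
Qed.

Lemma XK : cancel X inv.
Proof.
move=> z; apply/eqP; rewrite eq_le !leNgt; apply/andP; split; apply/negP => /X_incr.
  by rewrite invK ltxx.
by rewrite invK ltxx.
Qed.

Lemma inv_continuous : continuous inv.
Proof.
move=> x; rewrite -[x]invK.
have h : {near X (inv x), continuous inv}.
  apply: near_can_continuous; first by near=> z; exact: XK.
  by near=> z; exact: (prX P).
exact: nbhs_singleton h.
Unshelve. all: by end_near. Qed.

Lemma eul_continuous : continuous eul.
Proof. by move=> x; apply: continuous_comp; [exact: inv_continuous|exact: (prU P)]. Qed.

Lemma is_derive_inv x : inv x \notin B -> is_derive x 1 inv (jac (inv x))^-1.
Proof.
move=> xB; have := @is_derive_inverse R X inv (jac (inv x)) (inv x).
rewrite invK; apply.
- by near=> z; exact: XK.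
- by near=> z; exact: (prX P).
- exact: (prdX P).
- by rewrite gt_eqF// jac_gt0.
Unshelve. all: by end_near. Qed.

Lemma is_derive_eul x : inv x \notin B -> is_derive x 1 eul (q (inv x) / jac (inv x)).
Proof.
by move=> xB; apply: is_derive1_comp; [exact: (prdU P)|exact: is_derive_inv].
Qed.

Lemma derive1_eul x : inv x \notin B -> derive1 eul x = q (inv x) / jac (inv x).
Proof. by move=> xB; rewrite derive1E; have [_ ->] := is_derive_eul xB. Qed.

Lemma notin_map x : (x \notin map X B) = (inv x \notin B).
Proof.
by rewrite -[in LHS](invK x) mem_map//; exact: can_inj XK.
Qed.

Lemma jac_near z : z \notin B -> {for z, continuous jac}.
Proof.
move=> zB; change (jac y @[y --> z] --> jac z).
have z0 : z != 0 by apply: contraNneq zB => ->; exact: (prB0 P).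
have zE : z != E by apply: contraNneq zB => ->; exact: (prBE P).
have [zin|] := boolP (0 < z < E).
  have -> : jac z = q z * q z by rewrite /jac zin expr2.
  move/andP: zin => [z0' zE'].
  apply: (@cvg_trans _ (q y * q y @[y --> z])); last first.
    have qz : q y @[y --> z] --> q z := prq P zB.
    exact: (cvgM qz qz).
  apply: near_eq_cvg; near=> y; rewrite /jac ifT ?expr2//; apply/andP; split.
    by near: y; exact: lt_nbhsr.
  by near: y; exact: lt_nbhsl.
move=> zin; have -> : jac z = 1 by rewrite /jac (negbTE zin).
move: zin; rewrite negb_and -!leNgt !le_eqVlt (negbTE z0) eq_sym (negbTE zE)/= => zout.
have [zn|zn] : (\forall y \near z, y < 0) \/ (\forall y \near z, E < y).
- by case/orP: zout => h; [left; exact: lt_nbhsl|right; exact: lt_nbhsr].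
- apply: cvg_near_cst; apply: filterS zn => y y0.
  by rewrite /jac [0 < y]ltNge (ltW y0).
- apply: cvg_near_cst; apply: filterS zn => y Ey.
  by rewrite /jac andbC ltNge (ltW Ey).
Unshelve. all: by end_near. Qed.

Lemma derive1_eul_continuous x : x \notin map X B -> {for x, continuous (derive1 eul)}.
Proof.
rewrite notin_map => xB.
have nxB : \forall y \near x, inv y \notin B.
  exact: inv_continuous (notin_near xB).
change (derive1 eul y @[y --> x] --> derive1 eul x); rewrite (derive1_eul xB).
apply: (@cvg_trans _ (q (inv y) / jac (inv y) @[y --> x])).
  by apply: near_eq_cvg; near=> y; rewrite derive1_eul//; near: y.
have c1 : q (inv y) @[y --> x] --> q (inv x).
  by apply: continuous_comp; [exact: inv_continuous|exact: (prq P)].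
have c2 : jac (inv y) @[y --> x] --> jac (inv x).
  by apply: continuous_comp; [exact: inv_continuous|exact: jac_near].
by apply: (cvgM c1); apply: cvgV => //; rewrite gt_eqF// jac_gt0.
Unshelve. all: by end_near. Qed.

Lemma measurable_derive1_eul a :
  measurable_fun (`[a, +oo[ : set (measurableTypeR R)) (derive1 eul).
Proof.
by apply: (measurable_off_finite (B := map X B)) => x _; exact: derive1_eul_continuous.
Qed.

Lemma derive1_eul_bounded C : (forall z, z \notin B -> `|q z| <= C * jac z) ->
  forall x, x \notin map X B -> `|derive1 eul x| <= C.
Proof.
move=> qC x; rewrite notin_map => xB; rewrite derive1_eul// normrM normfV.
by rewrite (ger0_norm (jac_ge0 _)) ler_pdivrMr ?jac_gt0// qC.
Qed.

Lemma derive1_eul_right x : X E < x -> derive1 eul x = 0.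
Proof.
move=> Ex; have eE : \forall y \near x, U E = eul y.
  by near=> y; rewrite eul_right// ltW//; near: y; exact: lt_nbhsr.
have : is_derive x 1 eul 0 by apply: near_eq_is_derive eE (is_derive_cst _ _ _).
by rewrite derive1E => -[_ ->].
Unshelve. all: by end_near. Qed.

Lemma integrable_energy C (g : R -> R) (M : R) : (forall z, z \notin B -> `|q z| <= C * jac z) ->
  continuous g -> 0 <= M -> mu.-integrable `[0, M] (EFin \o (fun y => g y * (derive1 eul y) ^+ 2)).
Proof.
move=> qC gc M0.
have [C' C'0 hC'] := bounded_off_finite (D := setT) (fun x _ => derive1_eul_bounded qC (x := x)).
have [cmax _ hmax] := @EVT_max R (fun x => `|g x|) _ _ M0
  (continuous_subspaceT (fun x => cvg_norm (@gc x))).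
have mg : measurable_fun (`[0, M] : set (measurableTypeR R)) (fun y => g y * (derive1 eul y) ^+ 2).
  apply: measurable_funM.
    by apply: measurable_funTS; exact: continuous_measurable_fun.
  apply: measurable_funX; apply: (@measurable_funS _ _ _ _ (`[0, +oo[ : set R)) => //.
    by move=> x /=; rewrite !in_itv/= => /andP[->].
  exact: measurable_derive1_eul.
apply: (integrable_boxed (C := `|g cmax| * C' ^+ 2) (M := M)) => // x xM.
rewrite indicE mem_set// mulr1 normrM normrX ler_pM ?exprn_ge0//; first exact: hmax.
by rewrite lerXn2r ?nnegrE// hC'.
Qed.

(** The change of variables y = X z, under which u_x^2 dy = dz. As functions of x both sides have
    the same derivative off the images of [B]. Leaving the primitive [W] free covers both the source
    term of the equation and the energy tested against a function. *)
Lemma energy_eul C (g W : R -> R) (z : R) : (forall z, z \notin B -> `|q z| <= C * jac z) ->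
  continuous g -> continuous W -> W 0 = 0 ->
  (forall z, z \notin B -> 0 < z -> is_derive z 1 W (if 0 < z < E then g (X z) else 0)) ->
  0 <= z -> \int[mu]_(y in `[0, X z]) (g y * (derive1 eul y) ^+ 2) = W z.
Proof.
move=> qC gc Wc W0 dW z0.
have Xz0 : 0 <= X z by rewrite -(prXl P (lexx 0)) X_ndecr.
rewrite -(XK z) invK; move: (X z) Xz0 => x x0.
pose F x := \int[mu]_(y in `[0, x]) (g y * (derive1 eul y) ^+ 2).
suff : F x - W (inv x) = F 0 - W (inv 0).
  have -> : inv 0 = 0 by rewrite -[X in inv X](prXl P (lexx 0)) XK.
  rewrite W0 subr0 /F set_itv1 Rintegral_set1.
  by move/eqP; rewrite subr_eq0 => /eqP.
apply/esym; apply: (cst_off_finite (B := map X B) (f := F \- (W \o inv)) x0).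
- move=> y; apply: cvgB.
    exact: parameterized_integral_continuous (integrable_energy qC gc x0) y.
  by apply: continuous_subspaceT => {}y; apply: continuous_comp; [exact: inv_continuous|exact: Wc].
- move=> y /andP[y0 yx] yB; rewrite -(subrr (g y * (derive1 eul y) ^+ 2)).
  have iyB : inv y \notin B by rewrite -notin_map.
  apply: is_deriveB.
    have cy : {for y, continuous (fun y => g y * derive1 eul y ^+ 2)}.
      have c1 : derive1 eul z @[z --> y] --> derive1 eul y by exact: derive1_eul_continuous.
      exact: (cvgM (gc y) (cvgM c1 c1)).
    have [dF F'] := continuous_FTC1_closed yx (integrable_energy qC gc x0) y0 cy.
    by rewrite -F' derive1E; exact: DeriveDef.
  have iy0 : 0 < inv y by rewrite ltNge; apply/negP => /X_ndecr; rewrite invK (prXl P)// leNgt y0.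
  rewrite [X in is_derive _ _ _ X](_ : _ = (if 0 < inv y < E then g (X (inv y)) else 0) * (jac (inv y))^-1).
    by apply: is_derive1_comp; [exact: dW|exact: is_derive_inv].
  rewrite derive1_eul// invK; case: ifPn => [hy|hy]; last by rewrite (prq0 P iyB hy) !mul0r expr0n mulr0.
  rewrite /jac hy; field; exact: nondeg.
Qed.

End profile.

(** * The explicit solution in the energy coordinate *)

Section kernels.
Variable R : realType.
Implicit Types (m : nat) (s e x z : R).

(** [ker 0] is the Riemann function of U_sz = 3 U, cut off at x = 0. The index counts primitives in
    x, and a derivative in s raises it by one with a factor 3. *)
Definition ker m s x := if 0 < x then x ^+ m * bes m (3 * s * x) else 0.

Lemma kerS_max m s x : ker m.+1 s x = Num.max x 0 ^+ m.+1 * bes m.+1 (3 * s * Num.max x 0).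
Proof.
rewrite /ker; case: ifPn => [x0|]; first by rewrite max_l// ltW.
by rewrite -leNgt => x0; rewrite max_r// expr0n/= mul0r.
Qed.

Lemma continuous_kerS m s : continuous (ker m.+1 s).
Proof.
move=> x; rewrite (_ : ker _ _ = fun x => Num.max x 0 ^+ m.+1 * bes m.+1 (3 * s * Num.max x 0)); last first.
  by apply/funext => y; exact: kerS_max.
have cm : Num.max y 0 @[y --> x] --> Num.max x 0.
  by apply: continuous_max; [exact: cvg_id|exact: cvg_cst].
have c1 : Num.max y 0 ^+ m.+1 @[y --> x] --> Num.max x 0 ^+ m.+1.
  exact: (continuous_comp cm (@exprn_continuous _ _ _)).
have c2 : bes m.+1 (3 * s * Num.max y 0) @[y --> x] --> bes m.+1 (3 * s * Num.max x 0).
  have c3 : 3 * s * Num.max y 0 @[y --> x] --> 3 * s * Num.max x 0 by exact: cvgMr.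
  exact: (continuous_comp c3 (@continuous_bes _ _ _)).
exact: (cvgM c1 c2).
Qed.

Lemma ker_near_pos m s x : 0 < x ->
  \forall y \near x, y ^+ m * bes m (3 * s * y) = ker m s y.
Proof.
by move=> x0; apply: filterS (lt_nbhsr x0) => y y0; rewrite /ker y0.
Qed.

Lemma ker_near_neg m s x : x < 0 -> \forall y \near x, 0 = ker m s y.
Proof.
by move=> x0; apply: filterS (lt_nbhsl x0) => y y0; rewrite /ker ltNge (ltW y0).
Qed.

Lemma is_derive_mulr_arg (f : R -> R) c x l :
  is_derive (c * x) 1 f l -> is_derive x 1 (fun y => f (c * y)) (l * c).
Proof.
move=> fl; have := @is_derive1_comp R f (c \*: id) x l c fl; apply.
rewrite -[X in is_derive _ _ _ X]mulr1; exact: is_deriveZ.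
Qed.

Lemma is_derive_ker m s x : x != 0 -> is_derive x 1 (ker m.+1 s) (ker m s x).
Proof.
rewrite neq_lt => /orP[x0|x0].
  apply: (near_eq_is_derive (ker_near_neg m.+1 s x0)).
  by rewrite /ker ltNge (ltW x0)/=; exact: is_derive_cst.
apply: (near_eq_is_derive (ker_near_pos m.+1 s x0)).
have d1 : is_derive x 1 (fun y => y ^+ m.+1) (m.+1%:R * x ^+ m).
  apply: DeriveDef; first exact: exprn_derivable.
  by rewrite exp_derive /GRing.scale/= mulr1 mulr_natl.
have d2 := is_derive_mulr_arg (is_derive_bes m.+1 (3 * s * x)).
have := is_deriveM d1 d2; rewrite (_ : _ + _ = ker m s x)//.
rewrite /ker x0 -(bes_rec m) exprS /GRing.scale/=; ring.
Qed.

Lemma is_derive_ker_s m s x : is_derive s 1 (ker m ^~ x) (3 * ker m.+1 s x).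
Proof.
rewrite /ker; case: ifPn => x0; last by rewrite mulr0; exact: is_derive_cst.
rewrite [X in is_derive _ _ X _](_ : _ = x ^+ m \*: (fun s => bes m ((3 * x) * s))); last first.
  by apply/funext => t; rewrite /GRing.scale/= mulrAC.
rewrite [X in is_derive _ _ _ X](_ : _ = x ^+ m *: (bes m.+1 ((3 * x) * s) * (3 * x))).
  by apply: is_deriveZ; apply: is_derive_mulr_arg; exact: is_derive_bes.
by rewrite /GRing.scale/= exprS (mulrAC 3 x s); ring.
Qed.

Lemma continuous_ker m s x : x != 0 -> {for x, continuous (ker m s)}.
Proof.
case: m => [|m x0]; last exact: continuous_kerS.
rewrite neq_lt => /orP[x0|x0].
  change (ker 0 s y @[y --> x] --> ker 0 s x).
  rewrite {2}/ker ltNge (ltW x0)/=; apply: cvg_near_cst.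
  by apply: filterS (ker_near_neg 0 s x0) => y <-.
change (ker 0 s y @[y --> x] --> ker 0 s x).
apply: (@cvg_trans _ ((fun y => y ^+ 0 * bes 0 (3 * s * y)) @ x)).
  exact: near_eq_cvg (ker_near_pos 0 s x0).
rewrite /ker x0; under eq_fun do rewrite expr0 mul1r; rewrite expr0 mul1r.
have c3 : 3 * s * y @[y --> x] --> 3 * s * x by apply: cvgMr; exact: cvg_id.
exact: (continuous_comp c3 (@continuous_bes _ _ _)).
Qed.

(** For m = 0, 1, 2 these are U_z, U and V before truncation at the total energy. *)
Definition W m s e z := - ker m s z + 2 * ker m s (z - 1) - (1 + e) * ker m s (z - 2).

Lemma W_neg m s e z : z <= 0 -> W m s e z = 0.
Proof.
move=> z0; rewrite /W /ker !ifF; first by rewrite !mulr0; ring.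
- by apply/negbTE; rewrite -leNgt; lra.
- by apply/negbTE; rewrite -leNgt; lra.
- by apply/negbTE; rewrite -leNgt.
Qed.

Lemma is_derive_shift (f : R -> R) c x l :
  is_derive (x - c) 1 f l -> is_derive x 1 (fun y => f (y - c)) l.
Proof.
move=> fl; have := @is_derive1_comp R f (fun y => y - c) x l 1 fl; rewrite mulr1; apply.
by rewrite -[X in is_derive _ _ _ X]subr0; apply: is_deriveB.
Qed.

Lemma W_comb m s e : W m s e =
  (\- ker m s) \+ 2 \*: (fun z => ker m s (z - 1)) \- (1 + e) \*: (fun z => ker m s (z - 2)).
Proof. by []. Qed.

Lemma is_derive_W m s e z : z \notin [:: 0; 1; 2] -> is_derive z 1 (W m.+1 s e) (W m s e z).
Proof.
rewrite !inE !negb_or => /and3P[z0 z1 z2]; rewrite W_comb.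
apply: is_deriveB; last first.
  by apply: is_deriveZ; apply: is_derive_shift; apply: is_derive_ker; rewrite subr_eq0.
apply: is_deriveD; first by apply: is_deriveN; exact: is_derive_ker.
by apply: is_deriveZ; apply: is_derive_shift; apply: is_derive_ker; rewrite subr_eq0.
Qed.

Lemma is_derive_W_s m s e z : is_derive s 1 (fun s => W m s e z) (3 * W m.+1 s e z).
Proof.
rewrite [X in is_derive _ _ X _](_ : _ = (\- ker m ^~ z) \+ 2 \*: (ker m ^~ (z - 1))
   \- (1 + e) \*: (ker m ^~ (z - 2))) //.
rewrite [X in is_derive _ _ _ X](_ : _ = - (3 * ker m.+1 s z) + 2 *: (3 * ker m.+1 s (z - 1))
   - (1 + e) *: (3 * ker m.+1 s (z - 2))); last first.
  by rewrite /W /GRing.scale/=; ring.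
apply: is_deriveB; last by apply: is_deriveZ; exact: is_derive_ker_s.
apply: is_deriveD; first by apply: is_deriveN; exact: is_derive_ker_s.
by apply: is_deriveZ; exact: is_derive_ker_s.
Qed.

Lemma continuous_W m s e z : z \notin [:: 0; 1; 2] -> {for z, continuous (W m s e)}.
Proof.
rewrite !inE !negb_or => /and3P[z0 z1 z2].
have sh c : z != c -> ker m s (y - c) @[y --> z] --> ker m s (z - c).
  move=> zc; have c1 : y - c @[y --> z] --> z - c by apply: cvgB; [exact: cvg_id|exact: cvg_cst].
  apply: (continuous_comp c1); apply: continuous_ker; by rewrite subr_eq0.
have c0 : ker m s y @[y --> z] --> ker m s z by exact: continuous_ker.
have k1 : 2 * ker m s (y - 1) @[y --> z] --> 2 * ker m s (z - 1) by apply: cvgMr; exact: sh.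
have k2 : (1 + e) * ker m s (y - 2) @[y --> z] --> (1 + e) * ker m s (z - 2).
  by apply: cvgMr; exact: sh.
exact: (cvgB (cvgD (cvgN c0) k1) k2).
Qed.

Lemma continuous_WS m s e : continuous (W m.+1 s e).
Proof.
move=> z; have sh c : ker m.+1 s (y - c) @[y --> z] --> ker m.+1 s (z - c).
  have c1 : y - c @[y --> z] --> z - c by apply: cvgB; [exact: cvg_id|exact: cvg_cst].
  by apply: (continuous_comp c1); exact: continuous_kerS.
have c0 : ker m.+1 s y @[y --> z] --> ker m.+1 s z by exact: continuous_kerS.
have k1 : 2 * ker m.+1 s (y - 1) @[y --> z] --> 2 * ker m.+1 s (z - 1) by apply: cvgMr; exact: sh.
have k2 : (1 + e) * ker m.+1 s (y - 2) @[y --> z] --> (1 + e) * ker m.+1 s (z - 2).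
  by apply: cvgMr; exact: sh.
exact: (cvgB (cvgD (cvgN c0) k1) k2).
Qed.

End kernels.

(** * Sizes and signs for small arguments *)

Section bounds.
Variable R : realType.
Variable r : R.
Hypothesis hr : forall z, `|z| <= r ->
  [/\ `|bes 0 z - 1| <= 10^-1, `|bes 1 z - 1| <= 10^-1 & `|bes 2 z - 2^-1| <= 10^-1].
Implicit Types (m : nat) (s e x z : R).

(** The 12 is the factor 3 of the argument times the bound 4, which leaves a margin beyond the
    energy range [0, 3]. *)
Lemma arg_small s x : `|s| <= r / 12 -> `|x| <= 4 -> `|3 * s * x| <= r.
Proof.
move=> hs hx; rewrite !normrM (ger0_norm (_ : 0 <= 3))//.
have : `|s| * `|x| <= r / 12 * 4 by apply: ler_pM.
by lra.
Qed.

Lemma ker_bound m s x : (m <= 2)%N -> `|s| <= r / 12 -> x <= 4 -> `|ker m s x| <= 20.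
Proof.
move=> m2 hs x4; rewrite /ker; case: ifPn => x0; last by rewrite normr0.
have xa : `|x| <= 4 by rewrite ger0_norm// ltW.
have [] := hr (arg_small hs xa); rewrite ![`|bes _ _ - _| <= _]ler_norml.
move=> /andP[b0 b0'] /andP[b1 b1'] /andP[b2 b2'].
rewrite normrM normrX (ger0_norm (ltW x0)).
have hb : `|bes m (3 * s * x)| <= 11 / 10.
  by rewrite ler_norml; case: m m2 => [|[|[|//]]] _; apply/andP; split; lra.
have hp : x ^+ m <= 16.
  case: m m2 {hb} => [|[|[|//]]] _; rewrite ?expr0 ?expr1 ?expr2; [lra|lra|nra].
have : x ^+ m * `|bes m (3 * s * x)| <= 16 * (11 / 10).
  by apply: ler_pM => //; rewrite exprn_ge0// ltW.
by lra.
Qed.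

Lemma W_bound m s e z : (m <= 2)%N -> `|s| <= r / 12 -> 0 <= e <= 1 -> z <= 4 -> `|W m s e z| <= 100.
Proof.
move=> m2 hs /andP[e0 e1] z4.
have := ker_bound m2 hs z4; rewrite ler_norml => /andP[k0 k0'].
have := @ker_bound m s (z - 1) m2 hs ltac:(lra); rewrite ler_norml => /andP[k1 k1'].
have := @ker_bound m s (z - 2) m2 hs ltac:(lra); rewrite ler_norml => /andP[k2 k2'].
have : - 40 <= (1 + e) * ker m s (z - 2) <= 40 by apply/andP; split; nra.
move=> /andP[h1 h2].
by rewrite /W ler_norml; apply/andP; split; lra.
Qed.

Lemma W0_piece1 s e z : `|s| <= r / 12 -> 0 < z < 1 -> W 0 s e z <= - (7 / 10).
Proof.
move=> hs /andP[z0 z1]; rewrite /W /ker z0 !ifF; last 2 first.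
- by apply/negbTE; rewrite -leNgt; lra.
- by apply/negbTE; rewrite -leNgt; lra.
have xa : `|z| <= 4 by rewrite ger0_norm ?(ltW z0)//; lra.
have [] := hr (arg_small hs xa).
by rewrite !ler_norml expr0 => /andP[b0 b0'] _ _; lra.
Qed.

(** The constant is 2 * 9/10 - 11/10. *)
Lemma W0_piece2 s e z : `|s| <= r / 12 -> 1 < z < 2 -> 7 / 10 <= W 0 s e z.
Proof.
move=> hs /andP[z0 z1]; rewrite /W /ker [in X in _ - X]ifF; last first.
  by apply/negbTE; rewrite -leNgt; lra.
rewrite !ifT; [|lra|lra].
have xa : `|z| <= 4 by rewrite ger0_norm; lra.
have xb : `|z - 1| <= 4 by rewrite ger0_norm; lra.
have [+ _ _] := hr (arg_small hs xa); have [+ _ _] := hr (arg_small hs xb).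
by rewrite !ler_norml !expr0 => /andP[b0 b0'] /andP[c0 c0']; lra.
Qed.

(* bes 0 is uniformly convex on [-r, r], with second derivative at least 2/5. *)
Lemma bes_second_difference (c b : R) : 0 <= b -> `|c| + b <= r ->
  2 / 5 * b ^+ 2 <= bes 0 (c + b) - 2 * bes 0 c + bes 0 (c - b).
Proof.
move=> b0 cb.
have inr (t : R) : 0 <= t <= b -> `|c + t| <= r /\ `|c - t| <= r.
  move=> /andP[t0 tb]; split.
    by rewrite (le_trans (ler_normD _ _))// (ger0_norm t0); lra.
  by rewrite (le_trans (ler_normB _ _))// (ger0_norm t0); lra.
have dp (f : R -> R) (l t : R) : is_derive (c + t) 1 f l -> is_derive t 1 (fun t : R => f (c + t)) l.
  move=> h; rewrite (_ : (fun t => _) = (fun t => f (t - - c))).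
    by apply: is_derive_shift; rewrite opprK addrC.
  by apply/funext => u; rewrite opprK addrC.
have dm (f : R -> R) (l t : R) : is_derive (c - t) 1 f l -> is_derive t 1 (fun t : R => f (c - t)) (- l).
  move=> h; have := @is_derive1_comp R (fun t : R => f (c + t)) (fun t : R => - t) t l (-1).
  by rewrite mulrN1; apply.
(* [k] is the derivative of the [h] below. It starts at 0 and is nondecreasing, because the
   derivative [bes 2] of [bes 1] is at least 2/5. *)
pose k := (fun t : R => bes 1 (c + t) - bes 1 (c - t)) \- ((4 / 5 : R) \*: id).
have dk (t : R) : is_derive t 1 k (bes 2 (c + t) + bes 2 (c - t) - 4 / 5).
  have d1 := dp _ _ _ (is_derive_bes 1 (c + t)).
  have d2 := dm _ _ _ (is_derive_bes 1 (c - t)).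
  have d3 : is_derive t 1 ((4 / 5 : R) \*: id) (4 / 5 * 1) by apply: is_deriveZ.
  by have := is_deriveB (is_deriveB d1 d2) d3; rewrite opprK mulr1.
have ct (f df : R -> R) (a a' : R) : (forall t : R, is_derive t 1 f (df t)) -> {within `[a, a'], continuous f}.
  move=> h; apply: derivable_within_continuous => t _.
  by have [] := h t.
have k0 (t : R) : 0 <= t <= b -> 0 <= k t.
  move=> /andP[t0 tb]; have <- : k 0 = 0 by rewrite /k /= addr0 subr0 subrr scaler0 subrr.
  apply: (ndecr_off_finite (B := [::]) t0 (ct _ _ _ _ dk)) => x /andP[x0 xt] _.
  have [|h1 h2] := inr x; first by rewrite (ltW x0) (le_trans (ltW xt)).
  have [_ _] := hr h1; have [_ _] := hr h2; rewrite !ler_norml.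
  by move=> /andP[? ?] /andP[? ?]; lra.
pose h := (fun t : R => bes 0 (c + t) + bes 0 (c - t)) \- ((2 / 5 : R) \*: (fun t : R => t ^+ 2)).
have dh (t : R) : is_derive t 1 h (k t).
  rewrite /k /= /GRing.scale/= (_ : 4 / 5 * t = 2 / 5 * (2 * t)); last lra.
  have d1 := dp _ _ _ (is_derive_bes 0 (c + t)).
  have d2 := dm _ _ _ (is_derive_bes 0 (c - t)).
  have d3 : is_derive t 1 ((2 / 5 : R) \*: (fun t : R => t ^+ 2)) (2 / 5 * (2 * t)).
    apply: is_deriveZ; apply: DeriveDef; first exact: exprn_derivable.
    by rewrite exp_derive /GRing.scale/= mulr1 expr1.
  exact: (is_deriveB (is_deriveD d1 d2) d3).
have : h 0 <= h b.
  apply: (ndecr_off_finite (B := [::]) b0 (ct _ _ _ _ dh)) => x /andP[x0 xb] _.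
  by apply: k0; rewrite !ltW.
rewrite /h /= /GRing.scale/= addr0 subr0 expr0n/=; lra.
Qed.

(** With c = 3 s (z - 1) and b = 3 |s| the three kernels form a second difference of [bes 0], at
    least 18/5 s^2. The term in e is controlled by bes 0 >= 9/10. Both constants are then rounded
    down. *)
Lemma W0_piece3 s e z : `|s| <= r / 12 -> 0 <= e -> 2 < z < 3 ->
  W 0 s e z <= - (3 * s ^+ 2 + e / 2).
Proof.
move=> hs e0 /andP[z2 z3]; rewrite /W /ker !ifT; [|lra|lra|lra].
rewrite !expr0 !mul1r.
have xa : `|z - 2| <= 4 by rewrite ger0_norm; lra.
have [+ _ _] := hr (arg_small hs xa); rewrite ler_norml => /andP[b0 b0'].
have := @bes_second_difference (3 * s * (z - 1)) (3 * `|s|).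
have -> : 2 / 5 * (3 * `|s|) ^+ 2 = 18 / 5 * s ^+ 2.
  by rewrite exprMn real_normK ?num_real//; lra.
have s2 := sqr_ge0 s.
move=> /(_ ltac:(by rewrite mulr_ge0)) h.
have {}h : 18 / 5 * s ^+ 2 <= bes 0 (3 * s * z) - 2 * bes 0 (3 * s * (z - 1)) + bes 0 (3 * s * (z - 2)).
  have : `|3 * s * (z - 1)| + 3 * `|s| <= r.
    rewrite !normrM (ger0_norm (_ : 0 <= 3))// (ger0_norm (_ : 0 <= z - 1)); last lra.
    have : `|s| * z <= r / 12 * 3 by apply: ler_pM => //; lra.
    by have := normr_ge0 s; lra.
  move=> /h; have [s0|s0] := ger0P s.
    rewrite (_ : 3 * s * (z - 1) + 3 * s = 3 * s * z); last ring.
    by rewrite (_ : 3 * s * (z - 1) - 3 * s = 3 * s * (z - 2)); last ring.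
  rewrite (_ : 3 * s * (z - 1) + 3 * - s = 3 * s * (z - 2)); last ring.
  rewrite (_ : 3 * s * (z - 1) - 3 * - s = 3 * s * z); last ring.
  by lra.
have : e / 2 <= e * bes 0 (3 * s * (z - 2)) by nra.
lra.
Qed.

End bounds.

(** * Position, value and source as functions of the energy *)

Section lagrangian.
Variable R : realType.
Notation mu := (@lebesgue_measure R).
Implicit Types (E s e z : R).

(** Freezing z at [E] discards the energy beyond [E]: E = 2 describes the states that have lost the
    piece [2, 3]. *)
Definition lU E s e z := W 1 s e (Num.min z E).

Definition lV E s e z := W 2 s e (Num.min z E).

Definition lq E s e z := if z < E then W 0 s e z else 0.

(** Starting at -1, where the integrand vanishes, makes z = 0 an interior point for the continuity
    of the integral. *)
Definition Xint s e z := \int[mu]_(y in `[-1, z]) (W 0 s e y ^+ 2).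

Definition lX E s e z := Num.min z 0 + Xint s e (Num.min z E) + Num.max (z - E) 0.

Definition brk E : seq R := [:: 0; 1; 2; E].

Lemma notin_brk E z : z \notin brk E -> z \notin [:: 0; 1; 2].
Proof. by rewrite !inE !negb_or => /and4P[-> -> -> _]. Qed.

Lemma Xint_neg s e z : z <= 0 -> Xint s e z = 0.
Proof.
move=> z0; rewrite /Xint /Rintegral integral0_eq// => y /=; rewrite in_itv/= => /andP[_ yz].
by rewrite W_neg ?expr0n// (le_trans yz).
Qed.

Section bounded.
Variable r : R.
Hypothesis hr : forall z, `|z| <= r ->
  [/\ `|bes 0 z - 1| <= 10^-1, `|bes 1 z - 1| <= 10^-1 & `|bes 2 z - 2^-1| <= 10^-1].

Section fixed_time.
Variables (s e E : R).
Hypotheses (hs : `|s| <= r / 12) (he : 0 <= e <= 1) (E0 : 0 < E) (E3 : E <= 3).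

Lemma integrable_W0 : mu.-integrable `[-1, 4] (EFin \o (fun y => W 0 s e y ^+ 2)).
Proof.
have mW : measurable_fun (`[-1, +oo[ : set (measurableTypeR R)) (W 0 s e : _ -> measurableTypeR R).
  by apply: (measurable_off_finite (B := [:: 0; 1; 2])) => x _; exact: continuous_W.
have mW4 : measurable_fun (`[-1, 4] : set (measurableTypeR R)) (fun y => W 0 s e y ^+ 2).
  apply: measurable_funX; apply: (@measurable_funS _ _ _ _ (`[-1, +oo[ : set R)) => //.
  by move=> x /=; rewrite !in_itv/= => /andP[->].
apply: (integrable_boxed (C := 100 ^+ 2) (M := 4)) => // x /=; rewrite in_itv/= => /andP[x1 x4].
have [x0|x0] := leP x 0; first by rewrite W_neg// expr0n/= normr0 mulr_ge0// indicE.
rewrite indicE mem_set/= ?in_itv/= ?(ltW x0)// mulr1 normrX lerXn2r ?nnegrE//.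
exact: (W_bound hr).
Qed.

Lemma continuous_Xint z : z < 4 -> {for z, continuous (Xint s e)}.
Proof.
move=> z4; change (Xint s e y @[y --> z] --> Xint s e z).
have [z0|z0] := ltP z 0.
  rewrite (Xint_neg _ _ (ltW z0)); apply: cvg_near_cst.
  by apply: filterS (lt_nbhsl z0) => y y0; rewrite Xint_neg// ltW.
have a4 : -1 < 4 :> R by lra.
have := parameterized_integral_continuous (ltW a4) integrable_W0.
move=> /(continuous_within_itvP _ a4)[+ _ _]; apply.
by rewrite in_itv/= z4 andbT; lra.
Qed.

Lemma is_derive_Xint z : 0 < z -> z < 4 -> z \notin [:: 0; 1; 2] ->
  is_derive z 1 (Xint s e) (W 0 s e z ^+ 2).
Proof.
move=> z0 z4 zB.
have cz : {for z, continuous (fun y => W 0 s e y ^+ 2)}.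
  have c1 : W 0 s e y @[y --> z] --> W 0 s e z by exact: continuous_W.
  exact: (cvgM c1 c1).
have [dF F'] := continuous_FTC1_closed z4 integrable_W0 (lt_trans (ltrN10 R) z0) cz.
by rewrite -F' derive1E; exact: DeriveDef.
Qed.

Lemma continuous_min_cst c : continuous (fun z : R => Num.min z c).
Proof. by move=> z; apply: continuous_min; [exact: cvg_id|exact: cvg_cst]. Qed.

Lemma continuous_lX : continuous (lX E s e).
Proof.
move=> z; have c1 := @continuous_min_cst 0 z.
have c2 : Num.max (y - E) 0 @[y --> z] --> Num.max (z - E) 0.
  have cm (x : R) : Num.max y 0 @[y --> x] --> Num.max x 0.
    by apply: continuous_max; [exact: cvg_id|exact: cvg_cst].
  have cs : y - E @[y --> z] --> z - E by apply: cvgB; [exact: cvg_id|exact: cvg_cst].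
  exact: (continuous_comp cs (cm (z - E))).
have c3 : Xint s e (Num.min y E) @[y --> z] --> Xint s e (Num.min z E).
  apply: (continuous_comp (@continuous_min_cst E z)); apply: continuous_Xint.
  have E4 : E < 4 by move: E3; lra.
  by rewrite gt_min E4 orbT.
exact: (cvgD (cvgD c1 c3) c2).
Qed.

Lemma continuous_lU : continuous (lU E s e).
Proof. by move=> z; apply: (continuous_comp (@continuous_min_cst E z)); exact: continuous_WS. Qed.

Lemma continuous_lV : continuous (lV E s e).
Proof. by move=> z; apply: (continuous_comp (@continuous_min_cst E z)); exact: continuous_WS. Qed.

Lemma lX_left z : z <= 0 -> lX E s e z = z.
Proof.
move=> z0; rewrite /lX (min_l z0) Xint_neg ?max_r ?addr0 ?ge_min ?z0//.
by rewrite subr_le0 (le_trans z0)// ltW.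
Qed.

Lemma lX_mid z : 0 <= z <= E -> lX E s e z = Xint s e z.
Proof.
move=> /andP[z0 zE]; rewrite /lX (min_r z0) (min_l zE) max_r ?addr0 ?add0r//.
by rewrite subr_le0.
Qed.

Lemma lX_right z : E <= z -> lX E s e z = Xint s e E + (z - E).
Proof.
move=> Ez; rewrite /lX (min_r Ez) max_l ?subr_ge0// min_r ?add0r//.
by rewrite (le_trans _ Ez)// ltW.
Qed.

Lemma brk_cases z : z \notin brk E ->
  [\/ z < 0, 0 < z < E | E < z].
Proof.
rewrite !inE !negb_or => /and4P[z0 _ _ zE].
have [zn|zp] := ltP z 0; first exact: Or31.
have zp' : 0 < z by rewrite lt_neqAle eq_sym z0.
have [zn'|zp''] := ltP z E; first by apply: Or32; rewrite zp'.
by apply: Or33; rewrite lt_neqAle eq_sym zE.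
Qed.

Lemma near_itvoo z a b : a < z < b -> \forall y \near z, a < y < b.
Proof.
move=> /andP[az zb]; apply: filterS2 (lt_nbhsr az) (lt_nbhsl zb) => y ay yb.
by rewrite ay yb.
Qed.

Lemma is_derive_near_eq (f g : R -> R) z l : (\forall y \near z, g y = f y) ->
  is_derive z 1 f l -> is_derive z 1 g l.
Proof.
by move=> fg; apply: near_eq_is_derive; apply: filterS fg => y ->.
Qed.

Lemma is_derive_lX z : z \notin brk E -> is_derive z 1 (lX E s e) (jac E (lq E s e) z).
Proof.
move=> zB; rewrite /jac; have [zn|zm|zp] := brk_cases zB.
- rewrite [0 < z]ltNge (ltW zn)/=.
  apply: (is_derive_near_eq (f := id)).
  by apply: filterS (lt_nbhsl zn) => y /ltW; exact: lX_left.
- rewrite zm /lq (andP zm).2; apply: (is_derive_near_eq (f := Xint s e)).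
    by apply: filterS (near_itvoo zm) => y /andP[/ltW h1 /ltW h2]; rewrite lX_mid// h1.
  move/andP: zm => [z0 zE].
  apply: is_derive_Xint => //; last exact: notin_brk zB.
  by rewrite (lt_trans zE)//; move: E3; lra.
- rewrite andbC ltNge (ltW zp)/=.
  apply: (is_derive_near_eq (f := fun z => Xint s e E + (z - E))).
    by apply: filterS (lt_nbhsr zp) => y /ltW; exact: lX_right.
  rewrite -[X in is_derive _ _ _ X]add0r; apply: is_deriveD.
  by rewrite -[X in is_derive _ _ _ X]subr0; apply: is_deriveB.
Qed.

Lemma is_derive_lW m z : z \notin brk E ->
  is_derive z 1 (fun z => W m.+1 s e (Num.min z E)) (if z < E then W m s e z else 0).
Proof.
move=> zB; have [zE|Ez] := ltP z E.
  apply: (is_derive_near_eq (f := W m.+1 s e)).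
    by apply: filterS (lt_nbhsl zE) => y /ltW yE; rewrite min_l.
  by apply: is_derive_W; exact: notin_brk zB.
have {}Ez : E < z by rewrite lt_neqAle Ez andbT; apply: contraNneq zB => <-; rewrite !inE eqxx !orbT.
apply: (is_derive_near_eq (f := cst (W m.+1 s e E))).
by apply: filterS (lt_nbhsr Ez) => y /ltW yE; rewrite min_r.
Qed.

Lemma profile_lagrangian :
  profile E (brk E) (lX E s e) (lU E s e) (lV E s e) (lq E s e).
Proof.
split.
- exact: E0.
- by rewrite inE eqxx.
- by rewrite !inE eqxx !orbT.
- exact: continuous_lX.
- exact: continuous_lU.
- exact: continuous_lV.
- exact: is_derive_lX.
- by move=> z; exact: is_derive_lW.
- move=> z zB; have := is_derive_lW 1 zB.
  have [z0|z0] := leP z 0; last first.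
    by rewrite /lU; case: ltP => // zE; rewrite min_l// ltW.
  by rewrite (W_neg _ _ _ z0) if_same.
- move=> z zB; change (lq E s e y @[y --> z] --> lq E s e z).
  have [zE|Ez] := ltP z E.
    rewrite {2}/lq zE; have c1 : W 0 s e y @[y --> z] --> W 0 s e z.
      by apply: continuous_W; exact: notin_brk zB.
    apply: cvg_trans c1; apply: near_eq_cvg; apply: filterS (lt_nbhsl zE) => y yE.
    by rewrite /lq yE.
  have {}Ez : E < z by rewrite lt_neqAle Ez andbT; apply: contraNneq zB => <-; rewrite !inE eqxx !orbT.
  rewrite {2}/lq ltNge (ltW Ez)/=; apply: cvg_near_cst.
  by apply: filterS (lt_nbhsr Ez) => y Ey; rewrite /lq ltNge (ltW Ey).
- move=> z _; rewrite negb_and -!leNgt /lq => /orP[z0|Ez]; last by rewrite ltNge Ez.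
  by rewrite W_neg// if_same.
- exact: lX_left.
- by move=> z Ez; rewrite !lX_right// subrr addr0.
- by move=> z z0; rewrite /lU W_neg// ge_min z0.
- by move=> z z0; rewrite /lV W_neg// ge_min z0.
Qed.

End fixed_time.
End bounded.
End lagrangian.

(** * Dependence on time and on the perturbation *)

Section parameters.
Variable R : realType.
Implicit Types (E s e z : R).

Lemma lipschitz_abs (f df : R -> R) C (a b : R) :
  (forall x, Num.min a b <= x <= Num.max a b -> is_derive x 1 f (df x)) ->
  (forall x, Num.min a b <= x <= Num.max a b -> `|df x| <= C) ->
  `|f b - f a| <= C * `|b - a|.
Proof.
wlog ab : a b / a <= b => [h fd dfC|].
  case/orP: (le_total a b) => ab; first exact: h.
  by rewrite distrC [X in _ * X]distrC; apply: h => // x; rewrite minC maxC; [exact: fd|exact: dfC].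
rewrite min_l// max_r// => fd dfC; rewrite [X in _ * X]ger0_norm ?subr_ge0//.
apply: (lipschitz_off_finite (B := [::]) (df := df) ab) => [|x /andP[ax xb] _|x /andP[ax xb] _].
- apply: derivable_within_continuous => x; rewrite in_itv/= => xab.
  by have [] := fd x xab.
- by apply: fd; rewrite !ltW.
- by apply: dfC; rewrite !ltW.
Qed.

Lemma taylor2 (f df ddf : R -> R) C (a b : R) :
  (forall x, Num.min a b <= x <= Num.max a b -> is_derive x 1 f (df x)) ->
  (forall x, Num.min a b <= x <= Num.max a b -> is_derive x 1 df (ddf x)) ->
  (forall x, Num.min a b <= x <= Num.max a b -> `|ddf x| <= C) ->
  `|f b - f a - (b - a) * df a| <= C * (b - a) ^+ 2.
Proof.
move=> fd dfd ddfC.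
have C0 : 0 <= C by rewrite (le_trans _ (ddfC a _))// ge_min le_max lexx/=.
have h x : Num.min a b <= x <= Num.max a b -> `|df x - df a| <= C * `|b - a|.
  move=> /andP[x1 x2]; have sub y : Num.min a x <= y <= Num.max a x -> Num.min a b <= y <= Num.max a b.
    move=> /andP[y1 y2]; rewrite (le_trans _ y1) ?le_min ?x1 ?ge_min ?lexx//=.
    by rewrite (le_trans y2)// ge_max x2 le_max lexx.
  rewrite (le_trans (lipschitz_abs (df := ddf) (C := C) _ _))//.
  - by move=> y /sub; exact: dfd.
  - by move=> y /sub; exact: ddfC.
  - rewrite ler_wpM2l//; move: x1 x2; rewrite ge_min le_max.
    by case: (lerP a b) => ab; case: (lerP a x) => ax; lra.
pose g := f \- (df a \*: id).
have := @lipschitz_abs g (fun x => df x - df a) (C * `|b - a|) a b.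
rewrite /g /= /GRing.scale/=.
rewrite (_ : f b - df a * b - (f a - df a * a) = f b - f a - (b - a) * df a); last ring.
rewrite -mulrA -expr2 real_normK ?num_real//; apply; last exact: h.
move=> x xab; apply: is_deriveB; first exact: fd.
by rewrite -[X in is_derive _ _ _ X]mulr1; apply: is_deriveZ.
Qed.

(** A quadratic remainder suffices; this is how [Xint] is differentiated in s. *)
Lemma is_derive_quadratic (f : R -> R) (a l C d : R) : 0 < d ->
  (forall b, `|b - a| < d -> `|f b - f a - (b - a) * l| <= C * (b - a) ^+ 2) ->
  is_derive a 1 f l.
Proof.
move=> d0 h.
have hl : h^-1 *: (f (h + a) - f a) @[h --> 0^'] --> l.
  apply/cvgrPdist_le => eps eps0.
  have C1 : 0 < `|C| + 1 by rewrite ltr_wpDl.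
  near=> x; have x0 : x != 0 by near: x; exact: nbhs_dnbhs_neq.
  have xd : `|x| < d by near: x; apply: dnbhs0_lt.
  have xe : `|x| < eps / (`|C| + 1) by near: x; apply: dnbhs0_lt; rewrite divr_gt0.
  have := h (x + a); rewrite addrK => /(_ xd) hx.
  rewrite /GRing.scale/= (_ : l - x^-1 * (f (x + a) - f a) = - (x^-1 * (f (x + a) - f a - x * l))); last first.
    by field.
  rewrite normrN normrM normfV ler_pdivrMl ?normr_gt0// (le_trans hx)//.
  rewrite -real_normK ?num_real// expr2 mulrA [C * _]mulrC -mulrA ler_wpM2l//.
  move: xe; rewrite ltr_pdivlMr// => xe; rewrite (le_trans _ (ltW xe))// mulrC ler_wpM2l//.
  by rewrite (le_trans (ler_norm _))// lerDl.
apply: DeriveDef; last by rewrite -derive1E; exact: cvg_lim hl.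
apply/cvg_ex; exists l; rewrite (_ : (fun h => _) = fun h => h^-1 *: (f (h + a) - f a))//.
by apply/funext => x; rewrite /= [_%:A]mulr1.
Unshelve. all: by end_near. Qed.

Section bounded.
Variable r : R.
Hypothesis hr : forall z, `|z| <= r ->
  [/\ `|bes 0 z - 1| <= 10^-1, `|bes 1 z - 1| <= 10^-1 & `|bes 2 z - 2^-1| <= 10^-1].

Lemma between_small s s' x : `|s| <= r / 12 -> `|s'| <= r / 12 ->
  Num.min s s' <= x <= Num.max s s' -> `|x| <= r / 12.
Proof.
rewrite !ler_norml ge_min le_max => /andP[h1 h2] /andP[h3 h4] /andP[].
by case/orP=> h5 /orP[h6|h6]; apply/andP; split; lra.
Qed.

Lemma W_lip_s m s s' e z : (m <= 1)%N -> `|s| <= r / 12 -> `|s'| <= r / 12 -> 0 <= e <= 1 ->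
  z <= 4 -> `|W m s' e z - W m s e z| <= 300 * `|s' - s|.
Proof.
move=> m1 hs hs' he z4.
apply: (lipschitz_abs (f := fun s => W m s e z) (df := fun s => 3 * W m.+1 s e z)) => x hx.
  exact: is_derive_W_s.
have := @W_bound R r hr m.+1 x e z m1 (between_small hs hs' hx) he z4.
by rewrite normrM ger0_norm//; lra.
Qed.

Lemma W_lip_e m s e e' z : (m <= 2)%N -> `|s| <= r / 12 ->
  z <= 4 -> `|W m s e' z - W m s e z| <= 20 * `|e' - e|.
Proof.
move=> m2 hs z4; rewrite /W.
rewrite (_ : _ - _ = (e - e') * ker m s (z - 2)); last ring.
have z4' : z - 2 <= 4 by lra.
rewrite normrM distrC mulrC ler_wpM2r//; exact: (ker_bound hr m2 hs z4').
Qed.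

Lemma within_Xint s e z : `|s| <= r / 12 -> 0 <= e <= 1 -> z < 4 ->
  {within `[0, z], continuous (Xint s e)}.
Proof.
move=> hs he z4; apply: continuous_in_subspaceT => x; rewrite inE/= in_itv/= => /andP[_ xz].
by apply: (continuous_Xint hr hs he); rewrite (le_lt_trans xz).
Qed.

(** In a difference of squares, 20 |e' - e| bounds the difference and 200 the sum; 3 is the length
    of the interval. *)
Lemma Xint_lip_e s e e' z : `|s| <= r / 12 -> 0 <= e <= 1 -> 0 <= e' <= 1 -> z <= 3 ->
  `|Xint s e' z - Xint s e z| <= 20 * 200 * 3 * `|e' - e|.
Proof.
move=> hs he he' z3; have [z0|z0] := leP z 0.
  by rewrite !Xint_neg// subrr normr0 !mulr_ge0.
have z4 : z < 4 by lra.
have := @lipschitz_off_finite R [:: 0; 1; 2] (Xint s e' \- Xint s e)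
  (fun x => W 0 s e' x ^+ 2 - W 0 s e x ^+ 2) (20 * 200 * `|e' - e|) 0 z (ltW z0).
rewrite /= !(Xint_neg _ _ (lexx 0)) !subr0 => h.
rewrite (le_trans (h _ _ _))//.
- by move=> x; apply: cvgB; exact: within_Xint.
- move=> x /andP[x0 xz] xB; apply: is_deriveB; apply: (is_derive_Xint hr) => //;
  exact: lt_trans xz z4.
- move=> x /andP[x0 xz] xB; have x4 : x <= 4 by lra.
  have h1 := @W_lip_e 0 s e e' x isT hs x4.
  have h2 := W_bound hr (m := 0) isT hs he x4.
  have h3 := W_bound hr (m := 0) isT hs he' x4.
  rewrite subr_sqr normrM.
  have h4 : `|W 0 s e' x + W 0 s e x| <= 200 by rewrite (le_trans (ler_normD _ _))//; lra.
  by rewrite (le_trans (ler_pM _ _ h1 h4))//; lra.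
- by have := normr_ge0 (e' - e); nra.
Qed.

(** The s-derivative 6 W_0 W_1 of W_0^2 is also the z-derivative of 3 W_1^2. Hence the first-order
    remainder in s vanishes at z = 0, and its z-derivative is a Taylor remainder of W_0^2, of order
    (b - s)^2. *)
Lemma is_derive_Xint_s s e z : `|s| < r / 12 -> 0 <= e <= 1 -> z < 4 ->
  is_derive s 1 (fun s => Xint s e z) (3 * W 1 s e z ^+ 2).
Proof.
move=> hs he z4; have [z0|z0] := leP z 0.
  rewrite W_neg// expr0n mulr0 (_ : (fun _ => _) = cst 0); first exact: is_derive_cst.
  by apply/funext => t; rewrite Xint_neg.
have d0 : 0 < r / 12 - `|s| by rewrite subr_gt0.
(* The second s-derivative of W_0^2 is 18 (W_1^2 + W_0 W_2), each factor being at most 100; 4 bounds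
   the length of [0, z]. *)
apply: (is_derive_quadratic (C := 18 * (100 * 100 + 100 * 100) * 4) d0) => b hb.
have hsb : `|b| <= r / 12.
  by have := ler_normD (b - s) s; rewrite subrK; lra.
pose f := (Xint b e \- Xint s e) \- (fun z => (b - s) * (3 * W 1 s e z ^+ 2)).
pose df x := (W 0 b e x ^+ 2 - W 0 s e x ^+ 2) - (b - s) * (6 * W 0 s e x * W 1 s e x).
have := @lipschitz_off_finite R [:: 0; 1; 2] f df (18 * (100 * 100 + 100 * 100) * (b - s) ^+ 2) 0 z (ltW z0).
rewrite /f /= !(Xint_neg _ _ (lexx 0)) (W_neg _ _ _ (lexx 0)) expr0n/= !mulr0 !subr0 => h.
rewrite (le_trans (h _ _ _))//.
- have c1 : {within `[0, z], continuous (fun z => (b - s) * (3 * W 1 s e z ^+ 2))}.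
    apply: continuous_subspaceT => x; apply: cvgMr; apply: cvgMr.
    have c1 : W 1 s e y @[y --> x] --> W 1 s e x by exact: continuous_WS.
    exact: (cvgM c1 c1).
  by move=> x; apply: cvgB; [apply: cvgB; apply: within_Xint => //; exact: ltW|exact: c1].
- move=> x /andP[x0 xz] xB; have x4 := lt_trans xz z4.
  apply: is_deriveB.
    by apply: is_deriveB; apply: (is_derive_Xint hr) => //; exact: ltW.
  have d1 := is_derive_W 0 s e xB.
  have d2 : is_derive x 1 (((b - s) * 3) \*: (W 1 s e * W 1 s e))
      (((b - s) * 3) * (W 1 s e x * W 0 s e x + W 1 s e x * W 0 s e x)).
    by apply: is_deriveZ.
  rewrite (_ : (fun z => _) = ((b - s) * 3) \*: (W 1 s e * W 1 s e)); last first.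
    by apply/funext => y; rewrite /GRing.scale/= expr2 mulrA.
  by rewrite (_ : _ * (6 * _ * _) = ((b - s) * 3) * (W 1 s e x * W 0 s e x + W 1 s e x * W 0 s e x)); [|ring].
- move=> x /andP[x0 xz] xB; have x4 : x <= 4 by lra.
  apply: (taylor2 (f := fun s => W 0 s e x ^+ 2) (df := fun s => 6 * W 0 s e x * W 1 s e x)
     (ddf := fun s => 18 * (W 1 s e x ^+ 2 + W 0 s e x * W 2 s e x))).
  + move=> t _; have d1 := is_derive_W_s 0 t e x.
    have := is_deriveM d1 d1.
    rewrite (_ : _ * _ = (fun s => W 0 s e x ^+ 2)); last by apply/funext => u; rewrite expr2.
    by congr is_derive; rewrite /GRing.scale/=; ring.
  + move=> t _; have d1 := is_derive_W_s 0 t e x; have d2 := is_derive_W_s 1 t e x.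
    have := is_deriveZ 6 (is_deriveM d1 d2).
    rewrite (_ : _ \*: _ = (fun s => 6 * W 0 s e x * W 1 s e x)); last first.
      by apply/funext => u; rewrite -mulrA.
    by congr is_derive; rewrite /GRing.scale/=; ring.
  + move=> t ht; have ht' := between_small (ltW hs) hsb ht.
    have h0 := W_bound hr (m := 0) isT ht' he x4.
    have h1 := W_bound hr (m := 1) isT ht' he x4.
    have h2 := W_bound hr (m := 2) isT ht' he x4.
    rewrite normrM ger0_norm// (le_trans (ler_wpM2l _ (ler_normD _ _)))//.
    have := ler_pM (normr_ge0 _) (normr_ge0 _) h0 h2; have := ler_pM (normr_ge0 _) (normr_ge0 _) h1 h1.
    by rewrite -!normrM -expr2; lra.
- by have := sqr_ge0 (b - s); nra.
Qed.

Lemma is_derive_lX_s E s e z : `|s| < r / 12 -> 0 <= e <= 1 -> E <= 3 ->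
  is_derive s 1 (fun s => lX E s e z) (3 * lU E s e z ^+ 2).
Proof.
move=> hs he E3; have m4 : Num.min z E < 4 by rewrite gt_min (_ : E < 4) ?orbT//; lra.
have d1 := is_derive_Xint_s hs he m4.
rewrite /lX /lU -[X in is_derive _ _ _ X]addr0 -[X in is_derive _ _ _ (X + _)]add0r.
apply: is_deriveD.
Qed.

Lemma is_derive_lU_s E s e z : is_derive s 1 (fun s => lU E s e z) (3 * lV E s e z).
Proof. exact: is_derive_W_s. Qed.

Lemma lU_bound E s e z : `|s| <= r / 12 -> 0 <= e <= 1 -> E <= 3 -> `|lU E s e z| <= 100.
Proof.
by move=> hs he E3; apply: (W_bound hr) => //; rewrite ge_min (_ : E <= 4) ?orbT//; lra.
Qed.

Lemma lU_lip_s E s s' e z : `|s| <= r / 12 -> `|s'| <= r / 12 -> 0 <= e <= 1 -> E <= 3 ->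
  `|lU E s' e z - lU E s e z| <= 300 * `|s' - s|.
Proof.
by move=> hs hs' he E3; apply: W_lip_s => //; rewrite ge_min (_ : E <= 4) ?orbT//; lra.
Qed.

Lemma lX_lip_s E s s' e z C : `|s| < r / 12 -> `|s'| < r / 12 -> 0 <= e <= 1 -> E <= 3 ->
  (forall x, Num.min s s' <= x <= Num.max s s' -> 3 * lU E x e z ^+ 2 <= C) ->
  `|lX E s' e z - lX E s e z| <= C * `|s' - s|.
Proof.
move=> hs hs' he E3 hC.
apply: (lipschitz_abs (f := fun s => lX E s e z) (df := fun s => 3 * lU E s e z ^+ 2)) => x hx.
  apply: is_derive_lX_s => //.
  move: hx hs hs'; rewrite !ltr_norml ge_min le_max => /andP[] + + /andP[h1 h2] /andP[h3 h4].
  by case/orP=> h5 /orP[h6|h6]; apply/andP; split; lra.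
by rewrite ger0_norm ?hC// mulr_ge0// sqr_ge0.
Qed.

Lemma lX_ndecr_s E s s' e z : `|s| < r / 12 -> `|s'| < r / 12 -> 0 <= e <= 1 -> E <= 3 ->
  s <= s' -> lX E s e z <= lX E s' e z.
Proof.
move=> hs hs' he E3 ss.
have hd x : s <= x <= s' -> is_derive x 1 (fun s => lX E s e z) (3 * lU E x e z ^+ 2).
  move=> /andP[h5 h6]; apply: is_derive_lX_s => //.
  by move: hs hs'; rewrite !ltr_norml => /andP[h1 h2] /andP[h3 h4]; apply/andP; split; lra.
apply: (ndecr_off_finite (B := [::]) (f := fun s => lX E s e z)
   (df := fun s => 3 * lU E s e z ^+ 2) ss).
- by apply: derivable_within_continuous => x; rewrite in_itv/= => /hd[].
- by move=> x /andP[h1 h2] _; apply: hd; rewrite !ltW.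
- by move=> x _ _; rewrite mulr_ge0// sqr_ge0.
Qed.

End bounded.
End parameters.

(** * Time derivative at a fixed position *)

Section moving.
Variable R : realType.

(** Strict monotonicity of the limit puts X z between X_t (z - d) and X_t (z + d) eventually, and
    monotonicity of X_t then traps the preimage. The filter is free so as to serve limits in time
    and in the perturbation. *)
Lemma inv_cvg (T : Type) (F : set_system T) {FF : Filter F} (X_ : T -> R -> R) (X : R -> R) (z : R) :
  (forall a b, a < b -> X a < X b) ->
  (\forall t \near F, (forall a b, a <= b -> X_ t a <= X_ t b) /\
     forall x, X_ t (inv (X_ t) x) = x) ->
  (forall y, X_ t y @[t --> F] --> X y) -> inv (X_ t) (X z) @[t --> F] --> z.
Proof.
move=> Xi X_n XX; apply/cvgrPdist_lt => d d0.
have X1 : X (z - d) < X z by apply: Xi; lra.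
have X2 : X z < X (z + d) by apply: Xi; lra.
have h1 : \forall t \near F, X_ t (z - d) < X z by exact: (cvgr_lt _ (XX (z - d))).
have h2 : \forall t \near F, X z < X_ t (z + d) by exact: (cvgr_gt _ (XX (z + d))).
apply: filterS3 X_n h1 h2 => t [mono iK] a1 a2.
rewrite ltr_norml; apply/andP; split; rewrite ltNge; apply/negP => b.
  have : z + d <= inv (X_ t) (X z) by lra.
  by move=> /mono; rewrite iK leNgt a2.
have : inv (X_ t) (X z) <= z - d by lra.
by move=> /mono; rewrite iK leNgt a1.
Qed.

(** The error is measured by the increment of X, not of z, because in [is_derive_moving] it is the
    former that is known to be O(h). *)
Lemma increment_slope (E : R) (B : seq R) (X U V q : R -> R) (w eta a b : R) :
  profile E B X U V q -> 0 <= eta ->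
  (forall z, Num.min a b <= z <= Num.max a b -> z \notin B ->
     `|q z - w * jac E q z| <= eta * jac E q z) ->
  `|U b - U a - w * (X b - X a)| <= eta * `|X b - X a|.
Proof.
move=> P eta0.
wlog ab : a b / a <= b => [h hq|].
  case/orP: (le_total a b) => ab; first exact: h.
  rewrite (distrC (X b)); have -> : `|U b - U a - w * (X b - X a)| = `|U a - U b - w * (X a - X b)|.
    by rewrite -normrN; congr (`|_|); ring.
  by apply: h => // z; rewrite minC maxC; exact: hq.
rewrite min_l// max_r// => hq.
rewrite [X in _ <= _ * X]ger0_norm ?subr_ge0 ?(X_ndecr P)//.
rewrite (_ : U b - U a - w * (X b - X a) = (U b - w * X b) - (U a - w * X a)); last ring.
rewrite mulrBr; apply: (ler_increment_off_finite (B := B) (f := U \- (w \*: X)) (g := eta \*: X)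
  (df := fun z => q z - w * jac E q z) (dg := fun z => eta * jac E q z) ab).
- apply: continuous_subspaceT => z; apply: cvgB; first exact: (prU P).
  by apply: cvgZr; exact: (prX P).
- by apply: continuous_subspaceT => z; apply: cvgZr; exact: (prX P).
- move=> z _ zB; apply: is_deriveB; first exact: (prdU P).
  by apply: is_deriveZ; exact: (prdX P).
- by move=> z _ zB; apply: is_deriveZ; exact: (prdX P).
- by move=> z /andP[az zb]; apply: hq; rewrite !ltW.
Qed.

Lemma is_derive_limit (f : R -> R) (a l : R) :
  h^-1 *: (f (h + a) - f a) @[h --> 0^'] --> l -> is_derive a 1 f l.
Proof.
move=> hl; apply: DeriveDef; last by rewrite -derive1E; exact: cvg_lim hl.
apply/cvg_ex; exists l; rewrite (_ : (fun h => _) = fun h => h^-1 *: (f (h + a) - f a))//.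
by apply/funext => x; rewrite /= [_%:A]mulr1.
Qed.

Lemma limit_is_derive (f : R -> R) (a l : R) :
  is_derive a 1 f l -> h^-1 *: (f (h + a) - f a) @[h --> 0^'] --> l.
Proof.
move=> [/cvg_ex[l' hl'] fl].
have fl' : l = l' by rewrite -fl; exact: cvg_lim hl'.
rewrite fl' (_ : (fun h => _) = fun h => h^-1 *: ((f \o shift a) h%:A - f a))//.
by apply/funext => x; rewrite /= [_%:A]mulr1.
Qed.

Lemma near_dnbhs_shift (a : R) (A : R -> Prop) :
  (\forall x \near a, A x) -> \forall h \near 0^', A (h + a).
Proof.
move=> /nbhs_ballP[d /= d0 h]; near=> x; apply: h; rewrite /ball/= opprD addrCA subrr addr0 normrN.
by near: x; exact: dnbhs0_lt.
Unshelve. all: by end_near. Qed.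

(* Eulerian time derivative: d/ds (U o X^-1) = U_s - w X_s, where w = U_z / X_z. *)
Lemma is_derive_moving (E : R) (B : seq R) (X U V q : R -> R -> R) (s z w a b : R) :
  (\forall t \near s, profile E B (X t) (U t) (V t) (q t)) ->
  (forall x y, x < y -> X s x < X s y) ->
  (forall y, {for s, continuous (X ^~ y)}) ->
  (forall eta, 0 < eta -> exists2 d, 0 < d & \forall t \near s, forall y, `|y - z| < d ->
     y \notin B -> `|q t y - w * jac E (q t) y| <= eta * jac E (q t) y) ->
  is_derive s 1 (X ^~ z) a -> is_derive s 1 (U ^~ z) b ->
  is_derive s 1 (fun t => eul (X t) (U t) (X s z)) (b - w * a).
Proof.
move=> P Xi Xc hq dX dU.
have Ps := nbhs_singleton P.
apply: is_derive_limit.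
have cX := limit_is_derive dX; have cU := limit_is_derive dU.
set A := fun h => h^-1 *: (U (h + s) z - U s z).
set C := fun h => h^-1 *: (X (h + s) z - X s z).
pose D := fun h => h^-1 *: (eul (X (h + s)) (U (h + s)) (X s z) - eul (X s) (U s) (X s z)).
rewrite -/D.
have cAC : A h - w * C h @[h --> 0^'] --> b - w * a.
  by apply: cvgB; [exact: cU|apply: cvgMr; exact: cX].
suff rem : D h - (A h - w * C h) @[h --> 0^'] --> 0.
  have c := cvgD rem cAC; rewrite add0r in c.
  suff <- : (fun h => (D h - (A h - w * C h)) + (A h - w * C h)) = D by exact: c.
  by apply/funext => h; rewrite subrK.
have iz : inv (X t) (X s z) @[t --> s] --> z.
  apply: inv_cvg => //.
  by apply: filterS P => t Pt; split; [exact: (X_ndecr Pt)|exact: (invK Pt)].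
apply/cvgrPdist_le => eps eps0.
have a1 : 0 < `|a| + 1 by rewrite ltr_wpDl.
have [d d0 hd] := hq (eps / (`|a| + 1)) (divr_gt0 eps0 a1).
have nC : \forall h \near 0^', `|C h| < `|a| + 1.
  by apply: (cvgr_lt _ (cvg_norm cX)); rewrite ltrDl.
have niz : \forall t \near s, `|inv (X t) (X s z) - z| < d.
  have /cvgrPdist_lt/(_ _ d0) := iz.
  by apply: filterS => t; rewrite distrC.
have nP := near_dnbhs_shift P; have nhd := near_dnbhs_shift hd; have niz' := near_dnbhs_shift niz.
near=> h.
have h0 : h != 0 by near: h; exact: nbhs_dnbhs_neq.
have Pt : profile E B (X (h + s)) (U (h + s)) (V (h + s)) (q (h + s)) by near: h.
have Ch : `|C h| < `|a| + 1 by near: h.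
have ht : `|inv (X (h + s)) (X s z) - z| < d by near: h.
have hd' : forall y, `|y - z| < d -> y \notin B ->
  `|q (h + s) y - w * jac E (q (h + s)) y| <= eps / (`|a| + 1) * jac E (q (h + s)) y by near: h.
rewrite sub0r normrN.
set y := inv (X (h + s)) (X s z) in ht.
have := @increment_slope E B _ _ _ _ w (eps / (`|a| + 1)) z y Pt.
have Xy : X (h + s) y = X s z by exact: (invK Pt).
(* As X (h + s) y = X s z, the remainder is the increment of U - w X from z to y, taken at the time
   h + s. *)
have -> : D h - (A h - w * C h) = h^-1 * (U (h + s) y - U (h + s) z - w * (X (h + s) y - X (h + s) z)).
  rewrite Xy /D /A /C /GRing.scale/= (eul_at Ps (erefl _)) /eul -/y; ring.
have -> : X (h + s) y - X (h + s) z = - (h * C h) by rewrite Xy /C /GRing.scale/= mulrA divff// mul1r opprB.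
move=> hinc; rewrite normrM normfV ler_pdivrMl ?normr_gt0//.
rewrite (le_trans (hinc _ _))//.
- by rewrite divr_ge0 ?ltW.
- move=> x; rewrite ge_min le_max => /andP[x1 x2] xB; apply: hd' => //.
  move: ht; rewrite !ltr_norml => /andP[t1 t2].
  by apply/andP; case/orP: x1 => x1; case/orP: x2 => x2; split; lra.
- rewrite normrN normrM mulrCA ler_wpM2l// mulrAC ler_pdivrMr//.
  by rewrite ler_wpM2l// ltW.
Unshelve. all: by end_near. Qed.

End moving.

(** * Criteria for solutions and balance of energy *)

Section solution_criterion.
Variable R : realType.
Notation mu := (@lebesgue_measure R).

Lemma hoelder_continuous (w : R -> R) E : 0 < E ->
  (forall x y, (w x - w y) ^+ 2 <= E * `|x - y|) -> continuous w.
Proof.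
move=> E0 h x; apply/cvgrPdist_lt => e e0.
have d0 : 0 < e ^+ 2 / E by rewrite divr_gt0// exprn_gt0.
near=> y; rewrite -(@ltr_pXn2r _ 2)// ?nnegrE ?(ltW e0)//.
rewrite real_normK ?num_real// (le_lt_trans (h _ _))//.
have : `|x - y| < e ^+ 2 / E by near: y; exact: cvgr_dist_lt.
by rewrite ltr_pdivlMr// mulrC.
Unshelve. all: by end_near. Qed.

Lemma hoelder_sqrt (a b E : R) : 0 <= E -> a ^+ 2 <= E * `|b| -> `|a| <= Num.sqrt E * (`|b| `^ 2^-1).
Proof.
move=> E0 h; rewrite powR12_sqrt// -sqrtrM// -sqrtr_sqr; exact: ler_wsqrtr.
Qed.

Lemma measurable_itv_continuous (w : R -> R) M : continuous w ->
  measurable_fun (`[0, M] : set (measurableTypeR R)) w.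
Proof. by move=> wc; apply: measurable_funTS; exact: continuous_measurable_fun. Qed.

Lemma bounded_Rplus (g : R -> R) C (B : seq R) :
  (forall x, 0 < x -> x \notin B -> `|g x| <= C) ->
  exists2 C', 0 <= C' & forall x, 0 <= x -> `|g x| <= C'.
Proof.
move=> gC; apply: (bounded_off_finite (B := 0 :: B) (D := [set x | 0 <= x]) (C := C)) => x /= x0.
by rewrite inE negb_or => /andP[xn0 xB]; apply: gC => //; rewrite lt_neqAle eq_sym xn0.
Qed.

Variables (f : R -> R) (T E C : R) (ubar : R -> R) (u : R -> R -> R) (TB : seq R).
Hypotheses (E0 : 0 < E) (C0 : 0 <= C) (T0 : 0 < T).
Hypothesis u_t : forall t s x, `|u t x - u s x| <= C * `|t - s|.
Hypothesis u_x : forall t x y, (u t x - u t y) ^+ 2 <= E * `|x - y|.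
Hypothesis u_init : forall x, 0 <= x -> u 0 x = ubar x.
Hypothesis u_bound : forall t, u t 0 = 0.
Hypothesis u_lip : forall t, exists2 Ct, 0 <= Ct & forall x y, `|u t x - u t y| <= Ct * `|x - y|.
Hypothesis du_meas : forall t, measurable_fun (`[0, +oo[ : set (measurableTypeR R)) (derive1 (u t)).
Hypothesis du_bnd : forall t, exists C', exists B : seq R,
  forall x, x \notin B -> `|derive1 (u t) x| <= C'.
Hypothesis rhs_meas : forall t, measurable_fun (`[0, +oo[ : set (measurableTypeR R)) (evolution_rhs f (u t)).
Hypothesis u_evol : forall t, 0 < t < T -> t \notin TB -> exists B : seq R,
  forall x, 0 < x -> x \notin B -> is_derive t 1 (u ^~ x) (evolution_rhs f (u t) x).

Lemma u_continuous t : continuous (u t).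
Proof. exact: hoelder_continuous (u_x t). Qed.

Lemma loc_hoelder_criterion : loc_hoelder T u.
Proof.
move=> M M0; exists 2^-1, (C * Num.sqrt T + Num.sqrt E); split=> //; first by lra.
move=> t s x y /andP[t0 tT] /andP[s0 sT] _ _.
have -> : u t x - u s y = (u t x - u s x) + (u s x - u s y) by ring.
rewrite (le_trans (ler_normD _ _))// mulrDr.
have h1 : `|u t x - u s x| <= C * Num.sqrt T * `|t - s| `^ 2^-1.
  rewrite (le_trans (u_t _ _ _))// -mulrA ler_wpM2l// powR12_sqrt// -sqrtrM ?(ltW T0)//.
  have {1}-> : `|t - s| = Num.sqrt (`|t - s| ^+ 2) by rewrite sqrtr_sqr normr_id.
  apply: ler_wsqrtr; rewrite expr2 ler_wpM2r//.
  by rewrite ler_norml; apply/andP; split; lra.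
have h2 := hoelder_sqrt (ltW E0) (u_x s x y).
have p1 : 0 <= `|t - s| `^ 2^-1 by exact: powR_ge0.
have p2 : 0 <= `|x - y| `^ 2^-1 by exact: powR_ge0.
have q1 : 0 <= C * Num.sqrt T by rewrite mulr_ge0// sqrtr_ge0.
have q2 : 0 <= Num.sqrt E by exact: sqrtr_ge0.
by nra.
Qed.

Lemma in_L2_itv (g : R -> R) (M C' : R) (B : seq R) : measurable_fun (`[0, +oo[ : set (measurableTypeR R)) g ->
  (forall x, 0 < x -> x \notin B -> `|g x| <= C') -> in_L2 `[0, M] g.
Proof.
move=> mg gC.
have [C'' C''0 hC''] := bounded_Rplus gC.
apply: (in_L2_boxed (C := C'') (M := M)) => //.
  apply: (@measurable_funS _ _ _ _ (`[0, +oo[ : set R)) => //.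
  by move=> x /=; rewrite !in_itv/= => /andP[->].
by move=> x xM; rewrite indicE mem_set// mulr1 hC''//; move: xM; rewrite /= in_itv/= => /andP[].
Qed.

(** The right-hand side is a limit of difference quotients in time, so its bound is the Lipschitz
    constant in time. *)
Lemma rhs_bound t : 0 < t < T -> t \notin TB -> exists B : seq R,
  forall x, 0 < x -> x \notin B -> `|evolution_rhs f (u t) x| <= C.
Proof.
move=> tT tTB; have [B hB] := u_evol tT tTB; exists B => x x0 xB.
have c := limit_is_derive (hB x x0 xB).
have c' : `|h^-1 *: (u (h + t) x - u t x)| @[h --> 0^'] --> `|evolution_rhs f (u t) x|.
  exact: (cvg_norm c).
rewrite -(cvg_lim (@Rhausdorff R) c'); apply: limr_le; first by apply/cvg_ex; eexists; exact: c'.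
near=> h; have h0 : h != 0 by near: h; exact: nbhs_dnbhs_neq.
rewrite /GRing.scale/= normrM normfV ler_pdivrMl ?normr_gt0//.
by rewrite (le_trans (u_t _ _ _))// addrK mulrC.
Unshelve. all: by end_near. Qed.

(** Differentiability in time at all but finitely many x is enough: the Lipschitz bound dominates
    the difference quotients, and dominated convergence turns pointwise into L^2 convergence. *)
Lemma solution_criterion : is_solution f T ubar u.
Proof.
split.
- exact: loc_hoelder_criterion.
- exact: u_init.
- by move=> t _; exact: u_bound.
- move=> t tT; split=> M M0.
    have [Ct Ct0 hCt] := u_lip t.
    apply: (lipschitz_abs_continuous Ct0) => s s' _ ss' _.
    by rewrite /dist_R lee_fin (le_trans (hCt _ _))// distrC ger0_norm ?subr_ge0.
  have [C' [B hB]] := du_bnd t.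
  by apply: (in_L2_itv M (du_meas t) (B := B)) => x _; exact: hB.
- move=> M M0; split.
    apply: (@lipschitz_abs_continuous _ _ _ _ _ _ (C * Num.sqrt M)).
      by rewrite mulr_ge0// sqrtr_ge0.
    move=> s t _ st _; rewrite /dist_L2 mulrAC; apply: L2norm_le.
    - by apply: measurable_itv_continuous => x; apply: cvgB; exact: u_continuous.
    - by rewrite mulr_ge0// subr_ge0.
    - exact: ltW.
    - by move=> x _; rewrite (le_trans (u_t _ _ _))// distrC ger0_norm ?subr_ge0.
  apply: (@ae_off_finite _ [:: 0, T & TB]) => t.
  rewrite !inE !negb_or => /and3P[t0 tT tTB] /andP[t0' tT'].
  have tin : 0 < t < T by rewrite !lt_neqAle t0' tT' eq_sym t0 tT.
  have [B1 hB1] := rhs_bound tin tTB; have [B2 hB2] := u_evol tin tTB.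
  split; first exact: (in_L2_itv M (rhs_meas t) hB1).
  have mrhs : measurable_fun (`[0, M] : set (measurableTypeR R)) (evolution_rhs f (u t)).
    apply: (@measurable_funS _ _ _ _ (`[0, +oo[ : set R)) => //.
      by move=> x /=; rewrite !in_itv/= => /andP[->].
    exact: rhs_meas.
  have [C' C'0 hC'] := bounded_Rplus hB1.
  apply: (@L2norm_dnbhs0 _ (0 :: B2) _ (C + C') M
    (fun h x => h^-1 * (u (t + h) x - u t x) - evolution_rhs f (u t) x)) => //.
  - by rewrite addr_ge0.
  - move=> h; apply: measurable_funB => //; apply: measurable_itv_continuous => x.
    by apply: cvgMr; apply: cvgB; exact: u_continuous.
  - move=> h h0 x xM; rewrite indicE mem_set// mulr1 (le_trans (ler_normB _ _))// lerD//; last first.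
      by apply: hC'; move: xM; rewrite /= in_itv/= => /andP[].
    rewrite normrM normfV ler_pdivrMl ?normr_gt0//.
    by rewrite (le_trans (u_t _ _ _))// addrAC subrr add0r mulrC.
  - move=> x /=; rewrite in_itv/= inE negb_or => /andP[x0 _] /andP[xn0 xB].
    have {}x0 : 0 < x by rewrite lt_neqAle eq_sym xn0.
    have := limit_is_derive (hB2 x x0 xB) => c.
    have c1 : h^-1 * (u (h + t) x - u t x) - evolution_rhs f (u t) x @[h --> 0^'] -->
      evolution_rhs f (u t) x - evolution_rhs f (u t) x by exact: (cvgB c (cvg_cst _)).
    by move: c1; rewrite subrr; under eq_fun do rewrite [_ + t]addrC.
Unshelve. all: by end_near. Qed.

End solution_criterion.

(** * Calculus of test functions *)

Section test_function.
Variable R : realType.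
Notation mu := (@lebesgue_measure R).
Variable phi : R -> R -> R.
Hypothesis T : test_function phi.
Implicit Types t x : R.

Lemma dt_continuous t x : d_t phi p.1 p.2 @[p --> (t, x)] --> d_t phi t x.
Proof. by have [_ h _ _ _] := T; exact: (h (t, x)). Qed.

Lemma dx_continuous t x : d_x phi p.1 p.2 @[p --> (t, x)] --> d_x phi t x.
Proof. by have [_ _ h _ _] := T; exact: (h (t, x)). Qed.

Lemma is_derive_t t x : is_derive t 1 (phi ^~ x) (d_t phi t x).
Proof. by have [/(_ t x)[h _] _ _ _ _] := T; apply: DeriveDef => //; rewrite /d_t derive1E. Qed.

Lemma is_derive_x t x : is_derive x 1 (phi t) (d_x phi t x).
Proof. by have [/(_ t x)[_ h] _ _ _ _] := T; apply: DeriveDef => //; rewrite /d_x derive1E. Qed.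

(** The increment splits into one in t at the moved point y (h + t), handled by a mean value bound
    and the joint continuity of [d_t phi], and one of [phi t \o y], handled by the one-variable
    chain rule. *)
Lemma is_derive_along (y : R -> R) t y' : is_derive t 1 y y' ->
  is_derive t 1 (fun t => phi t (y t)) (d_t phi t (y t) + d_x phi t (y t) * y').
Proof.
move=> dy; apply: is_derive_limit.
have c2 := limit_is_derive (is_derive1_comp (is_derive_x t (y t)) dy).
suff c1 : h^-1 * (phi (h + t) (y (h + t)) - phi t (y (h + t))) @[h --> 0^'] --> d_t phi t (y t).
  have c := cvgD c1 c2.
  suff <- : (fun h => h^-1 * (phi (h + t) (y (h + t)) - phi t (y (h + t))) +
     h^-1 *: ((phi t \o y) (h + t) - (phi t \o y) t)) =
     (fun h => h^-1 *: (phi (h + t) (y (h + t)) - phi t (y t))) by exact: c.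
  by apply/funext => h; rewrite /= /GRing.scale/= -mulrDr addrA subrK.
apply/cvgrPdist_le => eps eps0.
have /cvgrPdist_le/(_ _ eps0)/nbhs_ballP[d /= d0 hd] := @dt_continuous t (y t).
have yc : {for t, continuous y}.
  by apply/differentiable_continuous/derivable1_diffP; have [] := dy.
have ny : \forall s \near t, `|y s - y t| < d.
  by have /cvgrPdist_lt/(_ _ d0) := yc; apply: filterS => s; rewrite distrC.
have ny' := near_dnbhs_shift ny.
near=> h.
have h0 : h != 0 by near: h; exact: nbhs_dnbhs_neq.
have hd' : `|h| < d by near: h; exact: dnbhs0_lt.
have yh : `|y (h + t) - y t| < d by near: h.
pose g := (phi ^~ (y (h + t))) \- (d_t phi t (y t) \*: id).
have := @lipschitz_abs R g (fun s => d_t phi s (y (h + t)) - d_t phi t (y t)) eps t (h + t).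
rewrite addrK /g /= /GRing.scale/= => hl.
rewrite distrC (_ : _ - _ = h^-1 * (phi (h + t) (y (h + t)) - d_t phi t (y t) * (h + t) -
  (phi t (y (h + t)) - d_t phi t (y t) * t))); last by field.
rewrite normrM normfV ler_pdivrMl ?normr_gt0// [_ * eps]mulrC; apply: hl.
  move=> s _; apply: is_deriveB; first exact: is_derive_t.
  by rewrite -[X in is_derive _ _ _ X]mulr1; apply: is_deriveZ.
move=> s hs; rewrite distrC; apply: (hd (s, y (h + t))); split => /=; last first.
  by rewrite /ball/= distrC.
rewrite /ball/= distrC (le_lt_trans _ hd')//.
move: hs; rewrite ge_min le_max => /andP[s1 s2].
have := ler_norm h; have := ler_norm (- h); rewrite normrN => n1 n2.
by rewrite ler_norml; apply/andP; case/orP: s1 => s1; case/orP: s2 => s2; split; lra.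
Unshelve. all: by end_near. Qed.

Lemma off_support (t x : R) : ~ closure [set p : R * R | phi p.1 p.2 != 0] (t, x) ->
  d_t phi t x = 0 /\ d_x phi t x = 0.
Proof.
set K := closure _ => nK.
have oK : open (~` K) by apply: closed_openC; exact: closed_closure.
have : nbhs (t, x) (~` K) by apply: open_nbhs_nbhs.
move=> /nbhs_ballP[d /= d0 hd].
have phi0 s y : ball t d s -> ball x d y -> phi s y = 0.
  move=> bs b2; case: (eqVneq (phi s y) 0) => // ne; exfalso.
  by apply: (hd (s, y)); [split|exact: subset_closure].
have nt : \forall s \near t, 0 = phi s x.
  by apply/nbhs_ballP; exists d => // s bs; rewrite phi0//; exact: ballxx.
have nx : \forall y \near x, 0 = phi t y.
  by apply/nbhs_ballP; exists d => // y b2; rewrite phi0//; exact: ballxx.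
split; rewrite /d_t /d_x derive1E.
- by have [_ ->] : is_derive t 1 (phi ^~ x) 0 by apply: near_eq_is_derive nt (is_derive_cst _ _ _).
- by have [_ ->] : is_derive x 1 (phi t) 0 by apply: near_eq_is_derive nx (is_derive_cst _ _ _).
Qed.

Lemma derivatives_bounded : exists2 M, 0 <= M &
  forall t x, `|d_t phi t x| <= M /\ `|d_x phi t x| <= M.
Proof.
have [_ ct cx cK _] := T.
have /compact_bounded[M1 [_ hM1]] := continuous_compact (continuous_subspaceT ct) cK.
have /compact_bounded[M2 [_ hM2]] := continuous_compact (continuous_subspaceT cx) cK.
exists (`|M1| + `|M2| + 1); first by rewrite !addr_ge0.
move=> t x; have [K|/off_support[-> ->]] :=
  pselect (closure [set p : R * R | phi p.1 p.2 != 0] (t, x)); last first.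
  by rewrite normr0 !addr_ge0.
have n1 := ler_norm M1; have n2 := ler_norm M2.
have n3 := normr_ge0 M1; have n4 := normr_ge0 M2.
by split; [apply: hM1|apply: hM2]; [lra|exists (t, x)|lra|exists (t, x)].
Qed.

End test_function.

(** * Transport of the energy along the characteristics *)

Section energy_flow.
Variable R : realType.
Notation mu := (@lebesgue_measure R).
Variables (phi : R -> R -> R) (X U : R -> R -> R) (a b E K : R).
Hypothesis T : test_function phi.
Hypothesis Xc : forall t, a < t < b -> continuous (X t).
Hypothesis Uc : forall t, a < t < b -> continuous (U t).
Hypothesis Xt : forall t z, a < t < b -> is_derive t 1 (X ^~ z) (3 * U t z ^+ 2).
Hypothesis Ut : forall t z, a < t < b -> {for t, continuous (U ^~ z)}.
Hypothesis UK : forall t z, a < t < b -> `|U t z| <= K.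

(** The time derivative of phi along a characteristic; with it the balance of energy becomes the
    fundamental theorem of calculus in t. *)
Definition transport t z := d_t phi t (X t z) + d_x phi t (X t z) * (3 * U t z ^+ 2).

Definition energy t := \int[mu]_(z in `[0, E]) phi t (X t z).

Definition energy_rate t := \int[mu]_(z in `[0, E]) transport t z.

Lemma is_derive_energy_density t z : a < t < b ->
  is_derive t 1 (fun t => phi t (X t z)) (transport t z).
Proof. by move=> tab; apply: is_derive_along => //; exact: Xt. Qed.

Lemma continuous_phi_x t : continuous (phi t).
Proof.
by move=> x; apply/differentiable_continuous/derivable1_diffP; have [] := is_derive_x T t x.
Qed.

Lemma integrable_itv (g : R -> R) c d : continuous g -> mu.-integrable `[c, d] (EFin \o g).
Proof.
move=> gc; apply: continuous_compact_integrable; first exact: segment_compact.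
exact: continuous_subspaceT.
Qed.

Lemma integrable_energy_density t : a < t < b ->
  mu.-integrable `[0, E] (EFin \o (fun z => phi t (X t z))).
Proof.
move=> tab; apply: integrable_itv => z.
exact: (continuous_comp (Xc tab (x := z)) (@continuous_phi_x t (X t z))).
Qed.

Lemma transport_cvg (S : Type) (F : set_system S) {FF : Filter F} (s y v : S -> R) (s0 y0 v0 : R) :
  s p @[p --> F] --> s0 -> y p @[p --> F] --> y0 -> v p @[p --> F] --> v0 ->
  d_t phi (s p) (y p) + d_x phi (s p) (y p) * (3 * v p ^+ 2) @[p --> F] -->
  d_t phi s0 y0 + d_x phi s0 y0 * (3 * v0 ^+ 2).
Proof.
move=> cs cy cv.
have cp : (s p, y p) @[p --> F] --> (s0, y0) by exact: (cvg_pair cs cy).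
have c1 := cvg_comp _ _ cp (dt_continuous T (t := s0) (x := y0)).
have c2 := cvg_comp _ _ cp (dx_continuous T (t := s0) (x := y0)).
have c3 : 3 * v p ^+ 2 @[p --> F] --> 3 * v0 ^+ 2.
  by apply: cvgMr; exact: (cvgM cv cv).
exact: (cvgD c1 (cvgM c2 c3)).
Qed.

Lemma continuous_transport_z t : a < t < b -> continuous (transport t).
Proof.
move=> tab z; apply: transport_cvg; first exact: cvg_cst.
  exact: Xc.
exact: Uc.
Qed.

Lemma continuous_transport_t t z : a < t < b -> {for t, continuous (transport ^~ z)}.
Proof.
move=> tab; apply: transport_cvg; first exact: cvg_id.
  by apply/differentiable_continuous/derivable1_diffP; have [] := Xt z tab.
exact: Ut.
Qed.

Lemma transport_bounded : exists2 G, 0 <= G & forall t z, a < t < b -> `|transport t z| <= G.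
Proof.
have [M M0 hM] := derivatives_bounded T.
exists (M + M * (3 * K ^+ 2)).
  by rewrite addr_ge0// mulr_ge0// mulr_ge0// sqr_ge0.
move=> t z tab; have [h1 h2] := hM t (X t z).
rewrite /transport (le_trans (ler_normD _ _))// lerD// normrM ler_pM// normrM ger0_norm//.
rewrite ler_wpM2l// normrX lerXn2r ?nnegrE ?UK//.
by rewrite (le_trans _ (UK z tab)).
Qed.

Lemma in_oo t : (t \in (`]a, b[ : set R)) = (a < t < b).
Proof. by apply/idP/idP; rewrite inE /= in_itv. Qed.

Lemma is_derive_energy t : a < t < b -> is_derive t 1 energy (energy_rate t).
Proof.
move=> tab; have [G G0 hG] := transport_bounded.
have Iab x : (`]a, b[ : set R) x -> a < x < b by rewrite /= in_itv.
have It : (`]a, b[ : set R) t by rewrite /= in_itv.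
have part x y : a < x < b -> partial1of2 (fun t z => phi t (X t z)) x y = transport x y.
  by move=> xab; rewrite partial1of2E; have [_ ->] := is_derive_energy_density y xab.
have h1 : forall x, (`]a, b[ : set R) x -> mu.-integrable `[0, E] (EFin \o (fun z => phi x (X x z))).
  by move=> x /Iab; exact: integrable_energy_density.
have h2 : forall x y, (`]a, b[ : set R) x -> (`[0, E] : set R) y ->
    derivable (fun t => phi t (X t y)) x 1.
  by move=> x y /Iab xab _; have [] := is_derive_energy_density y xab.
have h3 : mu.-integrable `[0, E] (EFin \o cst G).
  by apply: integrable_itv; exact: cst_continuous.
have h4 : forall x y, (`]a, b[ : set R) x -> (`[0, E] : set R) y ->
    `|partial1of2 (fun t z => phi t (X t z)) x y| <= cst G y.
  by move=> x y /Iab xab _; rewrite part// hG.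
have mE : measurable (`[0, E] : set (measurableTypeR R)) by exact: measurable_itv.
have dF := derivable_under_integral mE It h1 h2 (fun=> G0) h3 h4.
apply: DeriveDef; first exact: dF.
rewrite -derive1E (differentiation_under_integral mE It h1 h2 (fun=> G0) h3 h4).
by apply: eq_Rintegral => z _; rewrite part.
Qed.

Lemma continuous_energy_rate t : a < t < b -> {for t, continuous energy_rate}.
Proof.
move=> tab; have [G G0 hG] := transport_bounded.
have Iab x : (`]a, b[ : set R) x -> a < x < b by rewrite /= in_itv.
have mE : measurable (`[0, E] : set (measurableTypeR R)) by exact: measurable_itv.
have h1 : forall x, (`]a, b[ : set R) x -> mu.-integrable `[0, E] (EFin \o transport x).
  by move=> x /Iab xab; apply: integrable_itv; exact: continuous_transport_z.
have h2 : {ae mu, forall y, (`[0, E] : set R) y -> {in (`]a, b[ : set R), continuous (transport ^~ y)}}.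
  by apply/aeW => y _ x; rewrite in_oo => xab; exact: continuous_transport_t.
have h3 : mu.-integrable `[0, E] (EFin \o cst G).
  by apply: integrable_itv; exact: cst_continuous.
have h4 : forall x, (`]a, b[ : set R) x ->
    {ae mu, forall y, (`[0, E] : set R) y -> `|transport x y| <= cst G y}.
  by move=> x /Iab xab; apply/aeW => y _; exact: hG.
have := continuity_under_integral mE h1 h2 h3 h4; apply.
by rewrite in_oo.
Qed.

Lemma integrable_energy_rate c d : a < c -> d < b -> mu.-integrable `[c, d] (EFin \o energy_rate).
Proof.
move=> ac db; apply: continuous_compact_integrable; first exact: segment_compact.
apply: continuous_in_subspaceT => t; rewrite inE/= in_itv/= => /andP[ct td].
by apply: continuous_energy_rate; rewrite (lt_le_trans ac)//= (le_lt_trans td).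
Qed.

Lemma integral_energy_rate c d : a < c -> c <= d -> d < b ->
  \int[mu]_(t in `[c, d]) energy_rate t = energy d - energy c.
Proof.
move=> ac; rewrite le_eqVlt => /predU1P[<- _|cd db].
  by rewrite set_itv1 Rintegral_set1 subrr.
have sub t : c <= t <= d -> a < t < b.
  by move=> /andP[ct td]; rewrite (lt_le_trans ac)//= (le_lt_trans td).
have ce t : c <= t <= d -> {for t, continuous energy}.
  move=> /sub tab; apply/differentiable_continuous/derivable1_diffP.
  by have [] := is_derive_energy tab.
rewrite /Rintegral (continuous_FTC2 (F := energy) cd)//.
- apply: continuous_in_subspaceT => t; rewrite inE/= in_itv/= => /sub.
  exact: continuous_energy_rate.
- split.
  + move=> t; rewrite in_itv/= => /andP[ct td].
    by have [] := is_derive_energy (sub t _); rewrite ?(ltW ct) ?(ltW td).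
  + by apply: cvg_at_right_filter; apply: ce; rewrite lexx ltW.
  + by apply: cvg_at_left_filter; apply: ce; rewrite lexx ltW.
- move=> t; rewrite in_itv/= => /andP[ct td].
  have tab : a < t < b by apply: sub; rewrite !ltW.
  by rewrite derive1E; have [_ ->] := is_derive_energy tab.
Qed.

End energy_flow.

(** * The states and their evolution *)

Section state.
Variable R : realType.
Notation mu := (@lebesgue_measure R).
Variable r : R.
Hypothesis hr : forall z, `|z| <= r ->
  [/\ `|bes 0 z - 1| <= 10^-1, `|bes 1 z - 1| <= 10^-1 & `|bes 2 z - 2^-1| <= 10^-1].
Implicit Types (E s e x z : R).

Definition state E s e := eul (lX E s e) (lU E s e).

Definition cube (z : R) := z ^+ 3.

(* E = 2 forgets the piece [2, 3] of the energy; for E = 3 the piece has slope X_z > 0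
   unless it is concentrated, i.e. unless s = 0 and e = 0. *)
Definition nondegenerate E s e := E = 2 \/ (E = 3 /\ 0 < 3 * s ^+ 2 + e / 2).

Lemma slope_piece12 E s e z : `|s| <= r / 12 -> z < 2 -> z \notin brk E ->
  `|lq E s e z| <= 10 / 7 * jac E (lq E s e) z.
Proof.
move=> hs z2 zB; have [z0|z0] := leP z 0.
  by rewrite /jac [0 < z]ltNge z0/= /lq W_neg// if_same normr0; lra.
rewrite /jac z0 /= /lq; case: ifPn => zE; last by rewrite normr0; lra.
have z1 : z != 1 by apply: contraNneq zB => ->; rewrite !inE eqxx orbT.
have [zl|zg] := ltP z 1.
  have := @W0_piece1 R r hr s e z hs; rewrite z0 zl => /(_ isT) h.
  by rewrite ler0_norm; nra.
have {}zg : 1 < z by rewrite lt_neqAle eq_sym z1.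
have := @W0_piece2 R r hr s e z hs; rewrite zg z2 => /(_ isT) h.
by rewrite ger0_norm; nra.
Qed.

Lemma slope_piece3 s e k z : `|s| <= r / 12 -> 0 <= e -> 0 < k -> k <= 3 * s ^+ 2 + e / 2 ->
  2 < z -> z \notin brk 3 -> `|lq 3 s e z| <= k^-1 * jac 3 (lq 3 s e) z.
Proof.
move=> hs e0 k0 kse z2 zB; rewrite /jac (_ : 0 < z) /= /lq; last by lra.
case: ifPn => z3; last by rewrite normr0 mulr1 invr_ge0 ltW.
have := @W0_piece3 R r hr s e z hs e0; rewrite z2 z3 => /(_ isT) h.
rewrite ler0_norm; last lra.
by rewrite ler_pdivlMl// expr2; nra.
Qed.

Lemma nondegenerate_lq E s e z : `|s| <= r / 12 -> 0 <= e -> nondegenerate E s e ->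
  0 < z < E -> z \notin brk E -> lq E s e z != 0.
Proof.
move=> hs e0 nd /andP[z0 zE] zB; apply/negP => /eqP q0.
have j0 : jac E (lq E s e) z = 0 by rewrite /jac z0 zE q0 expr0n.
have z2 : z != 2 by apply: contraNneq zB => ->; rewrite !inE eqxx !orbT.
have z1 : z != 1 by apply: contraNneq zB => ->; rewrite !inE eqxx !orbT.
move: q0; rewrite /lq zE => W0.
have [zl|zg] := ltP z 1.
  by have := @W0_piece1 R r hr s e z hs; rewrite z0 zl => /(_ isT); lra.
have {}zg : 1 < z by rewrite lt_neqAle eq_sym z1.
have [zl|zg'] := ltP z 2.
  by have := @W0_piece2 R r hr s e z hs; rewrite zg zl => /(_ isT); lra.
have {}zg' : 2 < z by rewrite lt_neqAle eq_sym z2.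
case: nd => [E2|[E3 k0]]; first by move: zE; rewrite E2; lra.
have z3 : z < 3 by rewrite -E3.
have := @W0_piece3 R r hr s e z hs e0; rewrite zg' z3 => /(_ isT); lra.
Qed.

Lemma nondegenerate_E E s e : nondegenerate E s e -> 2 <= E <= 3.
Proof. by case=> [->|[-> _]]; lra. Qed.

Lemma nondegenerate_slope_le E s e k : `|s| <= r / 12 -> 0 <= e -> nondegenerate E s e ->
  0 < k -> (E = 3 -> k <= 3 * s ^+ 2 + e / 2) ->
  forall z, z \notin brk E -> `|lq E s e z| <= (10 / 7 + k^-1) * jac E (lq E s e) z.
Proof.
move=> hs e0 nd k0 kse z zB; have j0 := jac_ge0 E (lq E s e) z; rewrite mulrDl.
have kj : 0 <= k^-1 * jac E (lq E s e) z by rewrite mulr_ge0// invr_ge0 ltW.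
have [z2|z2] := ltP z 2.
  by rewrite (le_trans (slope_piece12 e hs z2 zB))// lerDl.
have zn2 : z != 2 by apply: contraNneq zB => ->; rewrite !inE eqxx !orbT.
have {}z2 : 2 < z by rewrite lt_neqAle eq_sym zn2.
case: nd => [E2|[E3 _]].
  have -> : lq E s e z = 0 by rewrite /lq E2 ltNge (ltW z2).
  by rewrite normr0 addr_ge0// mulr_ge0//; lra.
rewrite E3 in zB j0 kj *; rewrite (le_trans (slope_piece3 hs e0 k0 (kse E3) z2 zB))// lerDr.
by rewrite mulr_ge0//; lra.
Qed.

Lemma nondegenerate_slope E s e : `|s| <= r / 12 -> 0 <= e -> nondegenerate E s e ->
  exists2 C, 0 <= C & forall z, z \notin brk E -> `|lq E s e z| <= C * jac E (lq E s e) z.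
Proof.
move=> hs e0 nd.
have [k [k0 kse]] : exists k, 0 < k /\ (E = 3 -> k <= 3 * s ^+ 2 + e / 2).
  case: nd => [E2|[E3 k0]]; last by exists (3 * s ^+ 2 + e / 2).
  by exists 1; split => //; rewrite E2 => h; exfalso; move: h; lra.
exists (10 / 7 + k^-1); first by rewrite addr_ge0 ?invr_ge0 ?(ltW k0)//; lra.
exact: nondegenerate_slope_le.
Qed.

Lemma lq_lip_s E s s' e z : `|s| <= r / 12 -> `|s'| <= r / 12 -> 0 <= e <= 1 -> E <= 3 ->
  `|lq E s' e z - lq E s e z| <= 300 * `|s' - s|.
Proof.
move=> hs hs' he E3; rewrite /lq; case: ifPn => zE; last by rewrite subrr normr0 mulr_ge0 ?ler0n.
by apply: (W_lip_s hr) => //; lra.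
Qed.

Lemma lq_lip_e E s e e' z : `|s| <= r / 12 -> E <= 3 ->
  `|lq E s e' z - lq E s e z| <= 20 * `|e' - e|.
Proof.
move=> hs E3; rewrite /lq; case: ifPn => zE; last by rewrite subrr normr0 mulr_ge0 ?ler0n.
by apply: (W_lip_e hr) => //; lra.
Qed.

(* Relative to the energy density, the slope q/q^2 moves little near a nonzero value. *)
Lemma near_inverse (q q0 eta : R) : q0 != 0 -> `|q - q0| <= `|q0| / 2 ->
  `|q - q0| <= eta * q0 ^+ 2 / 2 -> `|q - q0 / q0 ^+ 2 * q ^+ 2| <= eta * q ^+ 2.
Proof.
move=> q00 h1 h2.
have p0 : 0 < `|q0| by rewrite normr_gt0.
have hq : `|q0| / 2 <= `|q|.
  have := ler_normD (q0 - q) q; rewrite subrK distrC; lra.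
have -> : q - q0 / q0 ^+ 2 * q ^+ 2 = q / q0 * (q0 - q) by field.
rewrite !normrM normfV distrC -[q ^+ 2]real_normK ?num_real//.
rewrite mulrAC ler_pdivrMr//; move: h2.
rewrite -[q0 ^+ 2]real_normK ?num_real// => h2.
rewrite (le_trans (ler_wpM2l (normr_ge0 q) h2))//.
have eta0 : 0 <= eta.
  have n := normr_ge0 (q - q0); have n2 : 0 < `|q0| ^+ 2 by rewrite exprn_gt0.
  rewrite leNgt; apply/negP => eta0; have : eta * `|q0| ^+ 2 < 0 by rewrite nmulr_rlt0.
  by move: (le_trans n h2); lra.
rewrite (_ : `|q| * _ = eta * `|q| * `|q0| * (`|q0| / 2)); last by field.
rewrite (_ : eta * `|q| ^+ 2 * `|q0| = eta * `|q| * `|q0| * `|q|); last by ring.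
by rewrite ler_wpM2l// !mulr_ge0.
Qed.

Lemma state_profile E s e : `|s| <= r / 12 -> 0 <= e <= 1 -> 2 <= E <= 3 ->
  profile E (brk E) (lX E s e) (lU E s e) (lV E s e) (lq E s e).
Proof. by move=> hs he /andP[E2 E3]; apply: (profile_lagrangian hr) => //; lra. Qed.

(** The closeness required by [is_derive_moving]. Outside the energy range both slopes are 0;
    inside, [near_inverse] applies once q is near its nonzero value at (s, z). *)
Lemma near_slope_s E s e z : `|s| < r / 12 -> 0 <= e <= 1 -> nondegenerate E s e ->
  z \notin brk E -> forall eta, 0 < eta -> exists2 d, 0 < d & \forall t \near s,
    forall y, `|y - z| < d -> y \notin brk E ->
    `|lq E t e y - lq E s e z / jac E (lq E s e) z * jac E (lq E t e) y| <=
      eta * jac E (lq E t e) y.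
Proof.
move=> hs he nd zB eta eta0; have E23 := nondegenerate_E nd.
have P := state_profile (ltW hs) he E23.
have /andP[E2 E3] := E23.
have [z0|z0E|zE] := brk_cases zB.
- exists (- z); first by rewrite oppr_gt0.
  apply/nbhs_ballP; exists 1; first exact: ltr01.
  move=> t _ y; rewrite ltr_norml => /andP[_ yz] yB.
  have y0 : y <= 0 by lra.
  rewrite (prq0 P zB) ?mul0r ?subr0; last by rewrite [0 < z]ltNge (ltW z0).
  rewrite {1}/lq W_neg// if_same normr0 mulr_ge0 ?(ltW eta0)//; exact: jac_ge0.
- have q0 : lq E s e z != 0.
    by apply: (nondegenerate_lq (ltW hs)) => //; case/andP: he.
  set w := lq E s e z in q0 *.
  have w2 : 0 < w ^+ 2 by rewrite exprn_even_gt0.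
  (* Halved once more because the variations in y and in t use one m each. *)
  pose m := Num.min (`|w| / 2) (eta * w ^+ 2 / 2) / 2.
  have m0 : 0 < m.
    have a1 : 0 < `|w| / 2 by rewrite divr_gt0// normr_gt0.
    have a2 : 0 < eta * w ^+ 2 / 2 by rewrite divr_gt0// mulr_gt0.
    by rewrite /m divr_gt0// lt_min a1 a2.
  have qc : lq E s e y @[y --> z] --> w by exact: (prq P zB).
  have nn : \forall y \near z, `|w - lq E s e y| < m /\ 0 < y < E.
    by apply: filterI; [exact: (@cvgr_dist_lt _ _ _ (nbhs z) _ _ _ qc)|exact: near_itvoo].
  move/nbhs_ballP : nn => [d /= d0 hd].
  exists d => //.
  have ns : \forall t \near s, `|t| < r / 12 /\ 300 * `|t - s| < m.
    have m3 : 0 < m / 300 by rewrite divr_gt0 ?ltr0n.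
    near=> t; split.
      near: t; have /near_itvoo : - (r / 12) < s < r / 12 by rewrite -ltr_norml.
      by apply: filterS => t; rewrite ltr_norml.
    rewrite -ltr_pdivlMl ?ltr0n// mulrC distrC; near: t.
    by apply: (@cvgr_dist_lt _ _ _ (nbhs s) _ id s).
  apply: filterS ns => t [ht hts] y yz yB.
  have [hqy hyE] : `|w - lq E s e y| < m /\ 0 < y < E by apply: hd; rewrite /ball/= distrC.
  rewrite /jac hyE z0E -/w.
  have hq : `|lq E t e y - w| <= Num.min (`|w| / 2) (eta * w ^+ 2 / 2).
    have := @lq_lip_s E s t e y (ltW hs) (ltW ht) he E3 => hl.
    have := ler_normD (lq E t e y - lq E s e y) (lq E s e y - w).
    rewrite addrA subrK => hn; rewrite distrC in hqy.
    rewrite (_ : Num.min _ _ = m + m); last by rewrite /m; lra.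
    lra.
  move: hq; rewrite le_min => /andP[h1 h2].
  exact: near_inverse.
- exists (z - E); first by rewrite subr_gt0.
  apply/nbhs_ballP; exists 1; first exact: ltr01.
  move=> t _ y; rewrite ltr_norml => /andP[yz _] yB.
  have y0 : E <= y by lra.
  rewrite (prq0 P zB) ?mul0r ?subr0; last by rewrite andbC ltNge (ltW zE).
  rewrite {1}/lq ltNge y0/= normr0 mulr_ge0 ?(ltW eta0)//; exact: jac_ge0.
Unshelve. all: by end_near. Qed.

End state.

(** * The equation and the energy of a state *)

Section state_evolution.
Variable R : realType.
Notation mu := (@lebesgue_measure R).
Variable r : R.
Hypothesis hr : forall z, `|z| <= r ->
  [/\ `|bes 0 z - 1| <= 10^-1, `|bes 1 z - 1| <= 10^-1 & `|bes 2 z - 2^-1| <= 10^-1].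
Implicit Types (E s e x z : R).

Lemma derive1_cube z : derive1 (@cube R) z = 3 * z ^+ 2.
Proof. by rewrite derive1E /cube exp_derive /GRing.scale/= mulr1. Qed.

Lemma derive2_cube z : derive1n 2 (@cube R) z = 6 * z.
Proof.
rewrite derive1nS derive1n1 (_ : derive1 (@cube R) = 3 \*: (fun z => z ^+ 2)); last first.
  by apply/funext => y; rewrite derive1_cube.
have d : is_derive z 1 (3 \*: (fun z : R => z ^+ 2)) (3 * (2 * z)).
  apply: is_deriveZ; apply: DeriveDef; first exact: exprn_derivable.
  by rewrite exp_derive /GRing.scale/= mulr1 expr1.
by rewrite derive1E; have [_ ->] := d; rewrite mulrA; congr (_ * _); lra.
Qed.

Section at_time.
Variables (E s e : R).
Hypotheses (hs : `|s| <= r / 12) (he : 0 <= e <= 1) (nd : nondegenerate E s e).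

Let P := state_profile hr hs he (nondegenerate_E nd).
Let e0 : 0 <= e. Proof. by case/andP: he. Qed.
Let qn0 := fun z => nondegenerate_lq hr hs e0 nd (z := z).
Let E0 : 0 < E. Proof. exact: (prE P). Qed.

Lemma state_continuous : continuous (state E s e).
Proof. exact: (eul_continuous P qn0). Qed.

(** Here f''(u) = 6 u, and u_x^2 dx = dz turns the integral into 6 V. *)
Lemma rhs_state x : 0 <= x -> evolution_rhs (@cube R) (state E s e) x =
  3 * lV E s e (inv (lX E s e) x) - derive1 (state E s e) x * (3 * state E s e x ^+ 2).
Proof.
move=> x0; rewrite /evolution_rhs derive1_cube.
have [C C0 hC] := nondegenerate_slope hr hs e0 nd.
have z0 : 0 <= inv (lX E s e) x.
  rewrite leNgt; apply/negP => zn; have := invK P x; rewrite (prXl P (ltW zn)); lra.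
have en : \int[mu]_(y in `[0, x]) (6 * state E s e y * derive1 (state E s e) y ^+ 2) =
    6 * lV E s e (inv (lX E s e) x).
  have c1 : continuous (fun y => 6 * state E s e y).
    by move=> y; apply: cvgMr; exact: state_continuous.
  have c2 : continuous (fun z => 6 * lV E s e z).
    by move=> y; apply: cvgMr; exact: (prV P).
  have V0 : 6 * lV E s e 0 = 0 by rewrite (prV0 P (lexx 0)) mulr0.
  have dV z : z \notin brk E -> 0 < z ->
      is_derive z 1 (fun z => 6 * lV E s e z) (if 0 < z < E then 6 * state E s e (lX E s e z) else 0).
    move=> zB zp; have d : is_derive z 1 (6 \*: lV E s e) (6 * (if 0 < z < E then lU E s e z else 0)).
      by apply: is_deriveZ; exact: (prdV P).
    suff -> : (if 0 < z < E then 6 * state E s e (lX E s e z) else 0) =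
      6 * (if 0 < z < E then lU E s e z else 0) by exact: d.
    by case: ifP => _; rewrite ?mulr0// /state (eul_at P (erefl _)).
  have := energy_eul P qn0 hC c1 c2 V0 dV z0.
  by rewrite (invK P).
have -> : \int[mu]_(y in `[0, x]) (derive1n 2 (@cube R) (state E s e y) * derive1 (state E s e) y ^+ 2) =
    6 * lV E s e (inv (lX E s e) x).
  by rewrite -en; apply: eq_Rintegral => y _; rewrite derive2_cube.
have -> : 2^-1 * (6 * lV E s e (inv (lX E s e) x)) = 3 * lV E s e (inv (lX E s e) x) by lra.
by rewrite addrC [X in _ - X]mulrC.
Qed.

Lemma measurable_rhs_state :
  measurable_fun (`[0, +oo[ : set (measurableTypeR R)) (evolution_rhs (@cube R) (state E s e)).
Proof.
apply: (eq_measurable_fun (fun x => 3 * lV E s e (inv (lX E s e) x) -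
    derive1 (state E s e) x * (3 * state E s e x ^+ 2))).
  by move=> x; rewrite inE/= in_itv/= andbT => x0; rewrite rhs_state.
apply: measurable_funB.
  apply: measurable_funTS; apply: continuous_measurable_fun => x; apply: cvgMr.
  exact: (continuous_comp (@inv_continuous _ _ _ _ _ _ _ P qn0 x) (@prV _ _ _ _ _ _ _ P _)).
apply: measurable_funM; first exact: (measurable_derive1_eul P qn0).
apply: measurable_funTS; apply: continuous_measurable_fun => x; apply: cvgMr.
exact: (cvgM (@state_continuous x) (@state_continuous x)).
Qed.

Lemma energy_state (g : R -> R) : continuous g ->
  energy_int (state E s e) g = \int[mu]_(z in `[0, E]) g (lX E s e z).
Proof.
move=> gc; have [C C0 hC] := nondegenerate_slope hr hs e0 nd.
have XE0 : 0 <= lX E s e E by rewrite -(prXl P (lexx 0)) (X_ndecr P)// ltW.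
have -> : energy_int (state E s e) g =
    \int[mu]_(y in `[0, lX E s e E]) (g y * derive1 (state E s e) y ^+ 2).
  rewrite /energy_int Rintegral_mkcond [RHS]Rintegral_mkcond.
  apply: eq_Rintegral => x _; rewrite !patchE.
  have [x0|x0] := leP 0 x; last first.
    by rewrite !memNset//= in_itv/= leNgt x0.
  rewrite mem_set/= ?in_itv/= ?x0//; case: ifPn => // xn.
  rewrite (derive1_eul_right P) ?expr0n ?mulr0// ltNge; apply: contra xn => xX.
  by rewrite mem_set//= in_itv/= x0.
pose h z := g (lX E s e z).
have hc : continuous h by move=> z; exact: (continuous_comp (@prX _ _ _ _ _ _ _ P z) (gc _)).
(* The interval [-1, E + 1] keeps both 0 and [E] interior; z is later clamped to [0, E] so that the
   primitive is constant beyond [E]. *)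
pose Q z := \int[mu]_(y in `[-1, z]) h y.
have Ei : -1 < E + 1 by move: E0; lra.
have hi : mu.-integrable `[-1, E + 1] (EFin \o h) by exact: integrable_itv.
have Qc z : -1 < z < E + 1 -> {for z, continuous Q}.
  move=> zE; have := parameterized_integral_continuous (ltW Ei) hi.
  by move=> /(continuous_within_itvP _ Ei)[+ _ _]; apply; rewrite in_itv.
have Qd z : 0 < z < E -> is_derive z 1 Q (h z).
  move=> /andP[z0 zE]; have zE1 : z < E + 1 by lra.
  have [dF F'] := continuous_FTC1_closed zE1 hi (lt_trans (ltrN10 R) z0) (hc z).
  by rewrite -F' derive1E; exact: DeriveDef.
have cl z : Num.max (Num.min y E) 0 @[y --> z] --> Num.max (Num.min z E) 0.
  have cm (x : R) : Num.max y 0 @[y --> x] --> Num.max x 0.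
    by apply: continuous_max; [exact: cvg_id|exact: cvg_cst].
  exact: (continuous_comp (@continuous_min_cst R E z) (cm _)).
have Wc : continuous (fun z => Q (Num.max (Num.min z E) 0) - Q 0).
  move=> z; apply: cvgB; last exact: cvg_cst.
  apply: (continuous_comp (cl z)); apply: Qc; apply/andP; split.
    by rewrite lt_max (ltrN10 R) orbT.
  by rewrite gt_max gt_min; apply/andP; split; [apply/orP; right|]; move: E0; lra.
have W0 : Q (Num.max (Num.min 0 E) 0) - Q 0 = 0 by rewrite min_l ?(ltW E0)// maxxx subrr.
have dW z : z \notin brk E -> 0 < z ->
    is_derive z 1 (fun z => Q (Num.max (Num.min z E) 0) - Q 0) (if 0 < z < E then g (lX E s e z) else 0).
  move=> zB z0; case: (brk_cases zB) => [zn|zm|zp].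
  - by move: zn; rewrite ltNge (ltW z0).
  - rewrite zm; apply: (is_derive_near_eq (f := fun y => Q y - Q 0)).
      apply: filterS (near_itvoo zm) => y /andP[y0 yE].
      by rewrite min_l ?(ltW yE)// max_l// ltW.
    have d := Qd z zm.
    by rewrite -[X in is_derive _ _ _ X]subr0; apply: is_deriveB.
  - rewrite andbC ltNge (ltW zp)/=; apply: (is_derive_near_eq (f := cst (Q E - Q 0))).
    by apply: filterS (lt_nbhsr zp) => y Ey; rewrite min_r ?(ltW Ey)// max_l// ltW.
have -> := energy_eul P qn0 hC gc Wc W0 dW (ltW E0).
rewrite minxx max_l ?(ltW E0)// /Q.
have hiE : mu.-integrable `[-1, E] (EFin \o h) by exact: integrable_itv.
rewrite Rintegral_itvB//; [|by rewrite bnd_simp; exact: ltW (ltrN10 R)|by rewrite bnd_simp ltW].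
apply: Rintegral_itv_obnd_cbnd; apply: integrableS hiE => //; apply: subset_itvr.
by rewrite bnd_simp; exact: ltW (ltrN10 R).
Qed.

End at_time.

Lemma is_derive_state E s e x : `|s| < r / 12 -> 0 <= e <= 1 -> nondegenerate E s e ->
  (\forall t \near s, nondegenerate E t e) -> 0 <= x -> inv (lX E s e) x \notin brk E ->
  is_derive s 1 (fun t => state E t e x) (evolution_rhs (@cube R) (state E s e) x).
Proof.
move=> hs he nd ndn x0 zB.
have P := state_profile hr (ltW hs) he (nondegenerate_E nd).
have e0 : 0 <= e by case/andP: he.
have qn0 := fun z => nondegenerate_lq hr (ltW hs) e0 nd (z := z).
have E3 : E <= 3 by case/andP: (nondegenerate_E nd).
set z := inv (lX E s e) x in zB.
have xE : x = lX E s e z by rewrite (invK P).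
have ns : \forall t \near s, `|t| < r / 12.
  have /near_itvoo : - (r / 12) < s < r / 12 by rewrite -ltr_norml.
  by apply: filterS => t; rewrite ltr_norml.
have := @is_derive_moving R E (brk E) (lX E ^~ e) (lU E ^~ e) (lV E ^~ e) (lq E ^~ e) s z
  (lq E s e z / jac E (lq E s e) z) (3 * lU E s e z ^+ 2) (3 * lV E s e z).
rewrite -xE rhs_state//; last exact: ltW.
have -> : derive1 (state E s e) x = lq E s e z / jac E (lq E s e) z by exact: (derive1_eul P qn0).
have -> : state E s e x = lU E s e z by rewrite xE /state (eul_at P (erefl _)).
apply.
- apply: filterS2 ns ndn => t ht ndt.
  by apply: (state_profile hr) => //; [exact: ltW|exact: nondegenerate_E ndt].
- by move=> a b; exact: (X_incr P qn0).
- move=> y; apply/differentiable_continuous/derivable1_diffP.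
  by have [] := is_derive_lX_s hr y hs he E3.
- exact: (near_slope_s hr).
- exact: (is_derive_lX_s hr).
- exact: is_derive_lU_s.
Qed.

End state_evolution.

(** * Estimates in time and the concentrated state *)

Section state_estimates.
Variable R : realType.
Notation mu := (@lebesgue_measure R).
Variable r : R.
Hypothesis hr : forall z, `|z| <= r ->
  [/\ `|bes 0 z - 1| <= 10^-1, `|bes 1 z - 1| <= 10^-1 & `|bes 2 z - 2^-1| <= 10^-1].
Implicit Types (E s e x z : R).

(* On the piece [2, 3], X_z is bounded below by k and the speed 3 U^2 of the
   characteristics is bounded by K k, so that the piece does not spoil the bound. *)
Lemma state_lip_s E s s' e k K x : `|s| < r / 12 -> `|s'| < r / 12 -> 0 <= e <= 1 -> s <= s' ->
  nondegenerate E s e -> 0 < k -> 0 <= K ->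
  (E = 3 -> k <= 3 * s ^+ 2 + e / 2 /\
    forall t z, s <= t <= s' -> 2 <= z -> 3 * lU E t e z ^+ 2 <= K * k) ->
  `|state E s' e x - state E s e x| <= (300 + 10 / 7 * (3 * 100 ^+ 2) + K) * `|s' - s|.
Proof.
move=> hs hs' he ss nd k0 K0 hk.
have e0 : 0 <= e by case/andP: he.
have E23 := nondegenerate_E nd; have /andP[E2 E3] := E23.
have P := state_profile hr (ltW hs) he E23; have P' := state_profile hr (ltW hs') he E23.
(* a and b sit at x at the times s' and s. U is compared between the two times at a, then between a
   and b at the time s. *)
have [a xa] := X_surj P' x; have [b xb] := X_surj P x.
have -> : state E s' e x = lU E s' e a by exact: (eul_at P' xa).
have -> : state E s e x = lU E s e b by exact: (eul_at P xb).
have xba : lX E s e b = lX E s' e a by exact: etrans xb (esym xa).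
move: xba {xa xb x} => xba.
have h0 : 0 <= `|s' - s| by [].
have U1 : `|lU E s' e a - lU E s e a| <= 300 * `|s' - s|.
  by apply: (lU_lip_s hr) => //; exact: ltW.
have XE (z C : R) : (forall t, s <= t <= s' -> 3 * lU E t e z ^+ 2 <= C) ->
    lX E s' e z - lX E s e z <= C * `|s' - s|.
  move=> hC; apply: (le_trans (ler_norm _)); apply: (lX_lip_s hr) => // t.
  by rewrite min_l// max_r//; exact: hC.
have Xa : lX E s e b - lX E s e a <= 3 * 100 ^+ 2 * `|s' - s|.
  rewrite xba; apply: XE => t /andP[t1 t2].
  rewrite ler_wpM2l// -real_normK ?num_real// lerXn2r ?nnegrE//; apply: (lU_bound hr) => //.
  by apply: (between_small (ltW hs) (ltW hs')); rewrite min_l// max_r// t1.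
have Xab : lX E s e a <= lX E s e b by rewrite xba; apply: (lX_ndecr_s hr).
suff U2 : `|lU E s e b - lU E s e a| <= (10 / 7 * (3 * 100 ^+ 2) + K) * `|s' - s|.
  have := ler_normB (lU E s' e a - lU E s e a) (lU E s e b - lU E s e a).
  rewrite (_ : _ - _ - _ = lU E s' e a - lU E s e b); last ring.
  by rewrite -[300 + _ + _]addrA [(300 + _) * _]mulrDl; lra.
have [ba|ab] := leP b a.
  have Xe : lX E s e b = lX E s e a by apply/eqP; rewrite eq_le Xab (X_ndecr P ba).
  have := hoelder_XU P ba; rewrite Xe subrr mulr0 => h.
  have -> : lU E s e b - lU E s e a = 0.
    by apply/eqP; rewrite -sqrf_eq0 -sqrrN opprB eq_le h sqr_ge0.
  by rewrite normr0 mulr_ge0// addr_ge0// mulr_ge0// ?mulr_ge0 ?exprn_ge0//; lra.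
pose m := Num.max a (Num.min b 2).
have am : a <= m by rewrite /m le_max lexx.
have mb : m <= b by rewrite /m ge_max (ltW ab) ge_min lexx.
have I1 : `|lU E s e m - lU E s e a| <= 10 / 7 * (lX E s e m - lX E s e a).
  apply: (lipschitz_XU P _ am) => z /andP[az zm] zB.
  apply: (slope_piece12 hr) => //; first exact: ltW.
  by move: zm; rewrite /m lt_max lt_min ltNge (ltW az)/= => /andP[].
have I2 : `|lU E s e b - lU E s e m| <= K * `|s' - s|.
  have [->|mb'] := eqVneq m b; first by rewrite subrr normr0 mulr_ge0.
  have {}mb' : m < b by rewrite lt_neqAle mb'.
  have b2 : 2 < b.
    rewrite ltNge; apply/negP => b2; move: mb'; rewrite /m (min_l b2) ltNge le_max lexx orbT//.
  have m2 : 2 <= m by rewrite /m (min_r (ltW b2)) le_max lexx orbT.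
  case: nd => [EE|[EE kk]].
    by rewrite EE in P *; rewrite (U_cst P (ltW b2)) (U_cst P m2) subrr normr0 mulr_ge0.
  have [kse hK] := hk EE.
  have h1 : `|lU E s e b - lU E s e m| <= k^-1 * (lX E s e b - lX E s e m).
    apply: (lipschitz_XU P _ mb) => z /andP[mz zb] zB; rewrite EE in zB *.
    apply: (slope_piece3 hr) => //; first exact: ltW.
    by rewrite (le_lt_trans m2).
  rewrite (le_trans h1)// ler_pdivrMl//.
  (* X s b = X s' a <= X s' m, so this length is at most the distance travelled by m, at speed at
     most K k; the factor k cancels the slope bound 1 / k. *)
  have h2 : lX E s e b - lX E s e m <= lX E s' e m - lX E s e m.
    by rewrite lerD2r xba; exact: (X_ndecr P').
  rewrite (le_trans h2)// mulrA [k * K]mulrC; apply: XE => t ht; exact: hK.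
have Xm : lX E s e m <= lX E s e b by exact: (X_ndecr P).
have := ler_normD (lU E s e b - lU E s e m) (lU E s e m - lU E s e a).
rewrite addrA subrK mulrDl -mulrA => h.
have h3 : 10 / 7 * (lX E s e m - lX E s e a) <= 10 / 7 * (3 * 100 ^+ 2 * `|s' - s|).
  by apply: ler_wpM2l; [lra|lra].
by rewrite (le_trans h)// addrC lerD// (le_trans I1).
Qed.

(** A second difference annihilates constants and linear functions. For m = 0 the endpoint 2 is
    excluded, since [ker 0] jumps at 0. *)
Lemma W_concentrated m z : 2 <= z <= 3 -> (m <= 1)%N -> 2 < z \/ m = 1%N -> W m 0 0 z = 0 :> R.
Proof.
move=> /andP[z2 z3] m1 hz; rewrite /W /ker !(mulr0, mul0r) !bes0.
rewrite (_ : 0 < z); last lra.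
rewrite (_ : 0 < z - 1); last lra.
case: m m1 hz => [|[|//]] _ hz.
  case: hz => // z2'; rewrite (_ : 0 < z - 2); last lra.
  by rewrite !expr0 fact0 invr1; ring.
rewrite !expr1 factS fact0 muln1 invr1.
case: ifPn => h; first by ring.
have -> : z = 2 by apply/eqP; rewrite eq_le z2 andbT leNgt; apply: contra h => ?; lra.
by ring.
Qed.

(* At the concentration time the piece [2, 3] sits at one point, where u = 0. *)
Lemma state_concentrated x : 0 < r -> state 3 0 0 x = state 2 0 0 x.
Proof.
move=> r0; have hs : `|0 : R| <= r / 12 by rewrite normr0 divr_ge0// ltW.
have he : 0 <= (0 : R) <= 1 by rewrite lexx/=.
have P2 : profile (2 : R) (brk 2) (lX 2 0 0) (lU 2 0 0) (lV 2 0 0) (lq 2 0 0).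
  by apply: (state_profile hr) => //; apply/andP; split; lra.
have P3 : profile (3 : R) (brk 3) (lX 3 0 0) (lU 3 0 0) (lV 3 0 0) (lq 3 0 0).
  by apply: (state_profile hr) => //; apply/andP; split; lra.
set z := inv (lX 2 0 0) x.
have xz : lX 2 0 0 z = x by exact: (invK P2).
have s2 : state 2 0 0 x = lU 2 0 0 z by [].
rewrite s2; have [z2|z2] := leP z 2.
  have z3 : z <= 3 by lra.
  have -> : lU 2 0 0 z = lU 3 0 0 z by rewrite /lU !min_l.
  have m3 : Num.max (z - 3) 0 = 0 by rewrite max_r//; lra.
  have m2 : Num.max (z - 2) 0 = 0 by rewrite max_r//; lra.
  by apply: (eul_at P3); rewrite -xz /lX m2 m3 (min_l z2) (min_l z3).
(* For E = 3 the outer part of slope 1 starts at the same position, but one unit of z later. *)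
have -> : lU 2 0 0 z = lU 3 0 0 (z + 1).
  rewrite /lU !min_r; [|lra|lra].
  by rewrite !W_concentrated//; try (by right); apply/andP; split; lra.
have X23 : Xint 0 0 2 = Xint 0 0 3 :> R.
  apply: (cst_off_finite (B := [::])); first lra.
    apply: continuous_in_subspaceT => y; rewrite inE/= in_itv/= => /andP[_ y3].
    apply: (continuous_Xint hr hs he); lra.
  move=> y /andP[y2 y3] _; have : y \notin [:: 0; 1; 2].
    by rewrite !inE !negb_or; apply/and3P; split; rewrite gt_eqF//; lra.
  move=> yB; have := @is_derive_Xint R r hr 0 0 hs he y ltac:(lra) ltac:(lra) yB.
  by rewrite W_concentrated ?expr0n//; [apply/andP; split; lra|left].
apply: (eul_at P3); rewrite -xz !lX_right -?X23 ?(ltW z2)//; lra.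
Qed.

Lemma derive1_lipschitz (w : R -> R) C : 0 <= C -> (forall x y, `|w x - w y| <= C * `|x - y|) ->
  forall x, `|derive1 w x| <= C.
Proof.
move=> C0 hw x; rewrite /derive1.
(* Where w is not derivable, [derive1] takes the default value 0. *)
have [c|/dvgP ->] := pselect (cvg (h^-1 *: (w (h + x) - w x) @[h --> 0^'])); last first.
  by rewrite /point/= normr0.
have c' : `|h^-1 *: (w (h + x) - w x)| @[h --> 0^'] --> `|lim (h^-1 *: (w (h + x) - w x) @[h --> 0^'])|.
  exact: (cvg_norm c).
rewrite -(cvg_lim (@Rhausdorff R) c'); apply: limr_le; first by apply/cvg_ex; eexists; exact: c'.
near=> h; have h0 : h != 0 by near: h; exact: nbhs_dnbhs_neq.
rewrite /GRing.scale/= normrM normfV ler_pdivrMl ?normr_gt0//.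
by rewrite (le_trans (hw _ _))// addrK mulrC.
Unshelve. all: by end_near. Qed.

Lemma state_lip_x E s e : `|s| <= r / 12 -> 0 <= e <= 1 -> nondegenerate E s e ->
  exists2 C, 0 <= C & forall x y, `|state E s e x - state E s e y| <= C * `|x - y|.
Proof.
move=> hs he nd; have e0 : 0 <= e by case/andP: he.
have [C C0 hC] := nondegenerate_slope hr hs e0 nd; exists C => //.
exact: (lipschitz_eul (state_profile hr hs he (nondegenerate_E nd)) hC).
Qed.

End state_estimates.

(** * The families of solutions *)

Section families.
Variable R : realType.
Notation mu := (@lebesgue_measure R).
Variable r : R.
Hypothesis r0 : 0 < r.
Hypothesis hr : forall z, `|z| <= r ->
  [/\ `|bes 0 z - 1| <= 10^-1, `|bes 1 z - 1| <= 10^-1 & `|bes 2 z - 2^-1| <= 10^-1].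
Implicit Types (E s e x z t : R).

(* The clamp makes the estimates hold for all t; the concentration time t = r / 24 is s = 0. *)
Definition shifted t := Num.max 0 (Num.min t (r / 12)) - r / 24.

Lemma shifted_small t : `|shifted t| <= r / 24.
Proof.
rewrite /shifted ler_norml; apply/andP; split.
  by rewrite lerBrDr addNr le_max lexx.
rewrite lerBlDr ge_max; apply/andP; split; first by move: r0; lra.
by rewrite ge_min; apply/orP; right; move: r0; lra.
Qed.

Lemma shifted_lt t : `|shifted t| < r / 12.
Proof. by rewrite (le_lt_trans (shifted_small t))//; move: r0; lra. Qed.

Lemma shifted_le t : `|shifted t| <= r / 12.
Proof. exact: ltW (shifted_lt t). Qed.

Lemma shifted_id t : 0 <= t <= r / 12 -> shifted t = t - r / 24.
Proof. by move=> /andP[t0 t1]; rewrite /shifted (min_l t1) (max_r t0). Qed.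

Lemma shifted_ndecr t t' : t <= t' -> shifted t <= shifted t'.
Proof.
move=> tt; rewrite /shifted lerD2r.
have h : Num.min t (r / 12) <= Num.min t' (r / 12) by rewrite le_min !ge_min tt lexx orbT.
by rewrite ge_max !le_max lexx/= h orbT.
Qed.

Lemma shifted_lip t t' : t <= t' -> shifted t' - shifted t <= t' - t.
Proof.
move=> tt; rewrite /shifted.
have h1 : Num.min t' (r / 12) <= Num.min t (r / 12) + (t' - t).
  by case: (leP t (r / 12)) => h; case: (leP t' (r / 12)) => h'; lra.
set m' := Num.min t' _ in h1 *; set m := Num.min t _ in h1 *.
have : Num.max 0 m' <= Num.max 0 m + (t' - t).
  by case: (leP 0 m) => h; case: (leP 0 m') => h'; lra.
by lra.
Qed.

Variables (Ef : R -> R) (e C : R).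
Hypothesis he : 0 <= e <= 1.
Hypothesis C0 : 0 <= C.
Hypothesis nd : forall s, `|s| <= r / 24 -> nondegenerate (Ef s) s e.
Hypothesis lip : forall s s' x, `|s| <= r / 24 -> `|s'| <= r / 24 -> s <= s' ->
  `|state (Ef s') s' e x - state (Ef s) s e x| <= C * (s' - s).
Hypothesis locconst : forall s, s != 0 -> \forall s' \near s, Ef s' = Ef s.

(** [Ef] is the energy retained at each time: the constant 3 for the conservative solutions, [lossy]
    for v. *)
Definition family t := state (Ef (shifted t)) (shifted t) e.

Let e0 : 0 <= e. Proof. by case/andP: he. Qed.
Let P t := state_profile hr (shifted_le t) he (nondegenerate_E (nd (shifted_small t))).
Let qn0 t := fun z => nondegenerate_lq hr (shifted_le t) e0 (nd (shifted_small t)) (z := z).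

Lemma family_lip t t' x : `|family t x - family t' x| <= C * `|t - t'|.
Proof.
wlog tt : t t' / t <= t' => [h|].
  case/orP: (le_total t t') => tt; first exact: h.
  by rewrite distrC (distrC t); exact: h.
rewrite distrC (distrC t) (ger0_norm (_ : 0 <= t' - t)) ?subr_ge0//.
have := lip x (shifted_small t) (shifted_small t') (shifted_ndecr tt).
by move/le_trans; apply; apply: ler_wpM2l => //; exact: shifted_lip.
Qed.

Lemma family_solution : is_solution (@cube R) (r / 12) (family 0) family.
Proof.
have T0 : 0 < r / 12 by rewrite divr_gt0 ?ltr0n.
have r24 : r / 12 = r / 24 + r / 24 by lra.
(* The only exceptional time is that of the concentration, where [Ef] may jump. *)
apply: (@solution_criterion R (@cube R) (r / 12) 3 C (family 0) family [:: r / 24]).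
- by rewrite ltr0n.
- exact: C0.
- exact: T0.
- exact: family_lip.
- move=> t x y; rewrite (le_trans (hoelder_eul (P t) x y))//.
  by apply: ler_wpM2r => //; case/andP: (nondegenerate_E (nd (shifted_small t))).
- by [].
- by move=> t; exact: (eul_left (P t) (lexx 0)).
- by move=> t; exact: (state_lip_x hr (shifted_le t) he (nd (shifted_small t))).
- by move=> t; exact: (measurable_derive1_eul (P t) (@qn0 t)).
- move=> t; have [Ct Ct0 hCt] := state_lip_x hr (shifted_le t) he (nd (shifted_small t)).
  by exists Ct, [::] => x _; exact: derive1_lipschitz hCt x.
- by move=> t; exact: (measurable_rhs_state hr (shifted_le t) he (nd (shifted_small t))).
- move=> t /andP[t0 t1]; rewrite inE => tn.
  have tin : 0 <= t <= r / 12 by rewrite !ltW.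
  have st := shifted_id tin.
  exists (map (lX (Ef (shifted t)) (shifted t) e) (brk (Ef (shifted t)))) => x x0.
  rewrite (notin_map (P t) (@qn0 t)) => xB.
  have sn0 : shifted t != 0 by rewrite st subr_eq0.
  have nE := locconst sn0.
  have near_small : \forall s' \near shifted t, `|s'| <= r / 24.
    have : - (r / 24) < shifted t < r / 24 by rewrite st; apply/andP; split; lra.
    move=> /near_itvoo; apply: filterS => s' /andP[h1 h2].
    by rewrite ler_norml !ltW.
  have ndn : \forall s' \near shifted t, nondegenerate (Ef (shifted t)) s' e.
    by apply: filterS2 nE near_small => s' Es /nd; rewrite Es.
  have D := is_derive_state hr (shifted_lt t) he (nd (shifted_small t)) ndn (ltW x0) xB.
  have D' : is_derive t 1 (fun t' => state (Ef (shifted t)) (t' - r / 24) e x)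
      (evolution_rhs (@cube R) (state (Ef (shifted t)) (shifted t) e) x).
    apply: (is_derive_shift (f := fun s => state (Ef (shifted t)) s e x)).
    by rewrite -st.
  apply: is_derive_near_eq D'.
  have nt : \forall t' \near t, 0 < t' < r / 12 by apply: near_itvoo; rewrite t0.
  have nEt : \forall t' \near t, Ef (t' - r / 24) = Ef (shifted t).
    have ct : t' - r / 24 @[t' --> t] --> shifted t.
      by rewrite st; apply: cvgB; [exact: cvg_id|exact: cvg_cst].
    exact: (ct _ nE).
  apply: filterS2 nt nEt => t' /andP[h1 h2] Et.
  by rewrite /family shifted_id ?(ltW h1) ?(ltW h2)// Et.
Qed.

Lemma family_energy t (g : R -> R) : continuous g ->
  energy_int (family t) g = \int[mu]_(z in `[0, Ef (shifted t)]) g (lX (Ef (shifted t)) (shifted t) e z).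
Proof. exact: (energy_state hr (shifted_le t) he (nd (shifted_small t))). Qed.

Lemma family_continuous t : continuous (family t).
Proof. exact: (state_continuous hr (shifted_le t) he (nd (shifted_small t))). Qed.

Lemma family_at t z : family t (lX (Ef (shifted t)) (shifted t) e z) = lU (Ef (shifted t)) (shifted t) e z.
Proof. exact: (eul_at (P t) (erefl _)). Qed.

End families.

(** * Energy balance of the families *)

Section family_dissipation.
Variable R : realType.
Notation mu := (@lebesgue_measure R).
Variable r : R.
Hypothesis r0 : 0 < r.
Hypothesis hr : forall z, `|z| <= r ->
  [/\ `|bes 0 z - 1| <= 10^-1, `|bes 1 z - 1| <= 10^-1 & `|bes 2 z - 2^-1| <= 10^-1].
Implicit Types (E s e x z t : R).
Variables (phi : R -> R -> R) (e : R).
Hypothesis T : test_function phi.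
Hypothesis he : 0 <= e <= 1.

Definition mX E t z := lX E (t - r / 24) e z.
Definition mU E t z := lU E (t - r / 24) e z.
Definition rate E t := energy_rate phi (mX E) (mU E) E t.
Definition mass E t := energy phi (mX E) E t.

(** This open interval contains [0, r / 12], so the balance can be integrated up to both end
    times. *)
Let small t : r / 24 - r / 12 < t < r / 24 + r / 12 -> `|t - r / 24| < r / 12.
Proof. by move=> /andP[h1 h2]; rewrite ltr_norml; apply/andP; split; lra. Qed.

Section fixed_E.
Variable E : R.
Hypothesis E23 : 2 <= E <= 3.
Let E3 : E <= 3. Proof. by case/andP: E23. Qed.

Lemma mX_continuous t : r / 24 - r / 12 < t < r / 24 + r / 12 -> continuous (mX E t).
Proof. by move=> ht; exact: (prX (state_profile hr (ltW (small ht)) he E23)). Qed.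

Lemma mU_continuous t : r / 24 - r / 12 < t < r / 24 + r / 12 -> continuous (mU E t).
Proof. by move=> ht; exact: (prU (state_profile hr (ltW (small ht)) he E23)). Qed.

Lemma is_derive_mX t z : r / 24 - r / 12 < t < r / 24 + r / 12 ->
  is_derive t 1 (mX E ^~ z) (3 * mU E t z ^+ 2).
Proof.
move=> ht; apply: (is_derive_shift (f := fun s => lX E s e z)).
exact: (is_derive_lX_s hr z (small ht) he E3).
Qed.

Lemma mU_continuous_t t z : r / 24 - r / 12 < t < r / 24 + r / 12 -> {for t, continuous (mU E ^~ z)}.
Proof.
move=> ht; apply/differentiable_continuous/derivable1_diffP.
have D : is_derive t 1 (mU E ^~ z) (3 * lV E (t - r / 24) e z).
  by apply: (is_derive_shift (f := fun s => lU E s e z)); exact: is_derive_lU_s.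
by have [] := D.
Qed.

Lemma mU_bounded t z : r / 24 - r / 12 < t < r / 24 + r / 12 -> `|mU E t z| <= 100.
Proof. by move=> ht; exact: (lU_bound hr z (ltW (small ht)) he E3). Qed.

Lemma integrable_rate c d : 0 <= c -> d <= r / 12 -> mu.-integrable `[c, d] (EFin \o rate E).
Proof.
move=> c0 d1; apply: (integrable_energy_rate E T mX_continuous mU_continuous is_derive_mX
  mU_continuous_t mU_bounded); move: r0; lra.
Qed.

Lemma integral_rate c d : 0 <= c -> c <= d -> d <= r / 12 ->
  \int[mu]_(t in `[c, d]) rate E t = mass E d - mass E c.
Proof.
move=> c0 cd d1; apply: (integral_energy_rate E T mX_continuous mU_continuous is_derive_mX
  mU_continuous_t mU_bounded) => //; move: r0; lra.
Qed.

End fixed_E.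

Variable (Ef : R -> R).
Hypothesis nd : forall s, `|s| <= r / 24 -> nondegenerate (Ef s) s e.

Lemma family_mass t : 0 <= t <= r / 12 ->
  energy_int (family r Ef e t) (phi t) = mass (Ef (t - r / 24)) t.
Proof.
move=> ht; rewrite (family_energy r0 hr he nd); last exact: (continuous_phi_x T).
by rewrite (shifted_id ht).
Qed.

Lemma family_rate t : 0 <= t <= r / 12 ->
  energy_int (family r Ef e t) (fun x => d_t phi t x + d_x phi t x * derive1 (@cube R) (family r Ef e t x))
  = rate (Ef (t - r / 24)) t.
Proof.
move=> ht.
have gc : continuous (fun x => d_t phi t x + d_x phi t x * derive1 (@cube R) (family r Ef e t x)).
  rewrite (_ : (fun x => _) = fun x => d_t phi t x + d_x phi t x * (3 * family r Ef e t x ^+ 2)).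
    move=> x; apply: (transport_cvg T (cvg_cst t) cvg_id).
    exact: (family_continuous r0 hr he nd).
  by apply/funext => x; rewrite derive1_cube.
rewrite (family_energy r0 hr he nd)// /rate /energy_rate (shifted_id ht).
apply: eq_Rintegral => z _; rewrite derive1_cube /transport /mX /mU.
have := family_at r0 hr he nd t z; rewrite (shifted_id ht) => ->.
by [].
Qed.

End family_dissipation.

Section glue.
Variable R : realType.
Notation mu := (@lebesgue_measure R).

Lemma integrable_glue (f g h : R -> R) a c b : a < c -> c <= b ->
  mu.-integrable `[a, c] (EFin \o f) -> mu.-integrable `[c, b] (EFin \o g) ->
  (forall x, a <= x < c -> h x = f x) -> (forall x, c <= x <= b -> h x = g x) ->
  mu.-integrable `[a, b] (EFin \o h) /\
  \int[mu]_(x in `[a, b]) h x = \int[mu]_(x in `[a, c]) f x + \int[mu]_(x in `[c, b]) g x.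
Proof.
move=> ac cb fi gi hf hg.
have fi' : mu.-integrable `[a, c[ (EFin \o f).
  by apply: integrableS fi => //; apply: subset_itvl; rewrite bnd_simp.
have abE : `[a, b]%classic = `[a, c[%classic `|` `[c, b]%classic.
  by apply: itv_bndbnd_setU; rewrite bnd_simp// ltW.
have Fi : mu.-integrable setT ((EFin \o f) \_ `[a, c[) by rewrite -integrable_mkcond.
have Gi : mu.-integrable setT ((EFin \o g) \_ `[c, b]) by rewrite -integrable_mkcond.
have hi : mu.-integrable `[a, b] (EFin \o h).
  have mI : measurable (`[a, b] : set (measurableTypeR R)) by exact: measurable_itv.
  have := integrableS measurableT mI (@subsetT _ _) (integrableD measurableT Fi Gi).
  apply: eq_integrable => // x; rewrite inE abE /= => -[]; rewrite in_itv/= => hx.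
    rewrite /patch mem_set/= ?in_itv/= ?hx// memNset/= ?in_itv/=; last first.
      by case/andP: hx => _ xc; rewrite leNgt xc.
    by rewrite adde0 hf.
  rewrite /patch [X in if X then _ else _]memNset/= ?in_itv/=; last first.
    by case/andP: hx => cx _; rewrite ltNge cx andbF.
  by rewrite mem_set/= ?in_itv/= ?hx// add0e hg.
split => //; rewrite abE in hi *; rewrite Rintegral_setU//; last first.
  apply/disj_setPS => x [/=]; rewrite !in_itv/= => /andP[_ xc] /andP[cx _].
  by move: xc; rewrite ltNge cx.
congr (_ + _); last by apply: eq_Rintegral => x; rewrite inE => xcb; apply: hg; move: xcb; rewrite /= in_itv.
rewrite -[RHS]Rintegral_itv_bndo_bndc//.
by apply: eq_Rintegral => x; rewrite inE => xcb; apply: hf; move: xcb; rewrite /= in_itv.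
Qed.

Lemma ler_eqB (x y x' y' z : R) : x = x' -> y = y' -> x' - y' <= z -> x - y <= z.
Proof. by move=> -> ->. Qed.

Lemma ler_concat (a b c d : R) : c <= d -> a - b <= (d - b) + (a - c).
Proof. by lra. Qed.

End glue.

(** * The conservative and the lossy solutions are dissipative *)

Section dissipation.
Variable R : realType.
Notation mu := (@lebesgue_measure R).
Variable r : R.
Hypothesis r0 : 0 < r.
Hypothesis hr : forall z, `|z| <= r ->
  [/\ `|bes 0 z - 1| <= 10^-1, `|bes 1 z - 1| <= 10^-1 & `|bes 2 z - 2^-1| <= 10^-1].
Implicit Types (E s e x z t : R).

Lemma nondegenerate3 e s : 0 < e -> nondegenerate 3 s e.
Proof. by move=> e0; right; split => //; have := sqr_ge0 s; lra. Qed.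

Lemma abs_small s : `|s| <= r / 24 -> `|s| < r / 12.
Proof. by move=> hs; rewrite (le_lt_trans hs)//; move: r0; lra. Qed.

Lemma lip_bound_ge0 (K : R) : 0 <= K -> 0 <= 300 + 10 / 7 * (3 * 100 ^+ 2) + K.
Proof. by move=> K0; lra. Qed.

Lemma conservative_dissipative e : 0 < e <= 1 ->
  is_dissipative_solution (@cube R) (r / 12) (family r (fun=> 3) e 0) (family r (fun=> 3) e).
Proof.
move=> /andP[e0 e1]; have he : 0 <= e <= 1 by rewrite ltW.
have nd s : `|s| <= r / 24 -> nondegenerate 3 s e by move=> _; exact: nondegenerate3.
have k0 : 0 < e / 2 by rewrite divr_gt0.
(* With k = e / 2, the product K k is the crude bound on the speed 3 U^2. The constant blows up as e
   -> 0, which is harmless since each e is treated alone. *)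
pose K := 3 * 100 ^+ 2 / (e / 2).
have K0 : 0 <= K by rewrite /K divr_ge0 ?(ltW k0)// mulr_ge0// exprn_ge0// ler0n.
have Kk : K * (e / 2) = 3 * 100 ^+ 2 by rewrite /K divfK// gt_eqF.
split.
  apply: (family_solution r0 hr he (lip_bound_ge0 K0) nd).
  - move=> s s' x hs hs' ss; have := @state_lip_s R r hr 3 s s' e (e / 2) K x (abs_small hs) (abs_small hs')
      he ss (nd s hs) k0 K0.
    rewrite (ger0_norm (_ : 0 <= s' - s)) ?subr_ge0//; apply => _; split.
      by have := sqr_ge0 s; lra.
    move=> t z /andP[t1 t2] _; rewrite Kk; apply: ler_wpM2l; first lra.
    rewrite -real_normK ?num_real// lerXn2r ?nnegrE ?ler0n//; apply: (lU_bound hr) => //.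
    by apply: (between_small (ltW (abs_small hs)) (ltW (abs_small hs'))); rewrite min_l// max_r// t1.
  - by move=> s _; apply: filterE.
move=> phi t1 t2 T t10 t12 t2T flux.
have E23 : 2 <= (3 : R) <= 3 by apply/andP; split; lra.
have it t : t1 <= t <= t2 -> 0 <= t <= r / 12.
  by move=> /andP[h1 h2]; rewrite (le_trans t10)//= (le_trans h2).
have fluxE t : t1 <= t <= t2 -> rate r phi e 3 t = flux t.
  by move=> /it ht; rewrite /flux (family_rate r0 hr T he nd ht).
split.
  apply: eq_integrable (integrable_rate r0 hr T he E23 t10 t2T) => //.
  by move=> t; rewrite inE/= in_itv/= => ht; rewrite fluxE.
have m1 := family_mass r0 hr T he nd (it t1 ltac:(by rewrite lexx ltW)).
have m2 := family_mass r0 hr T he nd (it t2 ltac:(by rewrite lexx ltW)).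
apply: (ler_eqB m2 m1); rewrite -(integral_rate r0 hr T he E23 t10 (ltW t12) t2T).
rewrite le_eqVlt; apply/orP; left; apply/eqP; apply: eq_Rintegral => t.
by rewrite inE/= in_itv/= => ht; rewrite fluxE.
Qed.

(** The value 2 at s = 0 is forced: for e = 0 the choice 3 is degenerate at that time. *)
Definition lossy (s : R) : R := if s < 0 then 3 else 2.

Lemma lossy_nondegenerate s : nondegenerate (lossy s) s 0.
Proof.
rewrite /lossy; case: ifPn => s0; last by left.
by right; split => //; rewrite mul0r addr0 mulr_gt0// exprn_even_gt0//= lt_eqF.
Qed.

Lemma lU_piece3 t z : `|t| <= r / 12 -> 2 <= z -> `|lU 3 t 0 z| <= 300 * `|t|.
Proof.
move=> ht z2; have h0 : `|0 : R| <= r / 12 by rewrite normr0 divr_ge0 ?ler0n// ltW.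
have := @lU_lip_s R r hr 3 0 t 0 z h0 ht ltac:(by rewrite lexx ler01) ltac:(lra).
rewrite subr0 [X in `|_ - X|](_ : _ = 0) ?subr0//.
rewrite /lU; apply: W_concentrated; [|by []|by right].
by rewrite le_min z2 ge_min lexx orbT andbT/=; lra.
Qed.

(** From a start a < 0 the slope on the third piece is only bounded by 1 / (3 a^2), but until time 0
    one has 3 U^2 <= 300^2 (3 a^2) there by [lU_piece3]. So K = 300^2 is uniform up to the
    concentration. An interval across 0 is cut at 0, where [state_concentrated] identifies the two
    states. *)
Lemma lossy_lip s s' x : `|s| <= r / 24 -> `|s'| <= r / 24 -> s <= s' ->
  `|state (lossy s') s' 0 x - state (lossy s) s 0 x| <=
    (300 + 10 / 7 * (3 * 100 ^+ 2) + 300 ^+ 2) * (s' - s).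
Proof.
move=> hs hs' ss; set K := 300 ^+ 2; set C := (X in X * _).
have K0 : 0 <= K by rewrite exprn_ge0 ?ler0n.
have he : 0 <= (0 : R) <= 1 by rewrite lexx ler01.
have late a b : `|a| <= r / 24 -> `|b| <= r / 24 -> 0 <= a -> a <= b ->
    `|state (lossy b) b 0 x - state (lossy a) a 0 x| <= C * (b - a).
  move=> ha hb a0 ab; have b0 := le_trans a0 ab.
  have nd2 : nondegenerate 2 a 0 by left.
  have := @state_lip_s R r hr 2 a b 0 1 K x (abs_small ha) (abs_small hb) he ab nd2 ltr01 K0.
  rewrite (ger0_norm (_ : 0 <= b - a)) ?subr_ge0//.
  have lossy2 c : 0 <= c -> lossy c = 2 by rewrite /lossy ltNge => ->.
  rewrite (lossy2 a a0) (lossy2 b b0); apply.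
  by move=> h; exfalso; move: h; lra.
have early a b : `|a| <= r / 24 -> `|b| <= r / 24 -> a < 0 -> b <= 0 -> a <= b ->
    `|state 3 b 0 x - state 3 a 0 x| <= C * (b - a).
  move=> ha hb a0 b0 ab; have a2 : 0 < a ^+ 2 by rewrite exprn_even_gt0//= lt_eqF.
  have nd3 : nondegenerate 3 a 0 by right; split => //; rewrite mul0r addr0 mulr_gt0.
  have k0 : 0 < 3 * a ^+ 2 by rewrite mulr_gt0.
  have := @state_lip_s R r hr 3 a b 0 (3 * a ^+ 2) K x (abs_small ha) (abs_small hb) he ab nd3 k0 K0.
  rewrite (ger0_norm (_ : 0 <= b - a)) ?subr_ge0//; apply => _; split; first by rewrite mul0r addr0.
  move=> t z /andP[t1 t2] z2.
  have ht : `|t| <= r / 12.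
    by apply: (between_small (ltW (abs_small ha)) (ltW (abs_small hb))); rewrite min_l// max_r// t1.
  have hU := lU_piece3 ht z2.
  have hta : `|t| <= `|a| by rewrite !ler0_norm ?(ltW a0) ?(le_trans t2)// lerN2.
  rewrite [leRHS]mulrCA; apply: ler_wpM2l; first lra.
  rewrite -real_normK ?num_real// /K -[a ^+ 2]real_normK ?num_real// -exprMn.

  apply: lerXn2r; rewrite ?nnegrE ?mulr_ge0 ?ler0n//.
  by apply: (le_trans hU); apply: ler_wpM2l; rewrite ?ler0n.
have [s0|s0] := leP 0 s; first exact: late.
have [s'0|s'0] := ltP s' 0.
  by rewrite /lossy s0 s'0; apply: early => //; exact: ltW.
have h0 : `|0 : R| <= r / 24 by rewrite normr0 divr_ge0 ?ler0n// ltW.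
have l1 := late 0 s' h0 hs' (lexx 0) s'0.
have l2 := early s 0 hs h0 s0 (lexx 0) (ltW s0).
have l3 : state 3 0 0 x = state (lossy 0) 0 0 x by rewrite /lossy ltxx; exact: (state_concentrated hr).
rewrite l3 in l2; rewrite [lossy s]/lossy s0.
have := ler_normD (state (lossy s') s' 0 x - state (lossy 0) 0 0 x)
  (state (lossy 0) 0 0 x - state 3 s 0 x).
rewrite addrA subrK => /le_trans; apply.
rewrite (_ : C * (s' - s) = C * (s' - 0) + C * (0 - s)); last ring.
exact: lerD.
Qed.

Lemma lossy_locconst s : s != 0 -> \forall s' \near s, lossy s' = lossy s.
Proof.
rewrite neq_lt => /orP[s0|s0].
  by apply: filterS (lt_nbhsl s0) => s' s'0; rewrite /lossy s0 s'0.
by apply: filterS (lt_nbhsr s0) => s' s'0; rewrite /lossy !ltNge (ltW s0) (ltW s'0).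
Qed.

(** On [0, 2] the position X does not depend on [E], and phi is nonnegative where the energy of
    [2, 3] sits. *)
Lemma mass_loss phi : test_function phi -> mass r phi 0 2 (r / 24) <= mass r phi 0 3 (r / 24).
Proof.
move=> T; rewrite /mass /energy /mX subrr.
have hs : `|0 : R| <= r / 12 by rewrite normr0 divr_ge0 ?ler0n// ltW.
have he : 0 <= (0 : R) <= 1 by rewrite lexx ler01.
have E23 : 2 <= (3 : R) <= 3 by apply/andP; split; lra.
have P3 := state_profile hr hs he E23.
have X0 z : 0 <= z -> 0 <= lX 3 0 0 z by move=> z0; rewrite -[leLHS](prXl P3 (lexx 0)); exact: (X_ndecr P3).
have hi : mu.-integrable `[0, 3] (EFin \o (fun z => phi (r / 24) (lX 3 0 0 z))).
  apply: integrable_itv => z.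
  exact: (continuous_comp (@prX _ _ _ _ _ _ _ P3 z) (@continuous_phi_x _ _ T (r / 24) _)).
have -> : \int[mu]_(z in `[0, 2]) phi (r / 24) (lX 2 0 0 z) = \int[mu]_(z in `[0, 2]) phi (r / 24) (lX 3 0 0 z).
  apply: eq_Rintegral => z; rewrite inE/= in_itv/= => /andP[z0 z2]; congr (phi _ _).
  rewrite !lX_mid ?z0//; lra.
rewrite -subr_ge0 (Rintegral_itvB (x := 2) hi); [|by rewrite bnd_simp ler0n|by rewrite bnd_simp; lra].
apply: Rintegral_ge0 => z; rewrite /= in_itv/= => /andP[z2 _].
have [_ _ _ _ phi0] := T; apply: phi0; first by rewrite divr_ge0 ?ler0n// ltW.
by apply: X0; lra.
Qed.

Lemma lossy_dissipative :
  is_dissipative_solution (@cube R) (r / 12) (family r lossy 0 0) (family r lossy 0).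
Proof.
have r24T : r / 24 <= r / 12 by move: r0; lra.
have r240 : 0 <= r / 24 by move: r0; lra.
have he : 0 <= (0 : R) <= 1 by rewrite lexx ler01.
have nd s : `|s| <= r / 24 -> nondegenerate (lossy s) s 0 by move=> _; exact: lossy_nondegenerate.
split.
  have K0 : 0 <= 300 ^+ 2 :> R by rewrite exprn_ge0 ?ler0n.
  apply: (family_solution r0 hr he (lip_bound_ge0 K0) nd).
  - exact: lossy_lip.
  - exact: lossy_locconst.
move=> phi t1 t2 T t10 t12 t2T flux.
have E3 : 2 <= (3 : R) <= 3 by apply/andP; split; lra.
have E2 : 2 <= (2 : R) <= 3 by apply/andP; split; lra.
have it t : t1 <= t <= t2 -> 0 <= t <= r / 12.
  by move=> /andP[h1 h2]; rewrite (le_trans t10)//= (le_trans h2).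
have flux3 t : t1 <= t <= t2 -> t < r / 24 -> flux t = rate r phi 0 3 t.
  move=> /it ht tl; rewrite /flux (family_rate r0 hr T he nd ht) /lossy.
  by rewrite subr_lt0 tl.
have flux2 t : t1 <= t <= t2 -> r / 24 <= t -> flux t = rate r phi 0 2 t.
  move=> /it ht tl; rewrite /flux (family_rate r0 hr T he nd ht) /lossy.
  by rewrite subr_lt0 ltNge tl.
have i1 : 0 <= t1 <= r / 12 by apply: it; rewrite lexx ltW.
have i2 : 0 <= t2 <= r / 12 by apply: it; rewrite lexx ltW.
have m1 := family_mass r0 hr T he nd i1; have m2 := family_mass r0 hr T he nd i2.
suff [fi fl] : mu.-integrable `[t1, t2] (EFin \o flux) /\
    mass r phi 0 (lossy (t2 - r / 24)) t2 - mass r phi 0 (lossy (t1 - r / 24)) t1 <=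
    \int[mu]_(t in `[t1, t2]) flux t.
  by split => //; exact: (ler_eqB m2 m1).
have [t1l|t1l] := leP (r / 24) t1.
  rewrite /lossy !subr_lt0 !ltNge t1l (le_trans t1l (ltW t12))/=.
  split.
    apply: eq_integrable (integrable_rate r0 hr T he E2 t10 t2T) => // t.
    by rewrite inE/= in_itv/= => ht; rewrite /= flux2//; case/andP: ht => h _; rewrite (le_trans t1l).
  rewrite -(integral_rate r0 hr T he E2 t10 (ltW t12) t2T).
  rewrite le_eqVlt; apply/orP; left; apply/eqP; apply: eq_Rintegral => t.
  by rewrite inE/= in_itv/= => ht; rewrite flux2//; case/andP: ht => h _; rewrite (le_trans t1l).
have [t2l|t2l] := ltP t2 (r / 24).
  rewrite /lossy !subr_lt0 t1l t2l.
  split.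
    apply: eq_integrable (integrable_rate r0 hr T he E3 t10 t2T) => // t.
    by rewrite inE/= in_itv/= => ht; rewrite /= flux3//; case/andP: ht => _ h; rewrite (le_lt_trans h).
  rewrite -(integral_rate r0 hr T he E3 t10 (ltW t12) t2T).
  rewrite le_eqVlt; apply/orP; left; apply/eqP; apply: eq_Rintegral => t.
  by rewrite inE/= in_itv/= => ht; rewrite flux3//; case/andP: ht => _ h; rewrite (le_lt_trans h).
(* On either side of r / 24 the balance is an equality; the loss of mass at r / 24 is the sole
   source of the inequality. *)
have [||fi fe] := integrable_glue (h := flux) t1l t2l (integrable_rate r0 hr T he E3 t10 r24T)
  (integrable_rate r0 hr T he E2 r240 t2T).
- by move=> t /andP[h1 h2]; apply: flux3 => //; rewrite h1 (le_trans (ltW h2)).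
- by move=> t /andP[h1 h2]; apply: flux2 => //; rewrite h2 (le_trans (ltW t1l)).
split=> //; rewrite fe (integral_rate r0 hr T he E3 t10 (ltW t1l) r24T).
rewrite (integral_rate r0 hr T he E2 r240 t2l t2T).
rewrite /lossy !subr_lt0 t1l [t2 < _]ltNge t2l/=.
exact: ler_concat (mass_loss T).
Qed.

End dissipation.

(** * The limit of the perturbed solutions *)

Section limits.
Variable R : realType.
Notation mu := (@lebesgue_measure R).
Variable r : R.
Hypothesis r0 : 0 < r.
Hypothesis hr : forall z, `|z| <= r ->
  [/\ `|bes 0 z - 1| <= 10^-1, `|bes 1 z - 1| <= 10^-1 & `|bes 2 z - 2^-1| <= 10^-1].
Implicit Types (E s e x z t : R).

(** Independent of s and e, this bound is used as x* for all times and all perturbations. *)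
Lemma Xint_bound s e z : `|s| <= r / 12 -> 0 <= e <= 1 -> 0 <= z <= 3 -> Xint s e z <= 100 ^+ 2 * 3.
Proof.
move=> hs he /andP[z0 z3].
have z4 : z < 4 by lra.
have := @lipschitz_off_finite R [:: 0; 1; 2] (Xint s e) (fun x => W 0 s e x ^+ 2) (100 ^+ 2) 0 z z0
  (within_Xint hr hs he z4).
rewrite (Xint_neg _ _ (lexx 0)) !subr0 => h.
have {}h : `|Xint s e z| <= 100 ^+ 2 * z.
  apply: h => [x /andP[x0 xz] xB|x /andP[x0 xz] xB].
    by apply: (is_derive_Xint hr) => //; exact: lt_trans xz z4.
  have x4 : x <= 4 by lra.
  rewrite normrX; apply: lerXn2r; rewrite ?nnegrE ?ler0n//.
  exact: (W_bound hr (m := 0) isT hs he x4).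
rewrite (le_trans (ler_norm _))// (le_trans h)//; exact: ler_wpM2l.
Qed.

Lemma state_tail E s e x : `|s| <= r / 12 -> 0 <= e <= 1 -> 2 <= E <= 3 -> 100 ^+ 2 * 3 < x ->
  lX E s e E < x.
Proof.
move=> hs he /andP[E2 E3]; have E03 : 0 <= E <= 3 by apply/andP; split; lra.
by apply: le_lt_trans; rewrite lX_mid ?Xint_bound//; case/andP: E03 => ->; rewrite lexx.
Qed.

Lemma derive1_state_boxed s e C : `|s| <= r / 12 -> 0 <= e <= 1 -> 0 <= C ->
  nondegenerate 3 s e ->
  (forall x y, `|state 3 s e x - state 3 s e y| <= C * `|x - y|) ->
  boxed (`[0, +oo[ : set R) C (100 ^+ 2 * 3) (derive1 (state 3 s e)).
Proof.
move=> hs he C0 nd hC x /=; rewrite in_itv/= andbT => x0.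
have P := state_profile hr hs he (nondegenerate_E nd).
have [xM|xM] := leP x (100 ^+ 2 * 3).
  by rewrite indicE mem_set/= ?in_itv/= ?x0// mulr1; exact: (derive1_lipschitz C0 hC).
have -> : derive1 (state 3 s e) x = 0.
  by apply: (derive1_eul_right P); exact: (state_tail hs he (nondegenerate_E nd)).
by rewrite normr0; exact: box_ge0.
Qed.

Lemma measurable_derive1_state s e : `|s| <= r / 12 -> 0 <= e <= 1 -> nondegenerate 3 s e ->
  measurable_fun (`[0, +oo[ : set (measurableTypeR R)) (derive1 (state 3 s e)).
Proof.
move=> hs he nd; have e0 : 0 <= e by case/andP: he.
exact: (measurable_derive1_eul (state_profile hr hs he (nondegenerate_E nd))
  (fun z => nondegenerate_lq hr hs e0 nd (z := z))).
Qed.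

Lemma state_admissible s e : `|s| <= r / 12 -> 0 <= e <= 1 -> nondegenerate 3 s e ->
  admissible_datum (state 3 s e).
Proof.
move=> hs he nd; have [C C0 hC] := state_lip_x hr hs he nd; split.
- move=> M M0; apply: (lipschitz_abs_continuous C0) => a b _ ab _.
  by rewrite /dist_R lee_fin (le_trans (hC _ _))// distrC ger0_norm ?subr_ge0.
- exact: (eul_left (state_profile hr hs he (nondegenerate_E nd)) (lexx 0)).
- apply: (in_L2_boxed (C := C) (M := 100 ^+ 2 * 3)) => //.
    exact: measurable_derive1_state.
  exact: derive1_state_boxed.
Qed.

Section fixed_time.
Variable s : R.
Hypotheses (hs : `|s| <= r / 12) (sn0 : s != 0).

Let k0 : 0 < 3 * s ^+ 2. Proof. by rewrite mulr_gt0// exprn_even_gt0//=. Qed.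

(** Uniform in e because s <> 0. It is applied at the initial time s = - r / 24, where even the
    unperturbed state is nondegenerate. *)
Definition slope_bound : R := 10 / 7 + (3 * s ^+ 2)^-1.

Lemma slope_bound_ge0 : 0 <= slope_bound.
Proof. by rewrite /slope_bound addr_ge0 ?invr_ge0 ?(ltW k0)//; lra. Qed.

Lemma nondegenerate_neq0 e : 0 <= e -> nondegenerate 3 s e.
Proof. by move=> e0; right; split => //; move: k0; lra. Qed.

Lemma state_lip_uniform e : 0 <= e <= 1 ->
  forall x y, `|state 3 s e x - state 3 s e y| <= slope_bound * `|x - y|.
Proof.
move=> he; have e0 : 0 <= e by case/andP: he.
have nd := nondegenerate_neq0 e0.
apply: (lipschitz_eul (state_profile hr hs he (nondegenerate_E nd))).
by apply: (nondegenerate_slope_le hr hs e0 nd k0) => _; lra.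
Qed.

Lemma lX_lip_e e z : 0 <= e <= 1 -> `|lX 3 s e z - lX 3 s 0 z| <= 20 * 200 * 3 * e.
Proof.
move=> he; have h0 : 0 <= (0 : R) <= 1 by rewrite lexx ler01.
have m3 : Num.min z 3 <= 3 by rewrite ge_min lexx orbT.
have := Xint_lip_e hr hs h0 he m3; rewrite subr0 (ger0_norm (_ : 0 <= e)); last by case/andP: he.
by rewrite /lX (_ : _ - _ = Xint s e (Num.min z 3) - Xint s 0 (Num.min z 3)); last ring.
Qed.

(** At the energy coordinate of x, U changes by at most 20 e and the position by at most 20 * 200 *
    3 e; the latter costs the slope of the unperturbed state. *)
Lemma state_lip_e e x : 0 <= e <= 1 ->
  `|state 3 s e x - state 3 s 0 x| <= (20 + slope_bound * (20 * 200 * 3)) * e.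
Proof.
move=> he; have e0 : 0 <= e by case/andP: he.
have h0 : 0 <= (0 : R) <= 1 by rewrite lexx ler01.
have P := state_profile hr hs he (nondegenerate_E (nondegenerate_neq0 e0)).
have P0 := state_profile hr hs h0 (nondegenerate_E (nondegenerate_neq0 (lexx 0))).
have [z xz] := X_surj P x.
have -> : state 3 s e x = lU 3 s e z by exact: (eul_at P xz).
have h1 : `|lU 3 s e z - lU 3 s 0 z| <= 20 * e.
  have m4 : Num.min z 3 <= 4 by rewrite ge_min; apply/orP; right; lra.
  by have := @W_lip_e R r hr 1 s 0 e (Num.min z 3) isT hs m4; rewrite subr0 (ger0_norm e0).
have h2 := state_lip_uniform h0 (lX 3 s 0 z) x.
have h3 : `|lX 3 s 0 z - x| <= 20 * 200 * 3 * e by rewrite -xz distrC; exact: lX_lip_e.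
have s0 : state 3 s 0 (lX 3 s 0 z) = lU 3 s 0 z by exact: (eul_at P0 (erefl _)).
rewrite s0 in h2.
have h4 := ler_wpM2l slope_bound_ge0 h3.
have := ler_normD (lU 3 s e z - lU 3 s 0 z) (lU 3 s 0 z - state 3 s 0 x).
rewrite addrA subrK => /le_trans; apply; rewrite mulrDl -mulrA.
by apply: lerD => //; exact: le_trans h2 h4.
Qed.

(** It gives the perturbed families a meaning, with all their bounds, for every real eps and not
    only near 0+. *)
Definition clamp01 (h : R) := Num.max 0 (Num.min h 1).

Lemma clamp01_itv h : 0 <= clamp01 h <= 1.
Proof. by rewrite /clamp01 le_max lexx/= ge_max ler01 ge_min lexx orbT. Qed.

Lemma clamp01_id h : 0 < h < 1 -> clamp01 h = h.
Proof. by move=> /andP[h0 h1]; rewrite /clamp01 min_l ?max_r// ltW. Qed.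

Lemma clamp01_le h : 0 < h -> clamp01 h <= h.
Proof. by move=> h0; rewrite /clamp01 ge_max (ltW h0) ge_min lexx. Qed.

Lemma lip_cvg0 (f : R -> R) (l K : R) : 0 <= K -> (forall h, `|f h - l| <= K * clamp01 h) ->
  f h @[h --> 0^'+] --> l.
Proof.
move=> K0 hf; have K1 : 0 < K + 1 by rewrite ltr_wpDl.
apply/cvgrPdist_le => eps eps0; near=> h.
have h0 : 0 < h by [].
rewrite distrC (le_trans (hf h))// (le_trans (ler_wpM2l K0 (clamp01_le h0)))//.
have : h < eps / (K + 1) by near: h; apply: nbhs_right_lt; rewrite divr_gt0.
by rewrite ltr_pdivlMr//; nra.
Unshelve. all: by end_near. Qed.

Lemma C0norm_cvg0 :
  C0norm `[0, +oo[ (state 3 s (clamp01 eps) \- state 3 s 0) @[eps --> 0^'+] --> 0%E.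
Proof.
pose K := 20 + slope_bound * (20 * 200 * 3).
have K0 : 0 <= K by rewrite /K addr_ge0 ?ler0n// mulr_ge0 ?slope_bound_ge0 ?ler0n// !mulr_ge0 ?ler0n.
have cK : (K * clamp01 h)%:E @[h --> 0^'+] --> 0%E.
  apply: cvg_EFin; first exact: nearW.
  apply: (lip_cvg0 K0) => h; rewrite subr0 ger0_norm// mulr_ge0//.
  by case/andP: (clamp01_itv h).
apply: (squeeze_cvge _ (cvg_cst 0%E) cK).
apply: nearW => h; apply/andP; split.
  apply: (@le_trans _ _ `|(state 3 s (clamp01 h) \- state 3 s 0) 0|%:E); first by rewrite lee_fin.
  by apply: ereal_sup_ubound; exists 0 => //=; rewrite in_itv/= lexx.
by apply: ge_ereal_sup => _ [x _ <-]; rewrite lee_fin; apply: state_lip_e; exact: clamp01_itv.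
Qed.

Lemma inv_cvg_e z : inv (lX 3 s (clamp01 h)) (lX 3 s 0 z) @[h --> 0^'+] --> z.
Proof.
have h0 : 0 <= (0 : R) <= 1 by rewrite lexx ler01.
have P0 := state_profile hr hs h0 (nondegenerate_E (nondegenerate_neq0 (lexx 0))).
have qn0 := fun z => nondegenerate_lq hr hs (lexx 0) (nondegenerate_neq0 (lexx 0)) (z := z).
apply: (inv_cvg (X := lX 3 s 0)).
- by move=> a b; exact: (X_incr P0 qn0).
- apply: nearW => h; have /andP[c0 _] := clamp01_itv h.
  have P := state_profile hr hs (clamp01_itv h) (nondegenerate_E (nondegenerate_neq0 c0)).
  by split; [exact: (X_ndecr P)|exact: (invK P)].
- move=> y; apply: (@lip_cvg0 _ _ (20 * 200 * 3)); first by rewrite !mulr_ge0 ?ler0n.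
  by move=> h; apply: lX_lip_e; exact: clamp01_itv.
Qed.

(** On the energy range u_x = 1 / q at the preimage of x, which converges by [inv_cvg_e], and the
    limit of q is nonzero. Off that range q is 0 for every e. *)
Lemma derive1_state_cvg x : x \notin map (lX 3 s 0) (brk 3) ->
  derive1 (state 3 s (clamp01 h)) x @[h --> 0^'+] --> derive1 (state 3 s 0) x.
Proof.
have h0 : 0 <= (0 : R) <= 1 by rewrite lexx ler01.
have P0 := state_profile hr hs h0 (nondegenerate_E (nondegenerate_neq0 (lexx 0))).
have qn0 := fun z => nondegenerate_lq hr hs (lexx 0) (nondegenerate_neq0 (lexx 0)) (z := z).
rewrite (notin_map P0 qn0); set z := inv (lX 3 s 0) x => zB.
have xz : lX 3 s 0 z = x by exact: (invK P0).
pose zh h := inv (lX 3 s (clamp01 h)) x.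
have czh : zh h @[h --> 0^'+] --> z by rewrite /zh -xz; exact: inv_cvg_e.
have nzB : \forall h \near 0^'+, zh h \notin brk 3 by exact: (czh _ (notin_near zB)).
have d0 : derive1 (state 3 s 0) x = lq 3 s 0 z / jac 3 (lq 3 s 0) z by exact: (derive1_eul P0 qn0 zB).
rewrite [X in _ --> X]d0.
have dh : \forall h \near 0^'+, derive1 (state 3 s (clamp01 h)) x =
    lq 3 s (clamp01 h) (zh h) / jac 3 (lq 3 s (clamp01 h)) (zh h).
  apply: filterS nzB => h hB; have /andP[c0 _] := clamp01_itv h.
  have P := state_profile hr hs (clamp01_itv h) (nondegenerate_E (nondegenerate_neq0 c0)).
  exact: (derive1_eul P (fun z => nondegenerate_lq hr hs c0 (nondegenerate_neq0 c0) (z := z)) hB).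
have outside (A : set R) : (\forall y \near z, A y) -> (forall y e, A y -> 0 <= e -> lq 3 s e y = 0) ->
    derive1 (state 3 s (clamp01 h)) x @[h --> 0^'+] --> lq 3 s 0 z / jac 3 (lq 3 s 0) z.
  move=> nA hA; have Az := nbhs_singleton nA; rewrite (hA z 0 Az)// mul0r.
  apply: cvg_near_cst; apply: filterS2 dh (czh _ nA) => h -> Ah.
  by rewrite (hA _ _ Ah) ?mul0r//; case/andP: (clamp01_itv h).
case: (brk_cases zB) => [zn|zm|zp].
- apply: (outside _ (lt_nbhsl zn)) => y e y0 _; by rewrite /lq W_neg ?if_same// ltW.
- have q0 : lq 3 s 0 z != 0 by exact: qn0.
  have -> : lq 3 s 0 z / jac 3 (lq 3 s 0) z = (lq 3 s 0 z)^-1 by rewrite /jac zm; field.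
  have cq : lq 3 s (clamp01 h) (zh h) @[h --> 0^'+] --> lq 3 s 0 z.
    have c1 : lq 3 s 0 (zh h) @[h --> 0^'+] --> lq 3 s 0 z.
      exact: (cvg_comp _ _ czh (prq P0 zB)).
    have c2 : lq 3 s (clamp01 h) (zh h) - lq 3 s 0 (zh h) @[h --> 0^'+] --> 0.
      apply: (@lip_cvg0 _ _ 20); first by rewrite ler0n.
      move=> h; have := @lq_lip_e R r hr 3 s 0 (clamp01 h) (zh h) hs ltac:(lra).
      by rewrite !subr0 (ger0_norm (_ : 0 <= clamp01 h))//; case/andP: (clamp01_itv h).
    rewrite -[X in _ --> X]add0r (_ : (fun h => _) =
      fun h => (lq 3 s (clamp01 h) (zh h) - lq 3 s 0 (zh h)) + lq 3 s 0 (zh h)).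
      exact: (cvgD c2 c1).
    by apply/funext => h; rewrite subrK.
  have ci : (lq 3 s (clamp01 h) (zh h))^-1 @[h --> 0^'+] --> (lq 3 s 0 z)^-1 by exact: cvgV.
  apply: cvg_trans ci; apply: near_eq_cvg.
  have nin : \forall h \near 0^'+, 0 < zh h < 3 by exact: (czh _ (near_itvoo zm)).
  apply: filterS3 dh nzB nin => h -> hB hin.
  have /andP[c0 _] := clamp01_itv h.
  have qh := nondegenerate_lq hr hs c0 (nondegenerate_neq0 c0) hin hB.
  by rewrite /jac hin; field.
- by apply: (outside _ (lt_nbhsr zp)) => y e Ey _; rewrite /lq ltNge (ltW Ey).
Qed.

Lemma L2norm_cvg :
  L2norm `[0, +oo[ (derive1 (state 3 s (clamp01 eps)) \- derive1 (state 3 s 0)) @[eps --> 0^'+] --> 0%E.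
Proof.
have h0 : 0 <= (0 : R) <= 1 by rewrite lexx ler01.
have nd e : 0 <= e <= 1 -> nondegenerate 3 s e by move=> /andP[e0 _]; exact: nondegenerate_neq0.
have B e := fun he => derive1_state_boxed hs he slope_bound_ge0 (nd e he) (state_lip_uniform he).
apply: (@L2norm_at_right0 R (map (lX 3 s 0) (brk 3)) _ (slope_bound + slope_bound) (100 ^+ 2 * 3)
  (fun h x => derive1 (state 3 s (clamp01 h)) x - derive1 (state 3 s 0) x)) => //.
- by rewrite addr_ge0 ?slope_bound_ge0.
- move=> h; apply: measurable_funB; apply: measurable_derive1_state => //; try exact: clamp01_itv.
    exact/nd/clamp01_itv.
  exact: nd.
- move=> h _ x xD; rewrite (le_trans (ler_normB _ _))// mulrDl lerD//.
    exact: (B _ (clamp01_itv h)).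
  exact: (B _ h0).
- move=> x xD xB; have c := derive1_state_cvg xB.
  rewrite -[X in _ --> X](subrr (derive1 (state 3 s 0) x)).
  exact: (cvgB c (cvg_cst _)).
Qed.

End fixed_time.
End limits.

Theorem mainTheorem4 (R : realType) :
  let f : R -> R := fun z => z ^+ 3 in
  exists (t0 T eps0 : R) (ubar : R -> R) (ubar_ : R -> R -> R)
    (v : R -> R -> R) (u_ : R -> R -> R -> R),
  [/\ 0 < t0, t0 < T & 0 < eps0] /\
  admissible_datum ubar /\
  (forall eps : R, 0 < eps < eps0 -> admissible_datum (ubar_ eps)) /\
  is_dissipative_solution f T ubar v /\
  (forall eps : R, 0 < eps < eps0 ->
     is_dissipative_solution f T (ubar_ eps) (u_ eps)) /\
  C0norm `[0, +oo[ (ubar_ eps \- ubar) @[eps --> 0^'+] --> 0%E /\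
  L2norm `[0, +oo[ (derive1 (ubar_ eps) \- derive1 ubar) @[eps --> 0^'+] --> 0%E /\
  (forall t : R, t0 < t <= T ->
     exists2 xstar : R, 0 <= xstar &
       forall x : R, xstar < x ->
         exists2 l : R, u_ eps t x @[eps --> 0^'+] --> l & l <> v t x).
Proof.
move=> f; have [r r0 hr] := bes_near0 R.
have he0 : 0 <= (0 : R) <= 1 by rewrite lexx ler01.
have s0E : shifted r 0 = - (r / 24).
  by rewrite (shifted_id (r := r)) ?sub0r// lexx divr_ge0 ?ler0n// ltW.
have s0lt : shifted r 0 < 0 by rewrite s0E oppr_lt0 divr_gt0 ?ltr0n.
have s0n : shifted r 0 != 0 by rewrite lt_eqF.
have s0s := shifted_le r0 0.
(* At t = 0 v still carries the whole energy, so its datum is the member e = 0 of the family of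
   data. *)
have ubarE : family r (@lossy R) 0 0 = state 3 (shifted r 0) 0.
  by rewrite /family /lossy s0lt.
exists (r / 24), (r / 12), 1, (family r (@lossy R) 0 0), (fun eps => family r (fun=> 3) (clamp01 eps) 0),
  (family r (@lossy R) 0), (fun eps => family r (fun=> 3) (clamp01 eps)).
split; first by split; [rewrite divr_gt0 ?ltr0n|lra|exact: ltr01].
split; first by rewrite ubarE; apply: (state_admissible hr) => //; exact: nondegenerate_neq0.
split.
  move=> eps _; apply: (state_admissible hr) => //; first exact: clamp01_itv.
  by apply: nondegenerate_neq0 => //; case/andP: (clamp01_itv eps).
split; first exact: (lossy_dissipative r0 hr).
split.
  move=> eps heps; apply: (conservative_dissipative r0 hr); rewrite clamp01_id//.
  by case/andP: heps => -> /ltW.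
split; first by rewrite ubarE; exact: (C0norm_cvg0 hr s0s s0n).
split; first by rewrite ubarE; exact: (L2norm_cvg hr s0s s0n).
move=> t /andP[t0 tT]; exists (100 ^+ 2 * 3); first by rewrite mulr_ge0 ?exprn_ge0 ?ler0n.
move=> x hx.
have tin : 0 <= t <= r / 12 by rewrite tT andbT ltW// (lt_trans _ t0)// divr_gt0 ?ltr0n.
have st := shifted_id tin; have ss := shifted_le r0 t.
have sp : 0 < shifted r t by rewrite st subr_gt0.
set s := shifted r t in st ss sp.
have sn : s != 0 by rewrite gt_eqF.
have vE : family r (@lossy R) 0 t x = W 1 s 0 2.
  rewrite /family -/s /lossy ltNge (ltW sp)/=.
  have E2 : 2 <= (2 : R) <= 3 by apply/andP; split; lra.
  have P := state_profile hr ss he0 E2.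
  rewrite /state (eul_right P (ltW (state_tail hr ss he0 E2 hx))).
  by rewrite /lU minxx.
exists (W 1 s 0 3); last first.
  rewrite vE => h; suff : - W 1 s 0 2 < - W 1 s 0 3 by rewrite h ltxx.
  have r23 : (2 : R) < 3 by lra.
  apply: (incr_off_finite (B := [::]) (f := \- W 1 s 0) (df := fun z => - W 0 s 0 z) r23).
  - by apply: continuous_subspaceT => z; apply: cvgN; exact: continuous_WS.
  - move=> z /andP[z2 z3] _; apply: is_deriveN; apply: is_derive_W.
    by rewrite !inE !negb_or; apply/and3P; split; rewrite gt_eqF//; lra.
  - move=> z hz _; have := W0_piece3 hr ss (lexx 0) hz.
    have : 0 < s ^+ 2 by rewrite exprn_even_gt0.
    by lra.
have uE h : family r (fun=> 3) (clamp01 h) t x = W 1 s (clamp01 h) 3.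
  rewrite /family -/s; have E3 : 2 <= (3 : R) <= 3 by apply/andP; split; lra.
  have P := state_profile hr ss (clamp01_itv h) E3.
  rewrite /state (eul_right P (ltW (state_tail hr ss (clamp01_itv h) E3 hx))).
  by rewrite /lU minxx.
apply: (@lip_cvg0 _ _ _ 20); first by rewrite ler0n.
move=> h; rewrite uE; have h34 : (3 : R) <= 4 by lra.
have := @W_lip_e R r hr 1 s 0 (clamp01 h) 3 isT ss h34.
by rewrite subr0 (ger0_norm (_ : 0 <= clamp01 h))//; case/andP: (clamp01_itv h).
Qed.
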